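(* For each $\beta\in Q^\vee_<$, each $i\in I_{\mathrm{af}}$ and each $\xi\in K_H(\mathrm{Gr})$, $$D_i([\mathcal O_{\mathrm{Gr}_\beta}]\odot\xi)=[\mathcal O_{\mathrm{Gr}_\beta}]\odot D_i(\xi).$$
   Context: $G$ is a connected, simply connected simple algebraic group over $\mathbb C$, with Borel $B$, maximal torus $H$, Weyl group $W$ with longest element $w_0$, weight lattice $P$, simple roots $\alpha_i$ ($i\in I$), highest root $\vartheta$ with coroot $\vartheta^\vee$, coroot lattice $Q^\vee$, $Q^\vee_<=\{\beta\in Q^\vee:\langle\beta,\alpha_i\rangle<0\ \forall i\in I\}$. $W_{\mathrm{af}}=W\ltimes Q^\vee$ with translations $t_\beta$, a Coxeter group generated by $s_i$, $i\in I_{\mathrm{af}}=I\cup\{0\}$, $s_\vartheta s_0=t_{-\vartheta^\vee}$; it acts on $P$ through $W_{\mathrm{af}}\to W$. $\mathbb CP$ is the group algebra of $P$, $\mathbb C(P)$ its fraction field. Nil-DAHA $\mathscr H$: generated by $e^\lambda$, $D_i$ ($i\in I_{\mathrm{af}}$) with $e^{\lambda+\mu}=e^\lambda e^\mu$, $D_i^2=D_i$, braid relations of $W_{\mathrm{af}}$, $D_ie^\lambda-e^{s_i\lambda}D_i=\frac{e^\lambda-e^{s_i\lambda}}{1-e^{\alpha_i}}$ ($i\in I$), $D_0e^\lambda-e^{s_\vartheta\lambda}D_0=\frac{e^\lambda-e^{s_\vartheta\lambda}}{1-e^{-\vartheta}}$; $D_w$ is the product along a reduced word. $\mathscr A=\mathbb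 C(P)\otimes\mathbb CW_{\mathrm{af}}$ with $(f\otimes w)(g\otimes v)=f\,w(g)\otimes wv$; embedding $\iota^*:\mathscr H\to\mathscr A$: $e^\lambda\mapsto e^\lambda\otimes1$, $D_i\mapsto\frac1{1-e^{\alpha_i}}\otimes1-\frac{e^{\alpha_i}}{1-e^{\alpha_i}}\otimes s_i$ ($i\in I$), $D_0\mapsto\frac1{1-e^{-\vartheta}}\otimes1-\frac{e^{-\vartheta}}{1-e^{-\vartheta}}\otimes s_0$. $\mathrm{Gr}=G(\!(z)\!)/G[\![z]\!]$ with Iwahori-orbit closures $\mathrm{Gr}_\beta$ ($\beta\in Q^\vee$). $K_H(\mathrm{Gr})=\bigoplus_\beta\mathbb CP[\mathcal O_{\mathrm{Gr}_\beta}]$ is identified with the left ideal $\mathscr HD_{w_0}$ via $e^\lambda[\mathcal O_{\mathrm{Gr}_\beta}]\mapsto e^\lambda D_{t_\beta}D_{w_0}$; $\mathscr H$ acts on it by left multiplication. $\mathscr C=\mathbb C(P)\otimes\mathbb CQ^\vee\subset\mathscr A$ is commutative; $\mathsf{pr}(f\otimes t_\beta w)=f\otimes t_\beta$ ($w\in W$). $\mathsf{pr}\circ\iota^*:K_H(\mathrm{Gr})\to\mathscr C$ is injective onto a subring; the transported product is the Pontryagin product $\odot$. *)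

(* Defs.v *)
From HB Require Import structures.
From mathcomp Require Import all_boot all_order all_algebra.
From mathcomp Require Import fraction mpoly complex Rstruct.
From Stdlib Require Import ClassicalEpsilon.

Set Implicit Arguments.
Unset Strict Implicit.
Unset Printing Implicit Defensive.

Import GRing.Theory Num.Theory.
Local Open Scope ring_scope.

Notation CC := (complex Rdefinitions.R).

Section NilDAHA.

Variable n : nat.
(* Cartan matrix A i j = <alpha_i^vee, alpha_j>, I = 'I_n. *)
Variable A : 'M[int]_n.

Definition finite_type_cartan : Prop :=
  [/\ (forall i, A i i = 2),
      (forall i j, i != j -> A i j <= 0),
      (forall i j, (A i j == 0) = (A j i == 0)) &
      exists d : 'I_n -> int,
        [/\ (forall i, 0 < d i),
            (forall i j, d i * A i j = d j * A j i) &
            forall x : 'I_n -> rat, (exists i, x i != 0) ->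
              0 < \sum_i \sum_j x i * x j * (d i * A i j)%:~R]].

(* indecomposable = irreducible root system = simple group *)
Definition indecomposable_cartan : Prop :=
  forall S : {set 'I_n},
    (forall i j, i \in S -> j \notin S -> A i j = 0) -> S = set0 \/ S = setT.

(* Weight lattice P = Z^I in the basis of fundamental weights;
   coroot lattice Q^vee = Z^I in the basis of simple coroots
   (G simply connected, so P and Q^vee are dual lattices). *)
Definition pairing (b l : 'cV[int]_n) : int := \sum_i b i ord0 * l i ord0.

Definition sroot (i : 'I_n) : 'cV[int]_n := col i A.
Definition scoroot (i : 'I_n) : 'cV[int]_n := delta_mx i ord0.

Definition sP (i : 'I_n) : 'M[int]_n := 1%:M - sroot i *m (scoroot i)^T.
Definition sQ (i : 'I_n) : 'M[int]_n := 1%:M - scoroot i *m (sroot i)^T.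

Definition wP (s : seq 'I_n) : 'M[int]_n := foldr (fun i M => sP i *m M) 1%:M s.
Definition wQ (s : seq 'I_n) : 'M[int]_n := foldr (fun i M => sQ i *m M) 1%:M s.

Definition is_root (l : 'cV[int]_n) : Prop := exists s i, wP s *m sroot i = l.

Definition nonneg_rootlat (l : 'cV[int]_n) : Prop :=
  exists c : 'cV[int]_n, (forall j, 0 <= c j ord0) /\ A *m c = l.

Definition is_highest_root (th : 'cV[int]_n) : Prop :=
  is_root th /\ forall l, is_root l -> nonneg_rootlat (th - l).

Definition theta : 'cV[int]_n := epsilon (inhabits 0) is_highest_root.

(* its coroot: if theta = w alpha_i then theta^vee = w alpha_i^vee *)
Definition thetav : 'cV[int]_n :=
  epsilon (inhabits 0) (fun v => exists s i,
    wP s *m sroot i = theta /\ wQ s *m scoroot i = v).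

(* An element t_b w is encoded by (w acting on P, w acting on Q^vee, b). *)
Definition Waf := ('M[int]_n * 'M[int]_n * 'cV[int]_n)%type.

Definition oneW : Waf := (1%:M, 1%:M, 0).
Definition mulW (g h : Waf) : Waf :=
  (g.1.1 *m h.1.1, g.1.2 *m h.1.2, g.2 + g.1.2 *m h.2).
Definition transl (b : 'cV[int]_n) : Waf := (1%:M, 1%:M, b).

(* I_af = option 'I_n, with None standing for the affine node 0;
   s_0 = s_theta t_{-theta^vee} = t_{theta^vee} s_theta *)
Definition genW (i : option 'I_n) : Waf :=
  match i with
  | Some i => (sP i, sQ i, 0)
  | None => (1%:M - theta *m thetav^T, 1%:M - thetav *m theta^T, thetav)
  end.

Definition wordW (s : seq (option 'I_n)) : Waf :=
  foldr (fun i g => mulW (genW i) g) oneW s.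

Definition is_reduced (s : seq (option 'I_n)) : Prop :=
  forall s', wordW s' = wordW s -> (size s <= size s')%N.

Definition w0_word : seq 'I_n :=
  epsilon (inhabits [::]) (fun s : seq 'I_n => is_reduced (map Some s) /\
    forall s' : seq 'I_n, is_reduced (map Some s') -> (size s' <= size s)%N).
Definition w0 : Waf := wordW (map Some w0_word).

Definition CP := {fraction {mpoly CC[n]}}.

Definition cst (c : CC) : CP := FracField.tofrac (c%:MP).
Definition eexp (l : 'cV[int]_n) : CP :=
  \prod_(i < n) ((FracField.tofrac ('X_i : {mpoly CC[n]})) ^ (l i ord0)).

Definition is_Waction (M : 'M[int]_n) (sigma : CP -> CP) : Prop :=
  [/\ (forall x y, sigma (x + y) = sigma x + sigma y),
      (forall x y, sigma (x * y) = sigma x * sigma y),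
      sigma 1 = 1,
      (forall c, sigma (cst c) = cst c) &
      (forall l, sigma (eexp l) = eexp (M *m l))].

Definition actF (M : 'M[int]_n) : CP -> CP :=
  epsilon (inhabits id) (is_Waction M).

(* elements are finite formal sums sum_k f_k (x) g_k, considered up to eqA *)
Definition Aelt := seq (CP * Waf).

Definition coefA (a : Aelt) (g : Waf) : CP := \sum_(p <- a | p.2 == g) p.1.
Definition eqA (a b : Aelt) : Prop := forall g, coefA a g = coefA b g.

Definition addA (a b : Aelt) : Aelt := a ++ b.
Definition mulA (a b : Aelt) : Aelt :=
  [seq (p.1 * actF p.2.1.1 q.1, mulW p.2 q.2) | p <- a, q <- b].
Definition oneA : Aelt := [:: (1, oneW)].

Definition iotaE (l : 'cV[int]_n) : Aelt := [:: (eexp l, oneW)].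

Definition iotaD (i : option 'I_n) : Aelt :=
  let a := match i with Some i => eexp (sroot i) | None => eexp (- theta) end in
  [:: ((1 - a)^-1, oneW); (- (a / (1 - a)), genW i)].

Definition Dword (s : seq (option 'I_n)) : Aelt :=
  foldr (fun i a => mulA (iotaD i) a) oneA s.
Definition Dw (g : Waf) : Aelt :=
  Dword (epsilon (inhabits [::]) (fun s => wordW s = g /\ is_reduced s)).

(* The nil-DAHA H, identified with its image under iota^*: the C-subalgebra
   of A generated by the e^lambda and the D_i. *)
Inductive inH : Aelt -> Prop :=
  | inH_cst c : inH [:: (cst c, oneW)]
  | inH_e l : inH (iotaE l)
  | inH_D i : inH (iotaD i)
  | inH_add a b : inH a -> inH b -> inH (addA a b)
  | inH_mul a b : inH a -> inH b -> inH (mulA a b)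
  | inH_eq a b : eqA a b -> inH a -> inH b.

(* K_H(Gr) = the left ideal H D_{w0} *)
Definition inK (x : Aelt) : Prop := exists h, inH h /\ eqA x (mulA h (Dw w0)).

Definition OGr (b : 'cV[int]_n) : Aelt := mulA (Dw (transl b)) (Dw w0).

Definition prA (a : Aelt) : Aelt := [seq (p.1, transl p.2.2) | p <- a].

Definition pont (a b : Aelt) : Aelt :=
  epsilon (inhabits [::]) (fun c => inK c /\ eqA (prA c) (mulA (prA a) (prA b))).

Definition Dact (i : option 'I_n) (x : Aelt) : Aelt := mulA (iotaD i) x.

End NilDAHA.

(* Main.v *)
(** Every element [x] of [K = H D_{w0}] satisfies [x = pr(x) D_{w0}],
    because [w D_{w0} = D_{w0}] for [w] in the finite Weyl group; hence [pr] is injective on [K]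
    and [pr (h X) = pr(h) pr(X)] as soon as [X] is left [W]-invariant.  For [b] strictly
    antidominant all finite simple reflections are left descents of [t_b], so that
    [D_i D_{t_b} = D_{t_b}] and [O_b = D_{t_b} D_{w0}] is left [W]-invariant.  Therefore
    [O_b * (h D_{w0}) = h O_b], which visibly commutes with left multiplication by [D_i].

    The identity [D_i D_w = D_w] for a left descent [i] of [w] is Matsumoto's theorem for the
    operators [D_i]: the exchange property comes from the affine root system, and the braid
    relations from Demazure's formula [sum_w w (1 / prod (1 - e^alpha))] in rank two. *)
Require Import Defs.
From HB Require Import structures.
From mathcomp Require Import all_boot all_order all_algebra.
From mathcomp Require Import fraction generic_quotient mpoly complex Rstruct.
From mathcomp Require Import zify ring.
From Stdlib Require Import ClassicalEpsilon Classical FunctionalExtensionality.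

Set Implicit Arguments.
Unset Strict Implicit.
Unset Printing Implicit Defensive.

Import Order.TTheory GRing.Theory Num.Theory.
Local Open Scope ring_scope.
Local Open Scope quotient_scope.

(** * Demazure operators of rank two *)

(** Almost every object is a choice by [epsilon]: [theta], [thetav], [w0_word], [actF], the reduced
    word in [Dw], the product [pont]. Each can be used only once its defining property is shown to
    be satisfiable, and this is what calls for root system theory: a highest root, finiteness of W,
    the extension of W to the fraction field, and the fact that [transl b] is a word in the
    generators, without which [Dw (transl b)] would be arbitrary. As [Dw] fixes one unknown reduced
    word, a descent can be brought to its front only because all reduced words give the same
    element. Elements of the algebra are lists up to [eqA]. Computations move to the coefficient
    functions [coefA a], where left multiplication by D_i is D = (1 + S) o (1 - x)^{-1}, with S the
    twisted left translation. The image of D is S-invariant, which turns a descent into left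
    invariance. Two simple affine roots with sum delta generate an infinite dihedral group, which
    has no braid relation; they are never descents of the same element. *)

Definition twist (F K : Type) (sg : F -> F) (s : K -> K) (f : K -> F) : K -> F :=
  fun k => sg (f (s k)).

(** On coefficient functions over a group [K], with [s] the left translation by a reflection,
    [twist] is left multiplication by that reflection and [dop] left multiplication by the image of
    D under the embedding. No inverse of [s] is written since [s] is an involution. *)
Definition dop (F : fieldType) (K : Type) (x : F) (sg : F -> F) (s : K -> K)
    (f : K -> F) : K -> F :=
  fun k => (1 - x)^-1 * f k + - (x / (1 - x)) * sg (f (s k)).

Lemma neq0_eq (F : fieldType) (a b : F) : a != 0 -> a = b -> b != 0.
Proof. by move=> h <-. Qed.

Section OneReflection.
Variables (F : fieldType) (K : Type) (sg : {rmorphism F -> F}) (s : K -> K) (x : F).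
Hypotheses (sgsg : involutive sg) (ss : involutive s).
Hypotheses (sgx : sg x = x^-1) (x0 : x != 0) (hx : 1 - x != 0).

(** With [sg x = x^-1], the coefficient of the reflected term is the image of the first one, so D =
    (1 + S) o (1 - x)^{-1}. Invariance of the image and Demazure's formula both start here. *)
Lemma rmorph_dopC : sg (1 - x)^-1 = - (x / (1 - x)).
Proof.
rewrite fmorphV rmorphB rmorph1 sgx; field; rewrite ?x0 hx ?andbT /=.
by apply: (neq0_eq (a := - (1 - x))); rewrite ?oppr_eq0 //; ring.
Qed.

Lemma twist_dop (f : K -> F) : twist sg s (dop x sg s f) = dop x sg s f.
Proof.
apply: functional_extensionality => k; rewrite /twist /dop ss.
rewrite rmorphD !rmorphM -rmorph_dopC !sgsg [RHS]addrC; congr (_ + _).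
Qed.

(** A [sg]-invariant factor commutes with D, so it can join (1 - x)^{-1} inside [g]. *)
Lemma dop_sum (e : F) (f : K -> F) : sg e = e ->
  let g k := e / (1 - x) * f k in
  forall k, e * dop x sg s f k = g k + twist sg s g k.
Proof.
move=> he g k; rewrite /g /twist /dop !rmorphM he rmorph_dopC; ring.
Qed.
End OneReflection.

Section Dihedral.
Variables (F : fieldType) (K : Type) (sg ta : {rmorphism F -> F}) (s t : K -> K) (x y : F).
Hypotheses (sgsg : involutive sg) (tata : involutive ta).
Hypotheses (ss : involutive s) (tt : involutive t).
Hypotheses (sgx : sg x = x^-1) (tay : ta y = y^-1) (x0 : x != 0) (y0 : y != 0).
Hypotheses (hx : 1 - x != 0) (hy : 1 - y != 0).

Local Notation S := (twist sg s).
Local Notation T := (twist ta t).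
Local Notation D1 := (dop x sg s).
Local Notation D2 := (dop y ta t).

(* The coefficients in the [half_*] lemmas below are those of the partial products [D1 v],
   [D2 (D1 v)], ... on the orbit [v, S v, T (S v), ...] of a [T]-invariant [v]; the last one
   is the orbit sum of [e v], with [e] the inverse product over the positive roots other
   than [y]. *)
Definition lc4 (c0 c1 c2 c3 : F) (v0 v1 v2 v3 : K -> F) : K -> F :=
  fun k => c0 * v0 k + c1 * v1 k + c2 * v2 k + c3 * v3 k.
Definition lc6 (c0 c1 c2 c3 c4 c5 : F) (v0 v1 v2 v3 v4 v5 : K -> F) : K -> F :=
  fun k => c0 * v0 k + c1 * v1 k + c2 * v2 k + c3 * v3 k + c4 * v4 k + c5 * v5 k.

Lemma D1_lc6 c0 c1 c2 c3 c4 c5 e0 e1 e2 e3 e4 e5 v0 v1 v2 v3 v4 v5 :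
  S v0 = v1 -> S v2 = v3 -> S v4 = v5 ->
  (1 - x)^-1 * c0 - x / (1 - x) * sg c1 = e0 ->
  (1 - x)^-1 * c1 - x / (1 - x) * sg c0 = e1 ->
  (1 - x)^-1 * c2 - x / (1 - x) * sg c3 = e2 ->
  (1 - x)^-1 * c3 - x / (1 - x) * sg c2 = e3 ->
  (1 - x)^-1 * c4 - x / (1 - x) * sg c5 = e4 ->
  (1 - x)^-1 * c5 - x / (1 - x) * sg c4 = e5 ->
  D1 (lc6 c0 c1 c2 c3 c4 c5 v0 v1 v2 v3 v4 v5) = lc6 e0 e1 e2 e3 e4 e5 v0 v1 v2 v3 v4 v5.
Proof.
move=> <- <- <- <- <- <- <- <- <-; apply: functional_extensionality => k.
by rewrite /dop /lc6 /twist !rmorphD !rmorphM !ss !sgsg; ring.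
Qed.

Lemma D2_lc6 c0 c1 c2 c3 c4 c5 e0 e1 e2 e3 e4 e5 v0 v1 v2 v3 v4 v5 :
  T v0 = v0 -> T v1 = v2 -> T v3 = v4 -> T v5 = v5 ->
  (1 - y)^-1 * c0 - y / (1 - y) * ta c0 = e0 ->
  (1 - y)^-1 * c1 - y / (1 - y) * ta c2 = e1 ->
  (1 - y)^-1 * c2 - y / (1 - y) * ta c1 = e2 ->
  (1 - y)^-1 * c3 - y / (1 - y) * ta c4 = e3 ->
  (1 - y)^-1 * c4 - y / (1 - y) * ta c3 = e4 ->
  (1 - y)^-1 * c5 - y / (1 - y) * ta c5 = e5 ->
  D2 (lc6 c0 c1 c2 c3 c4 c5 v0 v1 v2 v3 v4 v5) = lc6 e0 e1 e2 e3 e4 e5 v0 v1 v2 v3 v4 v5.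
Proof.
move=> e0' <- <- e5' <- <- <- <- <- <-; apply: functional_extensionality => k.
rewrite /dop /lc6 !rmorphD !rmorphM -![ta (v0 _)]/(T v0 k) -![ta (v5 _)]/(T v5 k) e0' e5'.
by rewrite /twist !tt !tata; ring.
Qed.

Lemma D1_lc4 c0 c1 c2 c3 e0 e1 e2 e3 v0 v1 v2 v3 :
  S v0 = v1 -> S v2 = v3 ->
  (1 - x)^-1 * c0 - x / (1 - x) * sg c1 = e0 ->
  (1 - x)^-1 * c1 - x / (1 - x) * sg c0 = e1 ->
  (1 - x)^-1 * c2 - x / (1 - x) * sg c3 = e2 ->
  (1 - x)^-1 * c3 - x / (1 - x) * sg c2 = e3 ->
  D1 (lc4 c0 c1 c2 c3 v0 v1 v2 v3) = lc4 e0 e1 e2 e3 v0 v1 v2 v3.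
Proof.
move=> <- <- <- <- <- <-; apply: functional_extensionality => k.
by rewrite /dop /lc4 /twist !rmorphD !rmorphM !ss !sgsg; ring.
Qed.

Lemma D2_lc4 c0 c1 c2 c3 e0 e1 e2 e3 v0 v1 v2 v3 :
  T v0 = v0 -> T v1 = v2 -> T v3 = v3 ->
  (1 - y)^-1 * c0 - y / (1 - y) * ta c0 = e0 ->
  (1 - y)^-1 * c1 - y / (1 - y) * ta c2 = e1 ->
  (1 - y)^-1 * c2 - y / (1 - y) * ta c1 = e2 ->
  (1 - y)^-1 * c3 - y / (1 - y) * ta c3 = e3 ->
  D2 (lc4 c0 c1 c2 c3 v0 v1 v2 v3) = lc4 e0 e1 e2 e3 v0 v1 v2 v3.
Proof.
move=> e0' <- e3' <- <- <- <-; apply: functional_extensionality => k.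
rewrite /dop /lc4 !rmorphD !rmorphM -![ta (v0 _)]/(T v0 k) -![ta (v3 _)]/(T v3 k) e0' e3'.
by rewrite /twist !tt !tata; ring.
Qed.

(** The positive roots are x, y, xy. The relation has odd length, so its innermost operator is again
    [D1]: here the orbit starts at an [S]-invariant function and [e] runs over the positive roots
    other than [x]. *)
Lemma half_A2 v : sg y = x * y -> ta x = x * y -> S v = v -> 1 - x * y != 0 ->
  let e := ((1 - y) * (1 - x * y))^-1 in
  D1 (D2 v) = fun k => e * v k + ta e * T v k + sg (ta e) * S (T v) k.
Proof.
move=> sgy tax hS h3 e; apply: functional_extensionality => k.
have s2 : sg (1 - y) = 1 - x * y by rewrite rmorphB rmorph1 sgy.
have s1 : sg (1 - x) = - ((1 - x) / x) by rewrite rmorphB rmorph1 sgx; field.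
have t2 : ta (1 - y) = - ((1 - y) / y) by rewrite rmorphB rmorph1 tay; field.
have t3 : ta (1 - x * y) = 1 - x.
  by rewrite rmorphB !(rmorph1, rmorphM, tax, tay); field.
have e1 : ta e = - y / ((1 - y) * (1 - x)).
  by rewrite /e !(t2, t3, rmorphM, fmorphV); field; rewrite ?oppr_eq0 ?y0 ?hx ?hy.
have e2 : sg (ta e) = x ^+ 2 * y / ((1 - x * y) * (1 - x)).
  by rewrite e1 !(s1, s2, rmorphM, rmorphN, fmorphV, sgy);
    field; rewrite ?oppr_eq0 ?x0 ?hx ?h3.
have hSk : sg (v (s k)) = v k by rewrite -[LHS]/(S v k) hS.
rewrite e2 e1 /dop /twist !(s2, rmorphM, fmorphV, rmorphN, rmorphD) hSk sgy /e.
move: (v k) (ta (v (t k))) (sg (ta (v (t (s k))))) => a b c.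
field; rewrite ?oppr_eq0 ?x0 ?y0 ?hx ?hy ?h3 //.
Qed.

(** Here [x] is the short simple root and the positive roots are x, y, xy, x^2 y. The braid relation
    at a [T]-invariant [v] makes the last function of the orbit [T]-invariant too, which closes the
    orbit under both reflections. *)
Lemma half_C2_short v : sg y = x ^+ 2 * y -> ta x = x * y -> T v = v ->
  T (S (T (S v))) = S (T (S (T v))) ->
  1 - x * y != 0 -> 1 - x ^+ 2 * y != 0 ->
  let e := ((1 - x) * (1 - x * y) * (1 - x ^+ 2 * y))^-1 in
  D1 (D2 (D1 v)) =
  lc4 e (sg e) (ta (sg e)) (sg (ta (sg e)))
    v (S v) (T (S v)) (S (T (S v))).
Proof.
move=> sgy tax hT br h3 h4 e.
have s1 : sg (1 - x) = - ((1 - x) / x).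
  by rewrite rmorphB !(rmorph1, rmorphM, rmorphXn, sgx, sgy, tax, tay); field.
have s2 : sg (1 - y) = 1 - x ^+ 2 * y.
  by rewrite rmorphB !(rmorph1, rmorphM, rmorphXn, sgx, sgy, tax, tay); field.
have s3 : sg (1 - x * y) = 1 - x * y.
  by rewrite rmorphB !(rmorph1, rmorphM, rmorphXn, sgx, sgy, tax, tay); field.
have s4 : sg (1 - x ^+ 2 * y) = 1 - y.
  by rewrite rmorphB !(rmorph1, rmorphM, rmorphXn, sgx, sgy, tax, tay); field.
have t1 : ta (1 - x) = 1 - x * y.
  by rewrite rmorphB !(rmorph1, rmorphM, rmorphXn, sgx, sgy, tax, tay); field.
have t2 : ta (1 - y) = - ((1 - y) / y).
  by rewrite rmorphB !(rmorph1, rmorphM, rmorphXn, sgx, sgy, tax, tay); field.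
have t3 : ta (1 - x * y) = 1 - x.
  by rewrite rmorphB !(rmorph1, rmorphM, rmorphXn, sgx, sgy, tax, tay); field.
have t4 : ta (1 - x ^+ 2 * y) = 1 - x ^+ 2 * y.
  by rewrite rmorphB !(rmorph1, rmorphM, rmorphXn, sgx, sgy, tax, tay); field.
have sE := (s1, s2, s3, s4, sgx, sgy).
have tE := (t1, t2, t3, t4, tay, tax).
have nz := (oppr_eq0, x0, y0, hx, hy, h3, h4).
have e1 : sg e = (- x) / ((1 - y) * (1 - x) * (1 - x * y)).
  rewrite /e !(sE, rmorphM, fmorphV, rmorphN, rmorphXn, rmorphD, rmorph1, rmorph0).
  by field; rewrite !nz.
have e2 : ta (sg e) = (x * y ^+ 2) / ((1 - y) * (1 - x) * (1 - x * y)).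
  rewrite e1 !(tE, rmorphM, fmorphV, rmorphN, rmorphXn, rmorphD, rmorph1, rmorph0).
  by field; rewrite !nz.
have e3 : sg (ta (sg e)) = (- x ^+ 4 * y ^+ 2) / ((1 - x) * (1 - x * y) * (1 - x ^+ 2 * y)).
  rewrite e2 !(sE, rmorphM, fmorphV, rmorphN, rmorphXn, rmorphD, rmorph1, rmorph0).
  by field; rewrite !nz.
set v1 := S v; set v2 := T v1; set v3 := S v2.
have Tl : T v3 = v3 by rewrite [LHS]br hT.
have vE : v = lc4 1 0 0 0 v v1 v2 v3.
  by apply: functional_extensionality => k; rewrite /lc4; ring.
have d1 : D1 (lc4 1 0 0 0 v v1 v2 v3) =
  lc4
    ((1) / ((1 - x))) ((- x) / ((1 - x))) 0 0
    v v1 v2 v3.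
  apply: (D1_lc4 erefl erefl);
    rewrite !(sE, rmorphM, fmorphV, rmorphN, rmorphXn, rmorphD, rmorph1, rmorph0);
    by field; rewrite !nz.
have d2 : D2 (lc4
    ((1) / ((1 - x))) ((- x) / ((1 - x))) 0 0
    v v1 v2 v3) =
  lc4
    ((1) / ((1 - x) * (1 - x * y))) ((- x) / ((1 - y) * (1 - x)))
    ((x * y ^+ 2) / ((1 - y) * (1 - x * y))) 0
    v v1 v2 v3.
  apply: (D2_lc4 hT erefl Tl);
    rewrite !(tE, rmorphM, fmorphV, rmorphN, rmorphXn, rmorphD, rmorph1, rmorph0);
    by field; rewrite !nz.
have d3 : D1 (lc4
    ((1) / ((1 - x) * (1 - x * y))) ((- x) / ((1 - y) * (1 - x)))
    ((x * y ^+ 2) / ((1 - y) * (1 - x * y))) 0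
    v v1 v2 v3) =
  lc4 e (sg e) (ta (sg e)) (sg (ta (sg e))) v v1 v2 v3.
  apply: (D1_lc4 erefl erefl);
    rewrite ?e3 ?e2 ?e1 ?/e !(sE, rmorphM, fmorphV, rmorphN, rmorphXn, rmorphD, rmorph1, rmorph0);
    by field; rewrite !nz.
by rewrite [in LHS]vE d1 d2 d3.
Qed.

(** The companion with [x] long: the two sides of one braid relation exchange the roles of the
    simple roots, so each side uses one of the two forms. *)
Lemma half_C2_long v : sg y = x * y -> ta x = x * y ^+ 2 -> T v = v ->
  T (S (T (S v))) = S (T (S (T v))) ->
  1 - x * y != 0 -> 1 - x * y ^+ 2 != 0 ->
  let e := ((1 - x) * (1 - x * y) * (1 - x * y ^+ 2))^-1 in
  D1 (D2 (D1 v)) =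
  lc4 e (sg e) (ta (sg e)) (sg (ta (sg e)))
    v (S v) (T (S v)) (S (T (S v))).
Proof.
move=> sgy tax hT br h3 h4 e.
have s1 : sg (1 - x) = - ((1 - x) / x).
  by rewrite rmorphB !(rmorph1, rmorphM, rmorphXn, sgx, sgy, tax, tay); field.
have s2 : sg (1 - y) = 1 - x * y.
  by rewrite rmorphB !(rmorph1, rmorphM, rmorphXn, sgx, sgy, tax, tay); field.
have s3 : sg (1 - x * y) = 1 - y.
  by rewrite rmorphB !(rmorph1, rmorphM, rmorphXn, sgx, sgy, tax, tay); field.
have s4 : sg (1 - x * y ^+ 2) = 1 - x * y ^+ 2.
  by rewrite rmorphB !(rmorph1, rmorphM, rmorphXn, sgx, sgy, tax, tay); field.
have t1 : ta (1 - x) = 1 - x * y ^+ 2.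
  by rewrite rmorphB !(rmorph1, rmorphM, rmorphXn, sgx, sgy, tax, tay); field.
have t2 : ta (1 - y) = - ((1 - y) / y).
  by rewrite rmorphB !(rmorph1, rmorphM, rmorphXn, sgx, sgy, tax, tay); field.
have t3 : ta (1 - x * y) = 1 - x * y.
  by rewrite rmorphB !(rmorph1, rmorphM, rmorphXn, sgx, sgy, tax, tay); field.
have t4 : ta (1 - x * y ^+ 2) = 1 - x.
  by rewrite rmorphB !(rmorph1, rmorphM, rmorphXn, sgx, sgy, tax, tay); field.
have sE := (s1, s2, s3, s4, sgx, sgy).
have tE := (t1, t2, t3, t4, tay, tax).
have nz := (oppr_eq0, x0, y0, hx, hy, h3, h4).
have e1 : sg e = (- x) / ((1 - y) * (1 - x) * (1 - x * y ^+ 2)).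
  rewrite /e !(sE, rmorphM, fmorphV, rmorphN, rmorphXn, rmorphD, rmorph1, rmorph0).
  by field; rewrite !nz.
have e2 : ta (sg e) = (x * y ^+ 3) / ((1 - y) * (1 - x) * (1 - x * y ^+ 2)).
  rewrite e1 !(tE, rmorphM, fmorphV, rmorphN, rmorphXn, rmorphD, rmorph1, rmorph0).
  by field; rewrite !nz.
have e3 : sg (ta (sg e)) = (- x ^+ 3 * y ^+ 3) / ((1 - x) * (1 - x * y) * (1 - x * y ^+ 2)).
  rewrite e2 !(sE, rmorphM, fmorphV, rmorphN, rmorphXn, rmorphD, rmorph1, rmorph0).
  by field; rewrite !nz.
set v1 := S v; set v2 := T v1; set v3 := S v2.
have Tl : T v3 = v3 by rewrite [LHS]br hT.
have vE : v = lc4 1 0 0 0 v v1 v2 v3.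
  by apply: functional_extensionality => k; rewrite /lc4; ring.
have d1 : D1 (lc4 1 0 0 0 v v1 v2 v3) =
  lc4
    ((1) / ((1 - x))) ((- x) / ((1 - x))) 0 0
    v v1 v2 v3.
  apply: (D1_lc4 erefl erefl);
    rewrite !(sE, rmorphM, fmorphV, rmorphN, rmorphXn, rmorphD, rmorph1, rmorph0);
    by field; rewrite !nz.
have d2 : D2 (lc4
    ((1) / ((1 - x))) ((- x) / ((1 - x))) 0 0
    v v1 v2 v3) =
  lc4
    ((1 + x * y) / ((1 - x) * (1 - x * y ^+ 2))) ((- x) / ((1 - y) * (1 - x)))
    ((x * y ^+ 3) / ((1 - y) * (1 - x * y ^+ 2))) 0
    v v1 v2 v3.
  apply: (D2_lc4 hT erefl Tl);
    rewrite !(tE, rmorphM, fmorphV, rmorphN, rmorphXn, rmorphD, rmorph1, rmorph0);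
    by field; rewrite !nz.
have d3 : D1 (lc4
    ((1 + x * y) / ((1 - x) * (1 - x * y ^+ 2))) ((- x) / ((1 - y) * (1 - x)))
    ((x * y ^+ 3) / ((1 - y) * (1 - x * y ^+ 2))) 0
    v v1 v2 v3) =
  lc4 e (sg e) (ta (sg e)) (sg (ta (sg e))) v v1 v2 v3.
  apply: (D1_lc4 erefl erefl);
    rewrite ?e3 ?e2 ?e1 ?/e !(sE, rmorphM, fmorphV, rmorphN, rmorphXn, rmorphD, rmorph1, rmorph0);
    by field; rewrite !nz.
by rewrite [in LHS]vE d1 d2 d3.
Qed.

(** The five factors of [e] are the positive roots of G2 other than the long simple root [y]; a
    [T]-invariant function has 12 / 2 = 6 translates. *)
Lemma half_G2_short v : sg y = x ^+ 3 * y -> ta x = x * y -> T v = v ->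
  T (S (T (S (T (S v))))) = S (T (S (T (S (T v))))) ->
  1 - x * y != 0 -> 1 - x ^+ 2 * y != 0 ->
  1 - x ^+ 3 * y != 0 -> 1 - x ^+ 3 * y ^+ 2 != 0 ->
  let e := ((1 - x) * (1 - x * y) * (1 - x ^+ 2 * y) * (1 - x ^+ 3 * y) *
    (1 - x ^+ 3 * y ^+ 2))^-1 in
  D1 (D2 (D1 (D2 (D1 v)))) =
  lc6 e (sg e) (ta (sg e)) (sg (ta (sg e)))
    (ta (sg (ta (sg e)))) (sg (ta (sg (ta (sg e)))))
    v (S v) (T (S v)) (S (T (S v))) (T (S (T (S v)))) (S (T (S (T (S v))))).
Proof.
move=> sgy tax hT br h3 h4 h5 h6 e.
have s1 : sg (1 - x) = - ((1 - x) / x).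
  by rewrite rmorphB !(rmorph1, rmorphM, rmorphXn, sgx, sgy, tax, tay); field.
have s2 : sg (1 - y) = 1 - x ^+ 3 * y.
  by rewrite rmorphB !(rmorph1, rmorphM, rmorphXn, sgx, sgy, tax, tay); field.
have s3 : sg (1 - x * y) = 1 - x ^+ 2 * y.
  by rewrite rmorphB !(rmorph1, rmorphM, rmorphXn, sgx, sgy, tax, tay); field.
have s4 : sg (1 - x ^+ 2 * y) = 1 - x * y.
  by rewrite rmorphB !(rmorph1, rmorphM, rmorphXn, sgx, sgy, tax, tay); field.
have s5 : sg (1 - x ^+ 3 * y) = 1 - y.
  by rewrite rmorphB !(rmorph1, rmorphM, rmorphXn, sgx, sgy, tax, tay); field.
have s6 : sg (1 - x ^+ 3 * y ^+ 2) = 1 - x ^+ 3 * y ^+ 2.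
  by rewrite rmorphB !(rmorph1, rmorphM, rmorphXn, sgx, sgy, tax, tay); field.
have t1 : ta (1 - x) = 1 - x * y.
  by rewrite rmorphB !(rmorph1, rmorphM, rmorphXn, sgx, sgy, tax, tay); field.
have t2 : ta (1 - y) = - ((1 - y) / y).
  by rewrite rmorphB !(rmorph1, rmorphM, rmorphXn, sgx, sgy, tax, tay); field.
have t3 : ta (1 - x * y) = 1 - x.
  by rewrite rmorphB !(rmorph1, rmorphM, rmorphXn, sgx, sgy, tax, tay); field.
have t4 : ta (1 - x ^+ 2 * y) = 1 - x ^+ 2 * y.
  by rewrite rmorphB !(rmorph1, rmorphM, rmorphXn, sgx, sgy, tax, tay); field.
have t5 : ta (1 - x ^+ 3 * y) = 1 - x ^+ 3 * y ^+ 2.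
  by rewrite rmorphB !(rmorph1, rmorphM, rmorphXn, sgx, sgy, tax, tay); field.
have t6 : ta (1 - x ^+ 3 * y ^+ 2) = 1 - x ^+ 3 * y.
  by rewrite rmorphB !(rmorph1, rmorphM, rmorphXn, sgx, sgy, tax, tay); field.
have sE := (s1, s2, s3, s4, s5, s6, sgx, sgy).
have tE := (t1, t2, t3, t4, t5, t6, tay, tax).
have nz := (oppr_eq0, x0, y0, hx, hy, h3, h4, h5, h6).
have e1 : sg e = (- x) /
    ((1 - y) * (1 - x) * (1 - x * y) * (1 - x ^+ 2 * y) * (1 - x ^+ 3 * y ^+ 2)).
  rewrite /e !(sE, rmorphM, fmorphV, rmorphN, rmorphXn, rmorphD, rmorph1, rmorph0).
  by field; rewrite !nz.
have e2 : ta (sg e) = (x * y ^+ 2) /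
    ((1 - y) * (1 - x) * (1 - x * y) * (1 - x ^+ 2 * y) * (1 - x ^+ 3 * y)).
  rewrite e1 !(tE, rmorphM, fmorphV, rmorphN, rmorphXn, rmorphD, rmorph1, rmorph0).
  by field; rewrite !nz.
have e3 : sg (ta (sg e)) = (- x ^+ 6 * y ^+ 2) /
    ((1 - y) * (1 - x) * (1 - x * y) * (1 - x ^+ 2 * y) * (1 - x ^+ 3 * y)).
  rewrite e2 !(sE, rmorphM, fmorphV, rmorphN, rmorphXn, rmorphD, rmorph1, rmorph0).
  by field; rewrite !nz.
have e4 : ta (sg (ta (sg e))) = (x ^+ 6 * y ^+ 5) /
    ((1 - y) * (1 - x) * (1 - x * y) * (1 - x ^+ 2 * y) * (1 - x ^+ 3 * y ^+ 2)).
  rewrite e3 !(tE, rmorphM, fmorphV, rmorphN, rmorphXn, rmorphD, rmorph1, rmorph0).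
  by field; rewrite !nz.
have e5 : sg (ta (sg (ta (sg e)))) = (- x ^+ 10 * y ^+ 5) /
    ((1 - x) * (1 - x * y) * (1 - x ^+ 2 * y) * (1 - x ^+ 3 * y) * (1 - x ^+ 3 * y ^+ 2)).
  rewrite e4 !(sE, rmorphM, fmorphV, rmorphN, rmorphXn, rmorphD, rmorph1, rmorph0).
  by field; rewrite !nz.
set v1 := S v; set v2 := T v1; set v3 := S v2; set v4 := T v3; set v5 := S v4.
have Tl : T v5 = v5 by rewrite [LHS]br hT.
have vE : v = lc6 1 0 0 0 0 0 v v1 v2 v3 v4 v5.
  by apply: functional_extensionality => k; rewrite /lc6; ring.
have d1 : D1 (lc6 1 0 0 0 0 0 v v1 v2 v3 v4 v5) =
  lc6
    ((1) / ((1 - x))) ((- x) / ((1 - x))) 0 0 0 0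
    v v1 v2 v3 v4 v5.
  apply: (D1_lc6 erefl erefl erefl);
    rewrite !(sE, rmorphM, fmorphV, rmorphN, rmorphXn, rmorphD, rmorph1, rmorph0);
    by field; rewrite !nz.
have d2 : D2 (lc6
    ((1) / ((1 - x))) ((- x) / ((1 - x))) 0 0 0 0
    v v1 v2 v3 v4 v5) =
  lc6
    ((1) / ((1 - x) * (1 - x * y))) ((- x) / ((1 - y) * (1 - x)))
    ((x * y ^+ 2) / ((1 - y) * (1 - x * y))) 0 0 0
    v v1 v2 v3 v4 v5.
  apply: (D2_lc6 hT erefl erefl Tl);
    rewrite !(tE, rmorphM, fmorphV, rmorphN, rmorphXn, rmorphD, rmorph1, rmorph0);
    by field; rewrite !nz.
(* In the first coefficient one factor of the double pole at [1 - x] cancels, since (1 - x^3 y) - x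
   (1 - x y) = (1 - x)(1 + x^2 y); this is where the numerator comes from. *)
have d3 : D1 (lc6
    ((1) / ((1 - x) * (1 - x * y))) ((- x) / ((1 - y) * (1 - x)))
    ((x * y ^+ 2) / ((1 - y) * (1 - x * y))) 0 0 0
    v v1 v2 v3 v4 v5) =
  lc6
    ((1 + x ^+ 2 * y) / ((1 - x) * (1 - x * y) * (1 - x ^+ 3 * y)))
    ((- x - x ^+ 2 * y) / ((1 - y) * (1 - x) * (1 - x ^+ 2 * y)))
    ((x * y ^+ 2) / ((1 - y) * (1 - x) * (1 - x * y)))
    ((- x ^+ 6 * y ^+ 2) / ((1 - x) * (1 - x ^+ 2 * y) * (1 - x ^+ 3 * y))) 0 0
    v v1 v2 v3 v4 v5.
  apply: (D1_lc6 erefl erefl erefl);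
    rewrite !(sE, rmorphM, fmorphV, rmorphN, rmorphXn, rmorphD, rmorph1, rmorph0);
    by field; rewrite !nz.
have d4 : D2 (lc6
    ((1 + x ^+ 2 * y) / ((1 - x) * (1 - x * y) * (1 - x ^+ 3 * y)))
    ((- x - x ^+ 2 * y) / ((1 - y) * (1 - x) * (1 - x ^+ 2 * y)))
    ((x * y ^+ 2) / ((1 - y) * (1 - x) * (1 - x * y)))
    ((- x ^+ 6 * y ^+ 2) / ((1 - x) * (1 - x ^+ 2 * y) * (1 - x ^+ 3 * y))) 0 0
    v v1 v2 v3 v4 v5) =
  lc6
    ((1 + x ^+ 2 * y) / ((1 - x) * (1 - x * y) * (1 - x ^+ 3 * y) * (1 - x ^+ 3 * y ^+ 2)))
    ((- x) / ((1 - y) * (1 - x) * (1 - x * y) * (1 - x ^+ 2 * y)))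
    ((x * y ^+ 2) / ((1 - y) * (1 - x) * (1 - x * y) * (1 - x ^+ 2 * y)))
    ((- x ^+ 6 * y ^+ 2) / ((1 - y) * (1 - x) * (1 - x ^+ 2 * y) * (1 - x ^+ 3 * y)))
    ((x ^+ 6 * y ^+ 5) / ((1 - y) * (1 - x * y) * (1 - x ^+ 2 * y) * (1 - x ^+ 3 * y ^+ 2))) 0
    v v1 v2 v3 v4 v5.
  apply: (D2_lc6 hT erefl erefl Tl);
    rewrite !(tE, rmorphM, fmorphV, rmorphN, rmorphXn, rmorphD, rmorph1, rmorph0);
    by field; rewrite !nz.
have d5 : D1 (lc6
    ((1 + x ^+ 2 * y) / ((1 - x) * (1 - x * y) * (1 - x ^+ 3 * y) * (1 - x ^+ 3 * y ^+ 2)))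
    ((- x) / ((1 - y) * (1 - x) * (1 - x * y) * (1 - x ^+ 2 * y)))
    ((x * y ^+ 2) / ((1 - y) * (1 - x) * (1 - x * y) * (1 - x ^+ 2 * y)))
    ((- x ^+ 6 * y ^+ 2) / ((1 - y) * (1 - x) * (1 - x ^+ 2 * y) * (1 - x ^+ 3 * y)))
    ((x ^+ 6 * y ^+ 5) / ((1 - y) * (1 - x * y) * (1 - x ^+ 2 * y) * (1 - x ^+ 3 * y ^+ 2))) 0
    v v1 v2 v3 v4 v5) =
  lc6 e (sg e) (ta (sg e)) (sg (ta (sg e)))
    (ta (sg (ta (sg e)))) (sg (ta (sg (ta (sg e))))) v v1 v2 v3 v4 v5.
  apply: (D1_lc6 erefl erefl erefl);
    rewrite ?e5 ?e4 ?e3 ?e2 ?e1 ?/e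
      !(sE, rmorphM, fmorphV, rmorphN, rmorphXn, rmorphD, rmorph1, rmorph0);
    by field; rewrite !nz.
by rewrite [in LHS]vE d1 d2 d3 d4 d5.
Qed.

Lemma half_G2_long v : sg y = x * y -> ta x = x * y ^+ 3 -> T v = v ->
  T (S (T (S (T (S v))))) = S (T (S (T (S (T v))))) ->
  1 - x * y != 0 -> 1 - x * y ^+ 2 != 0 ->
  1 - x * y ^+ 3 != 0 -> 1 - x ^+ 2 * y ^+ 3 != 0 ->
  let e := ((1 - x) * (1 - x * y) * (1 - x * y ^+ 2) * (1 - x * y ^+ 3) *
    (1 - x ^+ 2 * y ^+ 3))^-1 in
  D1 (D2 (D1 (D2 (D1 v)))) =
  lc6 e (sg e) (ta (sg e)) (sg (ta (sg e)))
    (ta (sg (ta (sg e)))) (sg (ta (sg (ta (sg e)))))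
    v (S v) (T (S v)) (S (T (S v))) (T (S (T (S v)))) (S (T (S (T (S v))))).
Proof.
move=> sgy tax hT br h3 h4 h5 h6 e.
have s1 : sg (1 - x) = - ((1 - x) / x).
  by rewrite rmorphB !(rmorph1, rmorphM, rmorphXn, sgx, sgy, tax, tay); field.
have s2 : sg (1 - y) = 1 - x * y.
  by rewrite rmorphB !(rmorph1, rmorphM, rmorphXn, sgx, sgy, tax, tay); field.
have s3 : sg (1 - x * y) = 1 - y.
  by rewrite rmorphB !(rmorph1, rmorphM, rmorphXn, sgx, sgy, tax, tay); field.
have s4 : sg (1 - x * y ^+ 2) = 1 - x * y ^+ 2.
  by rewrite rmorphB !(rmorph1, rmorphM, rmorphXn, sgx, sgy, tax, tay); field.
have s5 : sg (1 - x * y ^+ 3) = 1 - x ^+ 2 * y ^+ 3.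
  by rewrite rmorphB !(rmorph1, rmorphM, rmorphXn, sgx, sgy, tax, tay); field.
have s6 : sg (1 - x ^+ 2 * y ^+ 3) = 1 - x * y ^+ 3.
  by rewrite rmorphB !(rmorph1, rmorphM, rmorphXn, sgx, sgy, tax, tay); field.
have t1 : ta (1 - x) = 1 - x * y ^+ 3.
  by rewrite rmorphB !(rmorph1, rmorphM, rmorphXn, sgx, sgy, tax, tay); field.
have t2 : ta (1 - y) = - ((1 - y) / y).
  by rewrite rmorphB !(rmorph1, rmorphM, rmorphXn, sgx, sgy, tax, tay); field.
have t3 : ta (1 - x * y) = 1 - x * y ^+ 2.
  by rewrite rmorphB !(rmorph1, rmorphM, rmorphXn, sgx, sgy, tax, tay); field.
have t4 : ta (1 - x * y ^+ 2) = 1 - x * y.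
  by rewrite rmorphB !(rmorph1, rmorphM, rmorphXn, sgx, sgy, tax, tay); field.
have t5 : ta (1 - x * y ^+ 3) = 1 - x.
  by rewrite rmorphB !(rmorph1, rmorphM, rmorphXn, sgx, sgy, tax, tay); field.
have t6 : ta (1 - x ^+ 2 * y ^+ 3) = 1 - x ^+ 2 * y ^+ 3.
  by rewrite rmorphB !(rmorph1, rmorphM, rmorphXn, sgx, sgy, tax, tay); field.
have sE := (s1, s2, s3, s4, s5, s6, sgx, sgy).
have tE := (t1, t2, t3, t4, t5, t6, tay, tax).
have nz := (oppr_eq0, x0, y0, hx, hy, h3, h4, h5, h6).
have e1 : sg e = (- x) /
    ((1 - y) * (1 - x) * (1 - x * y ^+ 2) * (1 - x * y ^+ 3) * (1 - x ^+ 2 * y ^+ 3)).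
  rewrite /e !(sE, rmorphM, fmorphV, rmorphN, rmorphXn, rmorphD, rmorph1, rmorph0).
  by field; rewrite !nz.
have e2 : ta (sg e) = (x * y ^+ 4) /
    ((1 - y) * (1 - x) * (1 - x * y) * (1 - x * y ^+ 3) * (1 - x ^+ 2 * y ^+ 3)).
  rewrite e1 !(tE, rmorphM, fmorphV, rmorphN, rmorphXn, rmorphD, rmorph1, rmorph0).
  by field; rewrite !nz.
have e3 : sg (ta (sg e)) = (- x ^+ 4 * y ^+ 4) /
    ((1 - y) * (1 - x) * (1 - x * y) * (1 - x * y ^+ 3) * (1 - x ^+ 2 * y ^+ 3)).
  rewrite e2 !(sE, rmorphM, fmorphV, rmorphN, rmorphXn, rmorphD, rmorph1, rmorph0).
  by field; rewrite !nz.
have e4 : ta (sg (ta (sg e))) = (x ^+ 4 * y ^+ 9) /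
    ((1 - y) * (1 - x) * (1 - x * y ^+ 2) * (1 - x * y ^+ 3) * (1 - x ^+ 2 * y ^+ 3)).
  rewrite e3 !(tE, rmorphM, fmorphV, rmorphN, rmorphXn, rmorphD, rmorph1, rmorph0).
  by field; rewrite !nz.
have e5 : sg (ta (sg (ta (sg e)))) = (- x ^+ 6 * y ^+ 9) /
    ((1 - x) * (1 - x * y) * (1 - x * y ^+ 2) * (1 - x * y ^+ 3) * (1 - x ^+ 2 * y ^+ 3)).
  rewrite e4 !(sE, rmorphM, fmorphV, rmorphN, rmorphXn, rmorphD, rmorph1, rmorph0).
  by field; rewrite !nz.
set v1 := S v; set v2 := T v1; set v3 := S v2; set v4 := T v3; set v5 := S v4.
have Tl : T v5 = v5 by rewrite [LHS]br hT.
have vE : v = lc6 1 0 0 0 0 0 v v1 v2 v3 v4 v5.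
  by apply: functional_extensionality => k; rewrite /lc6; ring.
have d1 : D1 (lc6 1 0 0 0 0 0 v v1 v2 v3 v4 v5) =
  lc6
    ((1) / ((1 - x))) ((- x) / ((1 - x))) 0 0 0 0
    v v1 v2 v3 v4 v5.
  apply: (D1_lc6 erefl erefl erefl);
    rewrite !(sE, rmorphM, fmorphV, rmorphN, rmorphXn, rmorphD, rmorph1, rmorph0);
    by field; rewrite !nz.
have d2 : D2 (lc6
    ((1) / ((1 - x))) ((- x) / ((1 - x))) 0 0 0 0
    v v1 v2 v3 v4 v5) =
  lc6
    ((1 + x * y + x * y ^+ 2) / ((1 - x) * (1 - x * y ^+ 3))) ((- x) / ((1 - y) * (1 - x)))
    ((x * y ^+ 4) / ((1 - y) * (1 - x * y ^+ 3))) 0 0 0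
    v v1 v2 v3 v4 v5.
  apply: (D2_lc6 hT erefl erefl Tl);
    rewrite !(tE, rmorphM, fmorphV, rmorphN, rmorphXn, rmorphD, rmorph1, rmorph0);
    by field; rewrite !nz.
have d3 : D1 (lc6
    ((1 + x * y + x * y ^+ 2) / ((1 - x) * (1 - x * y ^+ 3))) ((- x) / ((1 - y) * (1 - x)))
    ((x * y ^+ 4) / ((1 - y) * (1 - x * y ^+ 3))) 0 0 0
    v v1 v2 v3 v4 v5) =
  lc6
    ((1 + x * y ^+ 2) / ((1 - x) * (1 - x * y) * (1 - x * y ^+ 3)))
    ((- x - x ^+ 2 * y ^+ 2) / ((1 - y) * (1 - x) * (1 - x ^+ 2 * y ^+ 3)))
    ((x * y ^+ 4) / ((1 - y) * (1 - x) * (1 - x * y ^+ 3)))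
    ((- x ^+ 4 * y ^+ 4) / ((1 - x) * (1 - x * y) * (1 - x ^+ 2 * y ^+ 3))) 0 0
    v v1 v2 v3 v4 v5.
  apply: (D1_lc6 erefl erefl erefl);
    rewrite !(sE, rmorphM, fmorphV, rmorphN, rmorphXn, rmorphD, rmorph1, rmorph0);
    by field; rewrite !nz.
have d4 : D2 (lc6
    ((1 + x * y ^+ 2) / ((1 - x) * (1 - x * y) * (1 - x * y ^+ 3)))
    ((- x - x ^+ 2 * y ^+ 2) / ((1 - y) * (1 - x) * (1 - x ^+ 2 * y ^+ 3)))
    ((x * y ^+ 4) / ((1 - y) * (1 - x) * (1 - x * y ^+ 3)))
    ((- x ^+ 4 * y ^+ 4) / ((1 - x) * (1 - x * y) * (1 - x ^+ 2 * y ^+ 3))) 0 0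
    v v1 v2 v3 v4 v5) =
  lc6
    ((1 + x ^+ 2 * y ^+ 3) / ((1 - x) * (1 - x * y) * (1 - x * y ^+ 2) * (1 - x * y ^+ 3)))
    ((- x - x ^+ 2 * y ^+ 2 - x ^+ 3 * y ^+ 4) /
      ((1 - y) * (1 - x) * (1 - x * y ^+ 3) * (1 - x ^+ 2 * y ^+ 3)))
    ((x * y ^+ 4 + x ^+ 2 * y ^+ 5 + x ^+ 3 * y ^+ 6) /
      ((1 - y) * (1 - x) * (1 - x * y ^+ 3) * (1 - x ^+ 2 * y ^+ 3)))
    ((- x ^+ 4 * y ^+ 4) / ((1 - y) * (1 - x) * (1 - x * y) * (1 - x ^+ 2 * y ^+ 3)))
    ((x ^+ 4 * y ^+ 9) / ((1 - y) * (1 - x * y ^+ 2) * (1 - x * y ^+ 3) * (1 - x ^+ 2 * y ^+ 3)))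
    0
    v v1 v2 v3 v4 v5.
  apply: (D2_lc6 hT erefl erefl Tl);
    rewrite !(tE, rmorphM, fmorphV, rmorphN, rmorphXn, rmorphD, rmorph1, rmorph0);
    by field; rewrite !nz.
have d5 : D1 (lc6
    ((1 + x ^+ 2 * y ^+ 3) / ((1 - x) * (1 - x * y) * (1 - x * y ^+ 2) * (1 - x * y ^+ 3)))
    ((- x - x ^+ 2 * y ^+ 2 - x ^+ 3 * y ^+ 4) /
      ((1 - y) * (1 - x) * (1 - x * y ^+ 3) * (1 - x ^+ 2 * y ^+ 3)))
    ((x * y ^+ 4 + x ^+ 2 * y ^+ 5 + x ^+ 3 * y ^+ 6) /
      ((1 - y) * (1 - x) * (1 - x * y ^+ 3) * (1 - x ^+ 2 * y ^+ 3)))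
    ((- x ^+ 4 * y ^+ 4) / ((1 - y) * (1 - x) * (1 - x * y) * (1 - x ^+ 2 * y ^+ 3)))
    ((x ^+ 4 * y ^+ 9) / ((1 - y) * (1 - x * y ^+ 2) * (1 - x * y ^+ 3) * (1 - x ^+ 2 * y ^+ 3)))
    0
    v v1 v2 v3 v4 v5) =
  lc6 e (sg e) (ta (sg e)) (sg (ta (sg e)))
    (ta (sg (ta (sg e)))) (sg (ta (sg (ta (sg e))))) v v1 v2 v3 v4 v5.
  apply: (D1_lc6 erefl erefl erefl);
    rewrite ?e5 ?e4 ?e3 ?e2 ?e1 ?/e
      !(sE, rmorphM, fmorphV, rmorphN, rmorphXn, rmorphD, rmorph1, rmorph0);
    by field; rewrite !nz.
by rewrite [in LHS]vE d1 d2 d3 d4 d5.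
Qed.

(** Once e v = g + T g, each member of the orbit contributes two terms, and the orbit sum becomes
    the sum of w g over the 8 elements of the dihedral group: Demazure's formula. *)
Lemma lc4_sum e v g : (forall k, e * v k = g k + T g k) ->
  lc4 e (sg e) (ta (sg e)) (sg (ta (sg e))) v (S v) (T (S v)) (S (T (S v))) =
  fun k => g k + T g k + S g k + S (T g) k + T (S g) k + T (S (T g)) k +
           S (T (S g)) k + S (T (S (T g))) k.
Proof.
move=> h; apply: functional_extensionality => k.
by rewrite /lc4 /twist -!rmorphM !h /twist !rmorphD !addrA.
Qed.

Lemma lc6_sum e v g : (forall k, e * v k = g k + T g k) ->
  lc6 e (sg e) (ta (sg e)) (sg (ta (sg e))) (ta (sg (ta (sg e)))) (sg (ta (sg (ta (sg e)))))
    v (S v) (T (S v)) (S (T (S v))) (T (S (T (S v)))) (S (T (S (T (S v))))) =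
  fun k => g k + T g k + S g k + S (T g) k + T (S g) k + T (S (T g)) k +
           S (T (S g)) k + S (T (S (T g))) k + T (S (T (S g))) k + T (S (T (S (T g)))) k +
           S (T (S (T (S g)))) k + S (T (S (T (S (T g))))) k.
Proof.
move=> h; apply: functional_extensionality => k.
by rewrite /lc6 /twist -!rmorphM !h /twist !rmorphD !addrA.
Qed.
End Dihedral.

(** * Braid relations in types A1 x A1, A2, C2 and G2 *)

Section Braid.
Variables (F : fieldType) (K : Type) (sg ta : {rmorphism F -> F}) (s t : K -> K) (x y : F).
Hypotheses (sgsg : involutive sg) (tata : involutive ta).
Hypotheses (ss : involutive s) (tt : involutive t).
Hypotheses (sgx : sg x = x^-1) (tay : ta y = y^-1) (x0 : x != 0) (y0 : y != 0).
Hypotheses (hx : 1 - x != 0) (hy : 1 - y != 0).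

Local Notation S := (twist sg s).
Local Notation T := (twist ta t).
Local Notation D1 := (dop x sg s).
Local Notation D2 := (dop y ta t).

Lemma dop_braid2 : sg y = y -> ta x = x -> (forall f, S (T f) = T (S f)) ->
  forall f, D1 (D2 f) = D2 (D1 f).
Proof.
move=> sgy tax br f; apply: functional_extensionality => k.
have := f_equal (fun h => h k) (br f); rewrite /dop /twist => brk.
rewrite !(rmorphD, rmorphM, fmorphV, rmorphN, rmorphB, rmorph1, sgx, sgy, tax, tay) brk.
by field; rewrite hx hy.
Qed.

Lemma dop_braid3 : sg y = x * y -> ta x = x * y ->
  (forall f, S (T (S f)) = T (S (T f))) -> 1 - x * y != 0 ->
  forall f, D1 (D2 (D1 f)) = D2 (D1 (D2 f)).
Proof.
move=> sgy tax br h3 f.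
have yx : y * x = x * y by rewrite mulrC.
have tax' : ta x = y * x by rewrite yx.
have sgy' : sg y = y * x by rewrite yx.
have h3' : 1 - y * x != 0 by rewrite yx.
rewrite (half_A2 t sgx tay x0 y0 hx hy sgy tax) ?twist_dop //.
rewrite (half_A2 s tay sgx y0 x0 hy hx tax' sgy') ?twist_dop //.
set e := ((1 - y) * (1 - x * y))^-1; set e' := ((1 - x) * (1 - y * x))^-1.
(* A simple reflection permutes the positive roots other than its own. *)
have te : sg e = e.
  rewrite /e fmorphV !rmorphM !rmorphB !rmorph1 !rmorphM ?rmorphXn sgy sgx;
    congr (_^-1); field; exact: x0.
have te' : ta e' = e'.
  rewrite /e' fmorphV !rmorphM !rmorphB !rmorph1 !rmorphM ?rmorphXn tax tay;
    congr (_^-1); field; exact: y0.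
pose g k := e / (1 - x) * f k.
have gE k : g k = e' / (1 - y) * f k.
  by rewrite /g /e /e'; congr (_ * _); field; rewrite ?hx ?hy ?h3 ?h3'.
have E k : e * D1 f k = g k + S g k by exact: dop_sum.
have E' k : e' * D2 f k = g k + T g k.
  by rewrite (dop_sum t tay y0 hy _ te') /twist !gE.
apply: functional_extensionality => k; rewrite /twist /= -!rmorphM !E !E' !rmorphD.
by have := f_equal (fun h => h k) (br g); rewrite /twist => ->; ring.
Qed.

Lemma dop_braid4 : sg y = x ^+ 2 * y -> ta x = x * y ->
  (forall f, S (T (S (T f))) = T (S (T (S f)))) ->
  1 - x * y != 0 -> 1 - x ^+ 2 * y != 0 ->
  forall f, D1 (D2 (D1 (D2 f))) = D2 (D1 (D2 (D1 f))).
Proof.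
move=> sgy tax br h3 h4 f.
have yx : y * x = x * y by rewrite mulrC.
have yx2 : y * x ^+ 2 = x ^+ 2 * y by rewrite mulrC.
have tax' : ta x = y * x by rewrite yx.
have sgy' : sg y = y * x ^+ 2 by rewrite yx2.
have h3' : 1 - y * x != 0 by rewrite yx.
have h4' : 1 - y * x ^+ 2 != 0 by rewrite yx2.
rewrite (half_C2_short sgsg tata ss tt) ?br ?twist_dop //.
rewrite (half_C2_long tata sgsg tt ss tay sgx y0 x0 hy hx tax' sgy') ?br ?twist_dop //.
set e := (_^-1); set e' := ((1 - y) * (1 - y * x) * (1 - y * x ^+ 2))^-1.
have te : ta e = e.
  by rewrite /e !(fmorphV, rmorphM, rmorphB, rmorph1, rmorphXn, tax, tay); congr (_^-1); field.
have te' : sg e' = e'.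
  by rewrite /e' !(fmorphV, rmorphM, rmorphB, rmorph1, rmorphXn, sgy, sgx); congr (_^-1); field.
pose g k := e / (1 - y) * f k.
have gE k : g k = e' / (1 - x) * f k.
  by rewrite /g /e /e'; congr (_ * _); field; rewrite ?hx ?hy ?h3 ?h4 ?h3' ?h4'.
rewrite (@lc4_sum _ _ _ _ _ _ _ _ g); last exact: dop_sum.
rewrite (@lc4_sum _ _ _ _ _ _ _ _ g); last first.
  by move=> k; rewrite (dop_sum s sgx x0 hx _ te') /twist !gE.
by apply: functional_extensionality => k; rewrite br; ring.
Qed.

Lemma dop_braid6 : sg y = x ^+ 3 * y -> ta x = x * y ->
  (forall f, S (T (S (T (S (T f))))) = T (S (T (S (T (S f)))))) ->
  1 - x * y != 0 -> 1 - x ^+ 2 * y != 0 -> 1 - x ^+ 3 * y != 0 -> 1 - x ^+ 3 * y ^+ 2 != 0 ->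
  forall f, D1 (D2 (D1 (D2 (D1 (D2 f))))) = D2 (D1 (D2 (D1 (D2 (D1 f))))).
Proof.
move=> sgy tax br h3 h4 h5 h6 f.
have yx : y * x = x * y by rewrite mulrC.
have yx2 : y * x ^+ 2 = x ^+ 2 * y by rewrite mulrC.
have yx3 : y * x ^+ 3 = x ^+ 3 * y by rewrite mulrC.
have yx4 : y ^+ 2 * x ^+ 3 = x ^+ 3 * y ^+ 2 by rewrite mulrC.
have tax' : ta x = y * x by rewrite yx.
have sgy' : sg y = y * x ^+ 3 by rewrite yx3.
have h3' : 1 - y * x != 0 by rewrite yx.
have h4' : 1 - y * x ^+ 2 != 0 by rewrite yx2.
have h5' : 1 - y * x ^+ 3 != 0 by rewrite yx3.
have h6' : 1 - y ^+ 2 * x ^+ 3 != 0 by rewrite yx4.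
rewrite (half_G2_short sgsg tata ss tt) ?br ?twist_dop //.
rewrite (half_G2_long tata sgsg tt ss tay sgx y0 x0 hy hx tax' sgy') ?br ?twist_dop //.
set e := (_ ^-1); set e' := ((1 - y) * (1 - y * x) * (1 - y * x ^+ 2) * (1 - y * x ^+ 3) *
  (1 - y ^+ 2 * x ^+ 3))^-1.
have te : ta e = e.
  by rewrite /e !(fmorphV, rmorphM, rmorphB, rmorph1, rmorphXn, tax, tay); congr (_^-1); field.
have te' : sg e' = e'.
  by rewrite /e' !(fmorphV, rmorphM, rmorphB, rmorph1, rmorphXn, sgy, sgx); congr (_^-1); field.
pose g k := e / (1 - y) * f k.
have gE k : g k = e' / (1 - x) * f k.
  by rewrite /g /e /e'; congr (_ * _); field; rewrite ?hx ?hy ?h3 ?h4 ?h5 ?h6 ?h3' ?h4' ?h5' ?h6'.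
rewrite (@lc6_sum _ _ _ _ _ _ _ _ g); last exact: dop_sum.
rewrite (@lc6_sum _ _ _ _ _ _ _ _ g); last first.
  by move=> k; rewrite (dop_sum s sgx x0 hx _ te') /twist !gE.
by apply: functional_extensionality => k; rewrite br; ring.
Qed.
End Braid.

(** * The Weyl group action on the fraction field of the group algebra *)

Lemma frac_repr (R : idomainType) (x : {fraction R}) :
  x = FracField.tofrac \n_(repr x) / FracField.tofrac \d_(repr x).
Proof.
rewrite -{1}[x]reprK; move: (repr x) => r.
have dr := denom_ratioP r.
apply: (mulIf (x := FracField.tofrac \d_r)); first by rewrite tofrac_eq0.
rewrite mulfVK ?tofrac_eq0 //=.
rewrite /GRing.mul /= !piE /=; apply/eqmodP => /=.
rewrite /FracField.mulf /= /FracField.equivf !numden_Ratio ?oner_eq0 ?mulr1 ?mulf_neq0 //.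
by rewrite mulrC.
Qed.

Section FieldAction.
Variable n : nat.
Local Notation wt := 'cV[int]_n.
Local Notation tf := (@FracField.tofrac {mpoly CC[n]}).

Lemma tfX_neq0 (i : 'I_n) : tf 'X_i != 0.
Proof.
rewrite tofrac_eq0; apply/eqP => /(congr1 (fun p : {mpoly CC[n]} => p@_U_(i))).
by rewrite mcoeffX eqxx mcoeff0 => /eqP; rewrite oner_eq0.
Qed.

Lemma eexp_neq0 (l : wt) : eexp l != 0.
Proof. by apply/prodf_neq0 => i _; rewrite expfz_neq0 ?tfX_neq0. Qed.

Lemma eexp0 : eexp (0 : wt) = 1.
Proof. by rewrite /eexp big1 // => i _; rewrite mxE expr0z. Qed.

Lemma eexpD (l m : wt) : eexp (l + m) = eexp l * eexp m.
Proof.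
rewrite /eexp -big_split /=; apply: eq_bigr => i _.
by rewrite mxE expfzDr ?tfX_neq0.
Qed.

Lemma eexpN (l : wt) : eexp (- l) = (eexp l)^-1.
Proof.
by apply: (mulfI (eexp_neq0 l)); rewrite -eexpD subrr eexp0 divff ?eexp_neq0.
Qed.

Lemma eexpMn (l : wt) k : eexp (l *+ k) = eexp l ^+ k.
Proof. by elim: k => [|k IH]; rewrite ?eexp0 // mulrS exprS eexpD IH. Qed.

Definition mcol (m : 'X_{1..n}) : wt := \col_i (m i)%:Z.

Lemma eexp_mcol m : eexp (mcol m) = tf 'X_[m].
Proof.
rewrite mpolyXE_id rmorph_prod /eexp; apply: eq_bigr => i _.
by rewrite mxE -exprnP rmorphXn.
Qed.

Lemma mcol_inj : injective mcol.
Proof.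
move=> m1 m2 /matrixP e; apply/mnmP => i; apply/eqP; rewrite -eqz_nat.
by have := e i ord0; rewrite !mxE => ->.
Qed.

Lemma mcolU (i : 'I_n) : mcol U_(i) = delta_mx i ord0.
Proof.
apply/matrixP => j k; by rewrite !mxE mnm1E ord1 eqxx andbT natz [j == i]eq_sym.
Qed.

(** Multiplication by [eexp K], with [K] bounding all exponents in absolute value, clears the
    negative exponents; distinct monomials of a polynomial are independent. *)
Lemma eexp_indep (I : eqType) (s : seq I) (g : I -> wt) (c : I -> CC) :
  uniq s -> {in s &, injective g} ->
  \sum_(i <- s) cst n (c i) * eexp (g i) = 0 -> {in s, forall i, c i = 0}.
Proof.
move=> us gi h i0 i0s.
pose K : wt := \col_j \sum_(i <- s) `|g i j ord0|.
have K_ge0 i j : i \in s -> 0 <= (g i + K) j ord0.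
  move=> si; rewrite !mxE (big_rem i) //=.
  rewrite addrA; apply: addr_ge0; last by apply: sumr_ge0.
  by rewrite addrC -lerBlDr sub0r -normrN ler_norm.
pose mm i : 'X_{1..n} := [multinom absz ((g i + K)%R j ord0) | j < n].
have mmE i : i \in s -> mcol (mm i) = g i + K.
  move=> si; apply/matrixP => j k.
  by rewrite ord1 [LHS]mxE mnmE gez0_abs // K_ge0.
have : \sum_(i <- s) c i *: 'X_[mm i] = 0 :> {mpoly CC[n]}.
  apply/eqP; rewrite -tofrac_eq0 rmorph_sum /=.
  suff -> : \sum_(i <- s) tf (c i *: 'X_[mm i]) =
    eexp K * \sum_(i <- s) cst n (c i) * eexp (g i) by rewrite h mulr0.
  rewrite mulr_sumr big_seq [RHS]big_seq; apply: eq_bigr => i si.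
  by rewrite -mul_mpolyC rmorphM /= -eexp_mcol mmE // eexpD mulrA mulrC.
move/(congr1 (fun p : {mpoly CC[n]} => p@_(mm i0))).
rewrite mcoeff0 raddf_sum /= (bigD1_seq i0) //= mcoeffZ mcoeffX eqxx mulr1.
rewrite big_seq_cond big1 ?addr0 //.
move=> i /andP[si ne]; rewrite mcoeffZ mcoeffX; case: eqP => [e|]; last by rewrite mulr0.
case/eqP: ne; apply: gi => //; apply: (addIr K).
by rewrite -!mmE // e.
Qed.

Lemma eexp_inj : injective (@eexp n).
Proof.
move=> l m e; apply/eqP; apply/negPn/negP => ne.
pose g (b : bool) := if b then l else m; pose c (b : bool) : CC := if b then 1 else -1.
have gi : {in [:: true; false] &, injective g}.
  by move=> [] [] //= _ _; rewrite /g => el; case/eqP: ne.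
have := @eexp_indep _ [:: true; false] g c isT gi.
rewrite big_cons big_seq1 /= e /cst mpolyCN mpolyC1 rmorphN rmorph1 mulN1r mul1r subrr.
by move/(_ erefl true isT)/eqP; rewrite /c oner_eq0.
Qed.

Lemma eexp_eq1 (l : wt) : (eexp l == 1) = (l == 0).
Proof. by rewrite -eexp0 (inj_eq eexp_inj). Qed.

Section Hom.
Variable M : 'M[int]_n.

Definition polyact : {mpoly CC[n]} -> CP n :=
  mmap (tf \o @mpolyC n CC) (fun i => eexp (M *m delta_mx i ord0)).

HB.instance Definition _ := GRing.RMorphism.on polyact.

Lemma polyactC c : polyact c%:MP = cst n c.
Proof. exact: mmapC. Qed.

Lemma eexpZ (k : int) (l : wt) : eexp (k *: l) = eexp l ^ k.
Proof.
rewrite /eexp (big_morph (fun x => x ^ k) (id1 := 1) (op1 := *%R)).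
- by apply: eq_bigr => i _; rewrite mxE mulrC exprz_exp.
- by move=> x y; rewrite expfzMl.
- by rewrite exp1rz.
Qed.

Lemma eexp_mulmx_col (l : wt) :
  eexp (M *m l) = \prod_i eexp (M *m delta_mx i ord0) ^ (l i ord0).
Proof.
have {1}-> : l = \sum_i l i ord0 *: delta_mx i ord0.
  apply/matrixP => i j; rewrite summxE (bigD1 i) //= !mxE ord1 !eqxx mulr1 big1 ?addr0 //.
  by move=> k /negbTE nk; rewrite !mxE eq_sym nk mulr0.
rewrite mulmx_sumr (big_morph _ (@eexpD) eexp0); apply: eq_bigr => i _.
by rewrite -scalemxAr eexpZ.
Qed.

Lemma polyactX m : polyact 'X_[m] = eexp (M *m mcol m).
Proof.
rewrite /polyact mmapX /mmap1 eexp_mulmx_col; apply: eq_bigr => i _.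
by rewrite mxE exprnP.
Qed.

Hypothesis Minj : forall l : wt, M *m l = 0 -> l = 0.

(** An injective [M] sends distinct monomials to distinct exponentials, which are independent.
    Injectivity is what lets the map extend to fractions. *)
Lemma polyact_eq0 p : (polyact p == 0) = (p == 0).
Proof.
apply/eqP/eqP => [h|->]; last exact: rmorph0.
apply/mpolyP => m; rewrite mcoeff0; case: (boolP (m \in msupp p)); last exact: memN_msupp_eq0.
move: m; apply: (eexp_indep (g := fun m => M *m mcol m) (c := fun m => p@_m) (msupp_uniq p)).
  move=> m1 m2 _ _ e; apply: mcol_inj; apply/eqP; rewrite -subr_eq0; apply/eqP/Minj.
  by rewrite mulmxBr e subrr.
rewrite -[RHS]h [in RHS](mpolyE p) rmorph_sum /=; apply: eq_bigr => m' _.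
by rewrite -mul_mpolyC rmorphM /= polyactC polyactX.
Qed.

Definition fracact (x : CP n) : CP n :=
  polyact \n_(repr x) / polyact \d_(repr x).

Lemma fracactE a b : b != 0 -> fracact (tf a / tf b) = polyact a / polyact b.
Proof.
move=> b0; rewrite /fracact; set x := tf a / tf b.
have d0 := denom_ratioP (repr x).
have xE : x = tf \n_(repr x) / tf \d_(repr x) := frac_repr x.
apply/eqP; rewrite eqr_div ?polyact_eq0 // -!rmorphM; apply/eqP; congr polyact.
apply/eqP; rewrite -tofrac_eq !rmorphM -eqr_div ?tofrac_eq0 //.
by rewrite -[X in X == _]xE.
Qed.

Lemma fracP (x : CP n) : exists a b, b != 0 /\ x = tf a / tf b.
Proof.
by exists \n_(repr x), \d_(repr x); split; [exact: denom_ratioP | exact: frac_repr].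
Qed.

Lemma fracact_tf a : fracact (tf a) = polyact a.
Proof. by rewrite -[tf a]divr1 -tofrac1 fracactE ?oner_eq0 // rmorph1 divr1. Qed.

Lemma fracactD x y : fracact (x + y) = fracact x + fracact y.
Proof.
have [a [b [b0 ->]]] := fracP x; have [c [d [d0 ->]]] := fracP y.
rewrite addf_div ?tofrac_eq0 // -!rmorphM -rmorphD !fracactE ?mulf_neq0 //.
by rewrite rmorphD !rmorphM addf_div ?polyact_eq0.
Qed.

Lemma fracactM x y : fracact (x * y) = fracact x * fracact y.
Proof.
have [a [b [b0 ->]]] := fracP x; have [c [d [d0 ->]]] := fracP y.
by rewrite mulf_div -!rmorphM !fracactE ?mulf_neq0 // !rmorphM mulf_div.
Qed.

Lemma Waction_exists : is_Waction M fracact.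
Proof.
have f1 : fracact 1 = 1 by rewrite -tofrac1 fracact_tf rmorph1.
split=> //; first exact: fracactD; first exact: fracactM.
- by move=> c; rewrite /cst fracact_tf polyactC.
- move=> l; rewrite eexp_mulmx_col {1}/eexp (big_morph _ fracactM f1); apply: eq_bigr => i _.
  have fX : fracact (tf 'X_i) = eexp (M *m delta_mx i ord0) by rewrite fracact_tf polyactX mcolU.
  have fXn k : fracact (tf 'X_i ^+ k) = eexp (M *m delta_mx i ord0) ^+ k.
    by elim: k => [|k IH]; rewrite ?f1 // !exprS fracactM IH fX.
  case: (l i ord0) => k; first by rewrite -!exprnP fXn.
  rewrite NegzE -!exprnN; apply: (mulIf (x := eexp (M *m delta_mx i ord0) ^+ k.+1)).
    by rewrite expf_neq0 ?eexp_neq0.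
  by rewrite mulVf ?expf_neq0 ?eexp_neq0 // -fXn -fracactM mulVf ?f1 // expf_neq0 ?tfX_neq0.
Qed.

End Hom.

Lemma Waction_neq0 (M : 'M[int]_n) s x : is_Waction M s -> x != 0 -> s x != 0.
Proof.
case=> _ sM s1 _ _ x0; apply/eqP => sx0.
have : s (x / x) = 1 by rewrite divff.
rewrite sM sx0 mul0r => /eqP.
by rewrite eq_sym oner_eq0.
Qed.

Lemma Waction0 (M : 'M[int]_n) s : is_Waction M s -> s 0 = 0.
Proof. by case=> sD _ _ _ _; apply: (addIr (s 0)); rewrite -sD !add0r. Qed.

(** The values on constants and exponentials determine the map on polynomials, hence on quotients.
    Since [actF] is a choice, this is how [actF1] and [actFM] are obtained. *)
Lemma Waction_uniq (M : 'M[int]_n) s s' : is_Waction M s -> is_Waction M s' -> s =1 s'.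
Proof.
move=> H H' x.
have [sD sM s1 sc sl] := H; have [sD' sM' s1' sc' sl'] := H'.
have sp p : s (tf p) = s' (tf p).
  rewrite [p]mpolyE !rmorph_sum /= (big_morph s sD (Waction0 H)).
  rewrite (big_morph s' sD' (Waction0 H')); apply: eq_bigr => m _.
  rewrite -mul_mpolyC rmorphM /= -eexp_mcol sM sM' sl sl'.
  by rewrite -[tf _]/(cst n p@_m) sc sc'.
have [a [b [b0 ->]]] := fracP x.
have tb0 : tf b != 0 by rewrite tofrac_eq0.
apply: (mulIf (Waction_neq0 H tb0)); by rewrite -sM divfK // [s (tf b)]sp -sM' divfK.
Qed.

Lemma Waction_rmorph (M : 'M[int]_n) s : is_Waction M s ->
  exists f : {rmorphism CP n -> CP n}, (f : CP n -> CP n) = s.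
Proof.
move=> H; have [sD sM s1 _ _] := H.
have sB : zmod_morphism s.
  move=> x y; apply: (addIr (s y)); rewrite -sD !subrK //.
have mm : monoid_morphism s by split.
pose f1 := GRing.isZmodMorphism.Build _ _ s sB.
pose f2 := GRing.isMonoidMorphism.Build _ _ s mm.
pose f : {rmorphism CP n -> CP n} := HB.pack s f1 f2.
by exists f.
Qed.

(** A left inverse makes [M] injective, so that the choice in [actF] is meaningful; the condition is
    stable under products. *)
Definition unimod (M : 'M[int]_n) := exists M', M' *m M = 1%:M.

Lemma unimod1 : unimod 1%:M. Proof. by exists 1%:M; rewrite mulmx1. Qed.

Lemma unimodM (M N : 'M[int]_n) : unimod M -> unimod N -> unimod (M *m N).
Proof.
move=> [M' hM] [N' hN]; exists (N' *m M').
by rewrite -mulmxA [M' *m _]mulmxA hM mul1mx.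
Qed.

Lemma actFP (M : 'M[int]_n) : unimod M -> is_Waction M (actF M).
Proof.
move=> [M' hM]; apply: epsilon_spec; exists (fracact M); apply: Waction_exists => l h.
by rewrite -[l]mul1mx -hM -mulmxA h mulmx0.
Qed.

Lemma actF1 : actF 1%:M =1 @id (CP n).
Proof.
apply: Waction_uniq (actFP unimod1) _; split=> // l; by rewrite mul1mx.
Qed.

Lemma actFM (M N : 'M[int]_n) x : unimod M -> unimod N -> actF (M *m N) x = actF M (actF N x).
Proof.
move=> hM hN; apply: (Waction_uniq (s' := actF M \o actF N) (actFP (unimodM hM hN))).
have [sD sM s1 sc sl] := actFP hM; have [sD' sM' s1' sc' sl'] := actFP hN.
split=> [y z|y z||c|l].
- by rewrite /= sD' sD.
- by rewrite /= sM' sM.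
- by rewrite /= s1' s1.
- by rewrite /= sc' sc.
- by rewrite /= sl' sl mulmxA.
Qed.

End FieldAction.

(** * Finite root systems *)

Section Pairing.
Variable n : nat.
Implicit Types b l : 'cV[int]_n.

Lemma pairingE b l : pairing b l = (b^T *m l) ord0 ord0.
Proof. by rewrite /pairing mxE; apply: eq_bigr => i _; rewrite mxE. Qed.

Lemma pairingDl b b' l : pairing (b + b') l = pairing b l + pairing b' l.
Proof. by rewrite !pairingE linearD mulmxDl mxE. Qed.
Lemma pairingNl b l : pairing (- b) l = - pairing b l.
Proof. by rewrite !pairingE linearN mulNmx mxE. Qed.
Lemma pairingBl b b' l : pairing (b - b') l = pairing b l - pairing b' l.
Proof. by rewrite pairingDl pairingNl. Qed.
Lemma pairingZl a b l : pairing (a *: b) l = a * pairing b l.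
Proof. by rewrite !pairingE linearZ -scalemxAl mxE. Qed.
Lemma pairingDr b l l' : pairing b (l + l') = pairing b l + pairing b l'.
Proof. by rewrite !pairingE mulmxDr mxE. Qed.
Lemma pairingNr b l : pairing b (- l) = - pairing b l.
Proof. by rewrite !pairingE mulmxN mxE. Qed.
Lemma pairingBr b l l' : pairing b (l - l') = pairing b l - pairing b l'.
Proof. by rewrite pairingDr pairingNr. Qed.
Lemma pairingZr a b l : pairing b (a *: l) = a * pairing b l.
Proof. by rewrite !pairingE -scalemxAr mxE. Qed.
Lemma pairing_scoroot i l : pairing (scoroot i) l = l i ord0.
Proof.
rewrite /pairing (bigD1 i) //= mxE !eqxx mul1r big1 ?addr0 // => j /negbTE nj.
by rewrite mxE nj mul0r.
Qed.

Lemma pairing_mulmx (M M' : 'M[int]_n) b l :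
  M'^T *m M = 1%:M -> pairing (M' *m b) (M *m l) = pairing b l.
Proof.
by move=> h; rewrite !pairingE trmx_mul -mulmxA [M'^T *m _]mulmxA h mul1mx.
Qed.

Lemma mul_rank1 (u v x : 'cV[int]_n) : (1%:M - u *m v^T) *m x = x - pairing v x *: u.
Proof.
rewrite mulmxBl mul1mx -mulmxA; congr (_ - _).
by apply/matrixP => i j; rewrite !mxE big_ord_recl big_ord0 addr0 pairingE mulrC !ord1.
Qed.
End Pairing.

(** Off-diagonal entries occur in equal pairs, and the diagonal ones are even. *)
Lemma sum_sym_even m (t : 'I_m -> 'I_m -> int) (u : 'I_m -> int) :
  (forall i j, t i j = t j i) -> (forall i, t i i = 2 * u i) ->
  exists k, \sum_i \sum_j t i j = 2 * k.
Proof.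
move=> ts tu; exists (\sum_i u i + \sum_(i : 'I_m) \sum_(j : 'I_m | (i < j)%N) t i j).
have E i : \sum_j t i j =
    2 * u i + \sum_(j : 'I_m | (i < j)%N) t i j + \sum_(j : 'I_m | (j < i)%N) t i j.
  rewrite (bigD1 i) //= tu -addrA; congr (_ + _).
  rewrite (bigID (fun j : 'I_m => (i < j)%N)) /=; congr (_ + _); apply: eq_bigl => j.
    by rewrite -(inj_eq val_inj) /=; lia.
  by rewrite -(inj_eq val_inj) /=; lia.
rewrite (eq_bigr _ (fun i _ => E i)) !big_split /= -mulr_sumr.
rewrite [X in _ + X](exchange_big_dep predT) //=.
rewrite [X in _ + _ + X](_ : _ = \sum_(i : 'I_m) \sum_(j : 'I_m | (i < j)%N) t i j); first by ring.
by apply: eq_bigr => i _; apply: eq_bigr => j _.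
Qed.

Lemma max_exists (T : Type) (P : T -> Prop) (h : T -> int) (B : int) :
  (exists x, P x) -> (forall x, P x -> h x <= B) ->
  exists x, P x /\ forall y, P y -> h y <= h x.
Proof.
move=> [x Px] hB.
have [k] : exists k : nat, B - h x <= k%:Z by exists `|B - h x|%N; lia.
elim: k x Px => [|k IH] x Px hk.
  by exists x; split=> // y /hB; lia.
case: (classic (exists y, P y /\ h x < h y)) => [[y [Py hy]]|no].
  by apply: (IH y Py); lia.
exists x; split=> // y Py; case: (lerP (h y) (h x)) => // lt.
by case: no; exists y.
Qed.

Section Roots.
Variables (n : nat) (A : 'M[int]_n) (d : 'I_n -> int).
Hypotheses (A2 : forall i, A i i = 2) (Aoff : forall i j, i != j -> A i j <= 0).
Hypotheses (d_gt0 : forall i, 0 < d i) (dA : forall i j, d i * A i j = d j * A j i).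
Hypothesis posdef : forall x : 'I_n -> rat, (exists i, x i != 0) ->
  0 < \sum_i \sum_j x i * x j * (d i * A i j)%:~R.
Local Notation vec := 'cV[int]_n.
Implicit Types c v : vec.

(** The invariant symmetric form on the root lattice, (alpha_i, alpha_j) = d_i A_ij, in coordinates
    on the simple roots. *)
Definition frm c c' : int := \sum_i d i * c i ord0 * (A *m c') i ord0.

Lemma frmE c c' : frm c c' = \sum_i \sum_j d i * A i j * (c i ord0 * c' j ord0).
Proof.
apply: eq_bigr => i _; rewrite mxE mulr_sumr; apply: eq_bigr => j _; ring.
Qed.

Lemma frm_sym c c' : frm c c' = frm c' c.
Proof.
rewrite !frmE exchange_big; apply: eq_bigr => i _; apply: eq_bigr => j _.
by rewrite dA; ring.
Qed.

Lemma frmDr c x y : frm c (x + y) = frm c x + frm c y.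
Proof.
by rewrite /frm -big_split; apply: eq_bigr => i _; rewrite mulmxDr mxE mulrDr.
Qed.
Lemma frmZr a c x : frm c (a *: x) = a * frm c x.
Proof.
rewrite /frm mulr_sumr; apply: eq_bigr => i _; rewrite -scalemxAr mxE; ring.
Qed.
Lemma frmNr c x : frm c (- x) = - frm c x.
Proof. by rewrite -scaleN1r frmZr mulN1r. Qed.
Lemma frmDl c x y : frm (x + y) c = frm x c + frm y c.
Proof. by rewrite !(frm_sym _ c) frmDr. Qed.
Lemma frmZl a c x : frm (a *: x) c = a * frm x c.
Proof. by rewrite !(frm_sym _ c) frmZr. Qed.
Lemma frmNl c x : frm (- x) c = - frm x c.
Proof. by rewrite !(frm_sym _ c) frmNr. Qed.

Lemma frm_gt0 c : c != 0 -> 0 < frm c c.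
Proof.
move=> c0; have [i ci] : exists i, c i ord0 != 0.
  apply: NNPP => no; case/eqP: c0; apply/matrixP => i j; rewrite ord1 mxE.
  by apply/eqP/negPn/negP => h; apply: no; exists i.
have P : 0 < \sum_i \sum_j ((c i ord0)%:~R * (c j ord0)%:~R * (d i * A i j)%:~R : rat).
  by apply: (posdef (x := fun i => (c i ord0)%:~R)); exists i; rewrite intr_eq0.
rewrite -(ltr_int rat) frmE [X in _ < X](_ : _ = \sum_i \sum_j
  ((c i ord0)%:~R * (c j ord0)%:~R * (d i * A i j)%:~R : rat)) //.
rewrite rmorph_sum; apply: eq_bigr => {ci P}i _; rewrite rmorph_sum; apply: eq_bigr => j _.
by rewrite !rmorphM /=; ring.
Qed.

Lemma A_inj c : A *m c = 0 -> c = 0.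
Proof.
move=> h; apply/eqP/negPn/negP => /frm_gt0; rewrite /frm h big1 ?ltxx // => i _.
by rewrite mxE mulr0.
Qed.

Lemma A_inj2 c c' : A *m c = A *m c' -> c = c'.
Proof.
by move=> h; apply/eqP; rewrite -subr_eq0; apply/eqP/A_inj; rewrite mulmxBr h subrr.
Qed.

Lemma mulA_scoroot j : A *m scoroot j = sroot A j.
Proof. by apply/matrixP => i k; rewrite ord1 -colE. Qed.

Lemma subZE c v a k : (c - a *: v) k ord0 = c k ord0 - a * v k ord0.
Proof. by rewrite !mxE. Qed.

Lemma scorootE (i j : 'I_n) : scoroot i j ord0 = (j == i)%:R.
Proof. by rewrite mxE eqxx andbT. Qed.

Definition sc (j : 'I_n) c : vec := c - (A *m c) j ord0 *: scoroot j.
Definition sv (j : 'I_n) v : vec := v - pairing v (sroot A j) *: scoroot j.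

(* Pairs (root in the basis of simple roots, its coroot in the basis of simple coroots). *)
Inductive rt : vec -> vec -> Prop :=
| rt_simple i : rt (scoroot i) (scoroot i)
| rt_step j c v : rt c v -> rt (sc j c) (sv j v).

(** The relation v = c / N under the identification alpha_j^vee = alpha_j / d_j, written without
    division. For a root and its coroot, N is half the square length. *)
Definition nrm N c v := 0 < N /\ forall j, N * v j ord0 = d j * c j ord0.

Lemma nrm_pairing N c v c' : nrm N c v -> N * pairing v (A *m c') = frm c c'.
Proof.
move=> [_ h]; rewrite mulr_sumr; apply: eq_bigr => i _.
by rewrite mulrA h.
Qed.

Lemma nrm_sroot N c v k : nrm N c v -> N * pairing v (sroot A k) = d k * (A *m c) k ord0.
Proof.
move=> h; rewrite -mulA_scoroot (nrm_pairing _ h) frm_sym /frm (bigD1 k) //= big1 ?addr0.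
  by rewrite mxE !eqxx mulr1.
by move=> i /negbTE ni; rewrite mxE ni mulr0 mul0r.
Qed.

Lemma rt_nrm c v : rt c v -> exists N, nrm N c v /\ pairing v (A *m c) = 2.
Proof.
elim=> [i|j c' v' _ [N [[N0 h] h2]]].
  exists (d i); rewrite pairing_scoroot mulA_scoroot mxE; split=> //; split=> // j.
  by rewrite !mxE eqxx andbT; case: eqP => [->|_]; rewrite ?mulr0.
exists N; split; first split=> // k.
  rewrite /sc /sv !subZE scorootE mulrBr h mulrBr; congr (_ - _).
  rewrite mulrA (nrm_sroot (c := c')) //.
  by case: (k =P j) => [->|_]; rewrite ?mulr0 // mulrA.
rewrite /sc /sv mulmxBr -scalemxAr mulA_scoroot pairingBl !pairingBr !pairingZl !pairingZr.
rewrite !pairing_scoroot h2 [sroot _ _ _ _]mxE A2; ring.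
Qed.

Lemma nrm_frm N c v : nrm N c v -> pairing v (A *m c) = 2 -> frm c c = 2 * N.
Proof. by move=> h h2; rewrite -(nrm_pairing _ h) h2 mulrC. Qed.

(* The summands [v_i A_ij c_j] form a symmetric array with even diagonal. *)
Lemma nrm_even N c v : nrm N c v -> exists k, pairing v (A *m c) = 2 * k.
Proof.
move=> [N0 h].
have [i j|i|k E] := @sum_sym_even n (fun i j => v i ord0 * A i j * c j ord0)
  (fun i => v i ord0 * c i ord0).
- apply: (mulfI (lt0r_neq0 N0)); rewrite !mulrA !h.
  rewrite -[LHS](_ : d i * A i j * (c i ord0 * c j ord0) = _); last by ring.
  by rewrite dA; ring.
- by rewrite A2; ring.
exists k; rewrite -E /pairing; apply: eq_bigr => i _; rewrite mxE mulr_sumr.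
by apply: eq_bigr => j _; rewrite mulrA.
Qed.

Definition nneg c := forall j, 0 <= c j ord0.

Lemma frm_le0 c c' : nneg c -> nneg c' -> (forall j, c j ord0 * c' j ord0 = 0) -> frm c c' <= 0.
Proof.
move=> h h' h0; rewrite frmE; apply: sumr_le0 => i _; apply: sumr_le0 => j _.
case: (eqVneq i j) => [->|ne]; first by rewrite h0 mulr0.
apply: mulr_le0_ge0; last by apply: mulr_ge0.
by apply: mulr_ge0_le0; [apply: ltW | apply: Aoff].
Qed.

(* If [c] had both signs, [c = c+ - c-], evenness would give
   [frm c c >= frm c+ c+ + frm c- c- >= 2N + 2N], whereas [frm c c = 2N]. *)
Lemma rt_sign c v : rt c v -> nneg c \/ nneg (- c).
Proof.
move/rt_nrm=> [N [hN h2]].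
pose cp : vec := \col_j (if 0 <= c j ord0 then c j ord0 else 0).
pose vp : vec := \col_j (if 0 <= c j ord0 then v j ord0 else 0).
have cpE j : cp j ord0 = if 0 <= c j ord0 then c j ord0 else 0 by rewrite mxE.
have cmE j : (cp - c) j ord0 = if 0 <= c j ord0 then 0 else - c j ord0.
  by rewrite !mxE; case: ifP => _; rewrite ?subrr ?sub0r.
have [N0 hv] := hN.
have hp : nrm N cp vp by split=> // j; rewrite !mxE; case: ifP => _; rewrite ?mulr0 ?hv.
have hm : nrm N (cp - c) (vp - v).
  split=> // j; have := hp.2 j; rewrite [(vp - v) _ _]mxE [(cp - c) _ _]mxE.
  by rewrite !mulrDr => ->; rewrite [(- v) _ _]mxE [(- c) _ _]mxE !mulrN hv.
have big x w : nrm N x w -> x != 0 -> 2 * N <= frm x x.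
  move=> hx x0; have [k E] := nrm_even hx.
  have := frm_gt0 x0; rewrite -(nrm_pairing _ hx) E => pos.
  have : 0 < k by nia.
  by nia.
case: (eqVneq cp 0) => [cp0|/(big _ _ hp) bp].
  right=> j; have := cpE j; rewrite cp0 !mxE.
  by case: lerP => [_ <-|/ltW h _]; rewrite ?oppr0 // oppr_ge0.
case: (eqVneq (cp - c) 0) => [cm0|/(big _ _ hm) bm].
  left=> j; have := cmE j; rewrite cm0 !mxE; case: lerP => // h /esym/eqP.
  by rewrite oppr_eq0 => /eqP e; rewrite e ltxx in h.
have le : frm cp (cp - c) <= 0.
  apply: frm_le0 => j; first by rewrite cpE; case: (lerP 0 (c j ord0)).
    by rewrite cmE; case: (lerP 0 (c j ord0)) => // /ltW h; rewrite oppr_ge0.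
  by rewrite cpE cmE; case: (lerP 0 (c j ord0)) => _; rewrite ?mulr0 ?mul0r.
have := nrm_frm hN h2.
have -> : c = cp - (cp - c) by rewrite opprB addrC subrK.
move: le bp bm; move: (cp - c) => cm le bp bm.
rewrite frmDl !frmDr !frmNl !frmNr (frm_sym cm cp); lia.
Qed.

Lemma scB j c a c' : sc j (c - a *: c') = sc j c - a *: sc j c'.
Proof.
by apply/matrixP => k l; rewrite ord1 /sc mulmxBr -scalemxAr !subZE; ring.
Qed.

Lemma svB j v a v' : sv j (v - a *: v') = sv j v - a *: sv j v'.
Proof.
by apply/matrixP => k l; rewrite ord1 /sv pairingBl pairingZl !subZE; ring.
Qed.

Lemma scoroot_sroot j : (sroot A j) j ord0 = 2.
Proof. by rewrite mxE. Qed.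

Lemma scK j c : sc j (sc j c) = c.
Proof.
apply/matrixP => k l; rewrite ord1 {2}/sc scB /sc mulA_scoroot !subZE scoroot_sroot; ring.
Qed.

Lemma svK j v : sv j (sv j v) = v.
Proof.
apply/matrixP => k l; rewrite ord1 {2}/sv svB /sv pairing_scoroot !subZE scoroot_sroot; ring.
Qed.

Lemma pairing_s j v c : pairing (sv j v) (A *m sc j c) = pairing v (A *m c).
Proof.
rewrite /sc /sv mulmxBr -scalemxAr mulA_scoroot pairingBl !pairingBr !pairingZl !pairingZr.
rewrite !pairing_scoroot scoroot_sroot; ring.
Qed.

(** Induction on the first root: the reflection in s_j c is s_j s_c s_j. *)
Lemma rt_refl c v c' v' : rt c v -> rt c' v' ->
  rt (c' - pairing v (A *m c') *: c) (v' - pairing v' (A *m c) *: v).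
Proof.
move=> h; elim: h c' v' => [i|j {}c {}v _ IH] c' v' h'.
  by rewrite pairing_scoroot mulA_scoroot; apply: rt_step.
have := rt_step j (IH _ _ (rt_step j h')).
rewrite scB svB scK svK.
by rewrite -(pairing_s j v) scK -[A *m c](f_equal (mulmx A) (scK j c)) pairing_s.
Qed.

Lemma rt_opp c v : rt c v -> rt (- c) (- v).
Proof.
move=> h; have := rt_refl h h; have [N [_ ->]] := rt_nrm h.
have E (x : vec) : x - (2 : int) *: x = - x by rewrite scaler_nat mulr2n opprD addrA subrr sub0r.
by rewrite !E.
Qed.

Lemma rt_neq0 c v : rt c v -> c != 0.
Proof.
move/rt_nrm => [N [_ h]]; apply/eqP => c0; move: h.
by rewrite c0 mulmx0 pairingE mulmx0 mxE.
Qed.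

Lemma rt_uniq c v v' : rt c v -> rt c v' -> v = v'.
Proof.
move=> /rt_nrm [N [h h2]] /rt_nrm [N' [h' h2']].
have NN : N = N' by have := nrm_frm h h2; rewrite (nrm_frm h' h2'); lia.
apply/matrixP => i j; rewrite ord1; apply: (mulfI (lt0r_neq0 h.1)).
by rewrite h.2 NN h'.2.
Qed.

(** The Cauchy-Schwarz identity: a c - 2 c' is -2 times the component of c' orthogonal to c. *)
Lemma rt_CS0 N N' c v c' v' : nrm N c v -> nrm N' c' v' ->
  pairing v (A *m c) = 2 -> pairing v' (A *m c') = 2 ->
  let a := pairing v (A *m c') in let b := pairing v' (A *m c) in
  N * a = N' * b /\
  frm (a *: c - (2 : int) *: c') (a *: c - (2 : int) *: c') = 2 * N' * (4 - a * b).
Proof.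
move=> h h' h2 h2' a b.
have Na : N * a = frm c c' by rewrite (nrm_pairing _ h).
have Nb : N' * b = frm c c' by rewrite (nrm_pairing _ h') frm_sym.
split; first by rewrite Na.
rewrite frmDl !frmDr !frmNl !frmNr !frmZl !frmZr (nrm_frm h h2) (nrm_frm h' h2').
rewrite (frm_sym c' c) (_ : 2 * N' * (4 - a * b) = 8 * N' - 2 * a * (N' * b)); last by ring.
by rewrite Nb -Na; ring.
Qed.

Lemma frm_ge0 c : 0 <= frm c c.
Proof.
case: (eqVneq c 0) => [->|/frm_gt0/ltW//].
by rewrite -[0 : vec](scale0r 0) frmZl mul0r.
Qed.

(** When ab = 4 the roots are proportional, a c = 2 c'. Then a = 2 or -2 gives c = c' or c = -c',
    while a or b equal to 1 or -1 would make one root plus or minus twice the other. *)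
Lemma rt_CS c v c' v' : rt c v -> rt c' v' ->
  let a := pairing v (A *m c') in let b := pairing v' (A *m c) in
  [/\ 0 <= a * b, a * b <= 4, (a == 0) = (b == 0) & [\/ c = c', c = - c' | a * b <= 3]].
Proof.
move=> /rt_nrm [N [h h2]] /rt_nrm [N' [h' h2']] a b.
have [ab fab] := rt_CS0 h h' h2 h2'; have [_ fba] := rt_CS0 h' h h2' h2.
rewrite -/a -/b in ab fab fba.
have N0 := h.1; have N0' := h'.1.
have ge := frm_ge0 (a *: c - (2 : int) *: c'); rewrite fab in ge.
have le4 : a * b <= 4.
  by move: ge; rewrite pmulr_rge0 ?subr_ge0 //; apply: mulr_gt0.
split=> //.
- rewrite -(pmulr_rge0 _ N0) mulrA ab -mulrA pmulr_rge0 //; exact: sqr_ge0.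
- apply/eqP/eqP => z; [apply: (mulfI (lt0r_neq0 N0')) | apply: (mulfI (lt0r_neq0 N0))].
    by rewrite -ab z !mulr0.
  by rewrite ab z !mulr0.
case: (lerP (a * b) 3) => [|gt3]; first by constructor 3.
have ab4 : a * b = 4 by lia.
have z1 : a *: c = (2 : int) *: c'.
  apply/eqP; rewrite -subr_eq0; apply/negPn/negP => /frm_gt0; rewrite fab ab4; lia.
have z2 : b *: c' = (2 : int) *: c.
  apply/eqP; rewrite -subr_eq0; apply/negPn/negP => /frm_gt0; rewrite fba [b * a]mulrC ab4; lia.
have inj2 (x y : vec) : (2 : int) *: x = (2 : int) *: y -> x = y.
  move=> /matrixP e; apply/matrixP => i j.
  by have := e i j; rewrite !mxE => /(mulfI (isT : (2 : int) != 0)).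
(* Excludes x = 2x' and x = -2x': the integral vector [e *: w] would then be proportional to x' in
   the sense of [nrm] and pair with x' to 1, against evenness. *)
have odd1 M M' (x w x' w' : vec) (e f : int) : nrm M x w -> nrm M' x' w' ->
    pairing w (A *m x) = 2 -> pairing w' (A *m x') = 2 -> 
    e = pairing w (A *m x') -> e * e = 1 -> e *: x = (2 : int) *: x' -> False.
  move=> hM hM' e2 e2' eE ee z.
  have xE : x = (2 * e) *: x' by rewrite mulrC -scalerA -z scalerA ee scale1r.
  have MM : M = 4 * M'.
    have := nrm_frm hM e2; rewrite xE frmZl frmZr (nrm_frm hM' e2').
    rewrite (_ : 2 * e * (2 * e * (2 * M')) = 8 * M' * (e * e)); last by ring.
    by rewrite ee; lia.
  have : nrm (2 * M') x' (e *: w).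
    split; first by have := hM'.1; lia.
    move=> j; have := hM.2 j; rewrite MM xE !mxE => /(congr1 (fun z => e * z)) H.
    have {}H : 4 * (M' * (e * w j ord0)) = 2 * (d j * x' j ord0) * (e * e).
      transitivity (e * (4 * M' * w j ord0)); first by ring.
      by rewrite H; ring.
    apply: (mulfI (isT : (2 : int) != 0)).
    transitivity (4 * (M' * (e * w j ord0))); first by ring.
    by rewrite H ee mulr1.
  by move/nrm_even => [k]; rewrite pairingZl -eE ee; lia.
have : (a == 2) || (a == -2) || (a * a == 1) || (b * b == 1).
  have : `|a|%N \in divisors 4.
    by rewrite -dvdn_divisors //; apply/dvdnP; exists `|b|%N; rewrite mulnC -abszM ab4.
  by rewrite !inE => /or3P[] /eqP e; lia.
case/orP=> [/orP[/orP[]|]|] /eqP e.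
- by constructor 1; apply: inj2; rewrite -z1 e.
- constructor 2; apply: inj2; rewrite scalerN -z1 e scaleNr opprK //.
- by case: (odd1 _ _ _ _ _ _ a 0 h h' h2 h2').
- by case: (odd1 _ _ _ _ _ _ b 0 h' h h2' h2).
Qed.

Lemma rt_bound c v c' v' : rt c v -> rt c' v' -> `|pairing v (A *m c')| <= 4.
Proof.
move=> h h'; have [ge le e0 _] := rt_CS h h'.
move: ge le e0; move: (pairing v _) (pairing v' _) => a b ge le e0.
case: (eqVneq a 0) => [->//|a0].
have b0 : b != 0 by rewrite -e0.
apply: le_trans (_ : `|a| * `|b| <= 4); last by rewrite -normrM ger0_norm.
by rewrite ler_peMr // -gtz0_ge1 normr_gt0.
Qed.

Lemma rt_box c v i : rt c v -> `|(A *m c) i ord0| <= 4.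
Proof. by move/(rt_bound (rt_simple i)); rewrite pairing_scoroot. Qed.

(** * Finiteness of the root system and the highest root *)

Definition ht c : int := \sum_i c i ord0.

Lemma htB c c' a : ht (c - a *: c') = ht c - a * ht c'.
Proof.
rewrite /ht mulr_sumr -sumrB; apply: eq_bigr => i _; exact: subZE.
Qed.

Lemma ht_scoroot i : ht (scoroot i) = 1.
Proof.
rewrite /ht (bigD1 i) //= scorootE eqxx big1 ?addr0 // => j /negbTE nj.
by rewrite scorootE nj.
Qed.

(** The weight coordinates of a root lie between -4 and 4, hence the 9 values, and they determine
    the root since A is injective. So there are finitely many roots, and one representative per
    value vector suffices for the bound. *)
Lemma ht_bounded : exists B, forall c v, rt c v -> ht c <= B.
Proof.
pose P (f : {ffun 'I_n -> 'I_9}) c := (exists v, rt c v) /\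
  forall i, (A *m c) i ord0 + 4 = (f i)%:Z.
pose pick f := epsilon (inhabits 0) (P f).
exists (\sum_f `|ht (pick f)|) => c v h.
pose f : {ffun 'I_n -> 'I_9} := [ffun i => inord (absz ((A *m c) i ord0 + 4)%R)].
have Pc : P f c.
  split=> [|i]; first by exists v.
  have := rt_box i h; rewrite ffunE; move: ((A *m c) i ord0) => z hz.
  by rewrite inordK; lia.
have [_ Pp] : P f (pick f) by apply: epsilon_spec; exists c.
have -> : c = pick f.
  apply: A_inj2; apply/matrixP => i j; rewrite ord1.
  by apply: (addIr 4); rewrite Pp; apply: Pc.2.
rewrite (bigD1 f) //= -[leLHS]addr0; apply: lerD; first exact: ler_norm.
by apply: sumr_ge0.
Qed.

Definition dominant c := forall i, 0 <= (A *m c) i ord0.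

Lemma dominant_rt_nneg c v : rt c v -> dominant c -> nneg c.
Proof.
move=> h dom; case: (rt_sign h) => // neg.
have := frm_gt0 (rt_neq0 h); rewrite /frm ltNge; case/negP.
apply: sumr_le0 => i _; apply: mulr_le0_ge0 => //.
apply: mulr_ge0_le0; first exact: ltW.
by have := neg i; rewrite mxE oppr_ge0.
Qed.

(** Take a root of maximal height among those above b. If its i-th pairing were negative, s_i would
    raise it while staying above b. *)
Lemma rt_max_above b w : rt b w -> exists c v,
  [/\ rt c v, nneg (c - b), dominant c & forall c' v', rt c' v' -> nneg (c' - b) -> ht c' <= ht c].
Proof.
move=> h; have [B hB] := ht_bounded.
have [||c [[[v hc] cb] mx]] := @max_exists _ (fun c => (exists v, rt c v) /\ nneg (c - b)) ht B.
- by exists b; split; [exists w | move=> j; rewrite subrr mxE].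
- by move=> c [[v hc] _]; apply: hB hc.
exists c, v; split=> // [i|c' v' hc' cb']; last by apply: mx; split=> //; exists v'.
case: lerP => // lt0.
suff /mx : (exists v, rt (sc i c) v) /\ nneg (sc i c - b).
  by rewrite /sc htB ht_scoroot; lia.
split; first by exists (sv i v); apply: rt_step.
move=> j; have := cb j; rewrite addrAC subZE scorootE => h0.
by case: (j == i); rewrite /= ?mulr1 ?mulr0 ?subr0 // subr_ge0 (le_trans (ltW lt0)).
Qed.

Hypotheses (n_gt0 : (0 < n)%N) (indec : indecomposable_cartan A).

(** At a zero coordinate i of c, all terms of (A c)_i are nonpositive while the sum is nonnegative,
    so row i vanishes on the support of c. Indecomposability then forces full support. *)
Lemma dominant_full c v : rt c v -> dominant c -> forall j, 0 < c j ord0.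
Proof.
move=> h dom; have ng := dominant_rt_nneg h dom.
pose S := [set j : 'I_n | c j ord0 == 0].
have [i j|S0|ST] := indec (S := S).
- rewrite !inE => /eqP ci cj.
  have := dom i; rewrite mxE => sge.
  have le0 k : A i k * c k ord0 <= 0.
    case: (eqVneq i k) => [<-|ne]; first by rewrite ci mulr0.
    by apply: mulr_le0_ge0 => //; apply: Aoff.
  have : A i j * c j ord0 == 0.
    rewrite eq_le le0 /=; apply: le_trans sge _.
    rewrite (bigD1 j) //= -[leRHS]addr0; apply: lerD => //.
    by apply: sumr_le0 => k _.
  by rewrite mulf_eq0 (negbTE cj) orbF => /eqP.
- move=> j; rewrite lt0r ng andbT; have : j \notin S by rewrite S0 inE.
  by rewrite inE.
- case/eqP: (rt_neq0 h); apply/matrixP => i j; rewrite ord1 mxE.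
  by have : i \in S by [rewrite ST inE]; rewrite inE => /eqP.
Qed.

(** A root [th] of maximal height is compared with a dominant root c above the given one. Both have
    full support, so (th, c) > 0; by Cauchy-Schwarz they are equal or differ by a root. That root
    has a sign, and maximal height decides which. *)
Lemma highest_exists : exists c v, rt c v /\ forall c' v', rt c' v' -> nneg (c - c').
Proof.
have i0 : 'I_n := Ordinal n_gt0.
have [B hB] := ht_bounded.
have [||th [[tv hth] mx]] := @max_exists _ (fun c => exists v, rt c v) ht B.
- by exists (scoroot i0), (scoroot i0); apply: rt_simple.
- by move=> c [v]; apply: hB.
have dth : dominant th.
  move=> i; case: lerP => // lt0.
  have /mx : exists v, rt (sc i th) v by exists (sv i tv); apply: rt_step.
  by rewrite /sc htB ht_scoroot; lia.
exists th, tv; split=> // b w hb.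
have [c [v [hc cb dc mc]]] := rt_max_above hb.
suff le : nneg (th - c).
  by move=> j; rewrite -[th](subrK c) -addrA mxE; apply: addr_ge0.
have tpos := dominant_full hth dth; have cpos := dominant_full hc dc.
have [N [hN h2]] := rt_nrm hth; have [N' [hN' h2']] := rt_nrm hc.
have fpos : 0 < frm th c.
  have [i ci] : exists i, (A *m c) i ord0 != 0.
    apply: NNPP => no; case/eqP: (rt_neq0 hc); apply: A_inj; apply/matrixP => i j.
    by rewrite ord1 [RHS]mxE; apply/eqP/negPn/negP => ne; apply: no; exists i.
  have p k : 0 <= d k * th k ord0 * (A *m c) k ord0.
    by apply: mulr_ge0 => //; apply: mulr_ge0; apply: ltW.
  rewrite /frm (bigD1 i) //= ltr_pwDl ?sumr_ge0 //.
  by rewrite lt0r p andbT !mulf_neq0 // lt0r_neq0.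
have a0 : 0 < pairing tv (A *m c).
  by rewrite -(pmulr_rgt0 _ hN.1) (nrm_pairing _ hN).
have b0 : 0 < pairing v (A *m th).
  by rewrite -(pmulr_rgt0 _ hN'.1) (nrm_pairing _ hN') frm_sym.
have [_ _ _ []] := rt_CS hth hc.
- by move=> ->; move=> j; rewrite subrr mxE.
- by move=> e; have := tpos i0; rewrite e mxE oppr_gt0 ltNge ltW.
have E : nneg (c - th) -> nneg (th - c).
  move=> s; suff -> : c = th by move=> j; rewrite subrr mxE.
  have hle : ht (c - th) <= 0.
    by rewrite -[th]scale1r htB mul1r subr_le0; apply: mx; exists v.
  apply/eqP; rewrite -subr_eq0; apply/eqP/matrixP => i j; rewrite ord1 [RHS]mxE.
  apply/eqP; rewrite eq_le s andbT; apply: le_trans hle.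
  rewrite /ht (bigD1 i) //= -[leLHS]addr0; apply: lerD => //; exact: sumr_ge0.
(* Two positive integers with product at most 3: one of them is 1, and the corresponding reflection
   yields the difference of the two roots. *)
move=> le3; have : (pairing tv (A *m c) == 1) || (pairing v (A *m th) == 1) by nia.
case/orP=> /eqP e1; [have hr := rt_refl hth hc | have hr := rt_refl hc hth];
  rewrite e1 scale1r in hr; case: (rt_sign hr); rewrite ?opprB //; exact: E.
Qed.

(** * The affine Weyl group and its root system *)

Lemma pairingC (b l : vec) : pairing b l = pairing l b.
Proof. by apply: eq_bigr => i _; rewrite mulrC. Qed.

Lemma sP_sc j c : sP A j *m (A *m c) = A *m sc j c.
Proof. by rewrite /sP mul_rank1 pairing_scoroot /sc mulmxBr -scalemxAr mulA_scoroot. Qed.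

Lemma sQ_sv j v : sQ A j *m v = sv j v.
Proof. by rewrite /sQ mul_rank1 pairingC. Qed.

Lemma rt_word s c v : rt c v ->
  exists2 c', rt c' (wQ A s *m v) & A *m c' = wP A s *m (A *m c).
Proof.
move=> h; elim: s => [|j s [c' h' e]]; first by exists c; rewrite /= mul1mx.
exists (sc j c'); first by rewrite /= -mulmxA sQ_sv; apply: rt_step.
by rewrite /= -mulmxA -e sP_sc.
Qed.

Lemma word_of_rt c v : rt c v ->
  exists s i, wP A s *m sroot A i = A *m c /\ wQ A s *m scoroot i = v.
Proof.
elim=> [i|j {}c {}v _ [s [i [e1 e2]]]].
  by exists [::], i; rewrite /= !mul1mx mulA_scoroot.
by exists (j :: s), i; rewrite /= -!mulmxA e1 e2 sP_sc sQ_sv.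
Qed.

(** Both [epsilon] choices are legitimate by [highest_exists], after passing between [is_root] and
    the inductive pairs [rt]. *)
Lemma theta_spec : exists ct,
  [/\ rt ct (thetav A), A *m ct = theta A & forall c v, rt c v -> nneg (ct - c)].
Proof.
have hr : is_highest_root A (theta A).
  apply: epsilon_spec; have [c [v [h mx]]] := highest_exists.
  exists (A *m c); split.
    by have [s [i [e _]]] := word_of_rt h; exists s, i.
  move=> l [s [i <-]]; have [c' h' e] := rt_word s (rt_simple i).
  exists (c - c'); split; first exact: mx h'.
  by rewrite mulmxBr e mulA_scoroot.
have [s [i [e1 e2]]] : exists s i,
    wP A s *m sroot A i = theta A /\ wQ A s *m scoroot i = thetav A.
  apply: (epsilon_spec (inhabits 0) (fun v => exists s i,
    wP A s *m sroot A i = theta A /\ wQ A s *m scoroot i = v)).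
  by have [[s [i e]] _] := hr; exists (wQ A s *m scoroot i), s, i.
have [ct h e] := rt_word s (rt_simple i).
rewrite mulA_scoroot e1 in e; rewrite e2 in h.
exists ct; split=> // c v hc.
have [s' [i' [es _]]] := word_of_rt hc.
have [|c' [h0 e']] := hr.2 (A *m c); first by exists s', i'.
by move: e'; rewrite -e -mulmxBr => /A_inj2 <-.
Qed.

(* The simple affine roots [sl i + sk i delta] with coroots [sw i]. *)
Definition sl (i : option 'I_n) : vec := if i is Some i then sroot A i else - theta A.
Definition sk (i : option 'I_n) : int := if i is Some i then 0 else 1.
Definition sw (i : option 'I_n) : vec := if i is Some i then scoroot i else - thetav A.

Lemma sl_rt i : exists2 c, rt c (sw i) & A *m c = sl i.
Proof.
case: i => [i|] /=; first by exists (scoroot i); [exact: rt_simple | exact: mulA_scoroot].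
have [ct [h e _]] := theta_spec; exists (- ct); first exact: rt_opp.
by rewrite mulmxN e.
Qed.

Lemma sw_sl i : pairing (sw i) (sl i) = 2.
Proof. by have [c h <-] := sl_rt i; have [N []] := rt_nrm h. Qed.

(** The two signs cancel in the rank-one matrices, so s_0 follows the same formula as the finite
    generators and later proofs rarely separate the cases. *)
Lemma genWE i :
  genW A i = (1%:M - sl i *m (sw i)^T, 1%:M - sw i *m (sl i)^T, - (sk i *: sw i)).
Proof.
case: i => [i|] /=; first by rewrite scale0r oppr0.
have E (u v : vec) : (- u) *m (- v)^T = u *m v^T.
  by rewrite mulNmx [(- v)^T]raddfN mulmxN opprK.
by rewrite !E scale1r opprK.
Qed.

Local Notation W := (@wordW n A).
Local Notation Wn := (Waf n).
Implicit Types (g h : Wn).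

Lemma mulWA g h k : mulW g (mulW h k) = mulW (mulW g h) k.
Proof. by rewrite /mulW /= !mulmxA mulmxDr !mulmxA addrA. Qed.
Lemma mul1W g : mulW (oneW n) g = g.
Proof. by case: g => [[M M'] b]; rewrite /mulW /= !mul1mx add0r. Qed.
Lemma mulW1 g : mulW g (oneW n) = g.
Proof. by case: g => [[M M'] b]; rewrite /mulW /= !mulmx1 mulmx0 addr0. Qed.

Lemma wordW_cat s s' : W (s ++ s') = mulW (W s) (W s').
Proof. by elim: s => [|i s IH]; rewrite /= ?mul1W // IH mulWA. Qed.

(** [Waf] consists of all triples of two matrices and a vector; this condition makes the actions on
    P and Q^vee contragredient, which gives invariance of the pairing and inverses. *)
Definition gd g := g.1.2^T *m g.1.1 = 1%:M.

Lemma gd_mul g h : gd g -> gd h -> gd (mulW g h).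
Proof.
by rewrite /gd /= => hg hh; rewrite trmx_mul -mulmxA [g.1.2^T *m _]mulmxA hg mul1mx.
Qed.

Lemma rank1_invol (u v : vec) : pairing v u = 2 ->
  (1%:M - u *m v^T) *m (1%:M - u *m v^T) = 1%:M.
Proof.
move=> h; rewrite mulmxBr mulmx1 mulmxA mul_rank1 h.
rewrite scaler_nat mulr2n opprD addrA subrr sub0r mulNmx opprK.
exact: subrK.
Qed.

Lemma mulW_gen i : mulW (genW A i) (genW A i) = oneW n.
Proof.
have e := sw_sl i; have e' : pairing (sl i) (sw i) = 2 by rewrite pairingC.
rewrite genWE /mulW /= !rank1_invol // /oneW; congr (_, _, _).
rewrite mulmxN -scalemxAr mul_rank1 e' scaler_nat mulr2n opprD addrA subrr sub0r.
by rewrite scalerN opprK addNr.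
Qed.

Lemma gd_gen i : gd (genW A i).
Proof.
rewrite /gd genWE /= [(_ - _)^T]raddfB /= trmx1 trmx_mul trmxK rank1_invol //.
exact: sw_sl.
Qed.

Lemma gd_one : gd (oneW n). Proof. by rewrite /gd trmx1 mulmx1. Qed.

Lemma gd_word s : gd (W s).
Proof. by elim: s => [|i s IH]; [exact: gd_one | apply: gd_mul (gd_gen i) IH]. Qed.

Lemma wordW_rev s : mulW (W s) (W (rev s)) = oneW n.
Proof.
elim: s => [|i s IH]; first by rewrite mul1W.
rewrite rev_cons -cats1 wordW_cat /= mulW1 -mulWA [mulW (W s) _]mulWA IH mul1W.
exact: mulW_gen.
Qed.

Lemma wordW_revl s : mulW (W (rev s)) (W s) = oneW n.
Proof. by rewrite -{2}[s]revK wordW_rev. Qed.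

Lemma wordW_eq_rev s s' : W s = W s' -> W (rev s) = W (rev s').
Proof.
by move=> e; rewrite -[LHS]mulW1 -(wordW_rev s') -e mulWA wordW_revl mul1W.
Qed.

Lemma mulW_genK i g : mulW (genW A i) (mulW (genW A i) g) = g.
Proof. by rewrite mulWA mulW_gen mul1W. Qed.

Lemma mulW_wordI s g h : mulW (W s) g = mulW (W s) h -> g = h.
Proof.
by move=> e; rewrite -[g]mul1W -[h]mul1W -(wordW_revl s) -!mulWA e.
Qed.

(** Membership in W semidirect Q^vee: one word must produce both matrices, and the translation part
    is free. *)
Definition inW g := exists s, g.1.1 = wP A s /\ g.1.2 = wQ A s.

Lemma wP_cat s s' : wP A (s ++ s') = wP A s *m wP A s'.
Proof. by elim: s => [|i s IH]; rewrite /= ?mul1mx // IH mulmxA. Qed.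
Lemma wQ_cat s s' : wQ A (s ++ s') = wQ A s *m wQ A s'.
Proof. by elim: s => [|i s IH]; rewrite /= ?mul1mx // IH mulmxA. Qed.

Lemma wordW_Some s : W (map Some s) = (wP A s, wQ A s, 0).
Proof. by elim: s => //= i s IH; rewrite IH /mulW /= mulmx0 addr0. Qed.

Lemma inW_mul g h : inW g -> inW h -> inW (mulW g h).
Proof.
by move=> [s [e1 e2]] [s' [e3 e4]]; exists (s ++ s'); rewrite wP_cat wQ_cat /= e1 e2 e3 e4.
Qed.

Lemma rank1_conj (M M' : 'M[int]_n) (u v : vec) : M'^T *m M = 1%:M ->
  M *m (1%:M - u *m v^T) = (1%:M - (M *m u) *m (M' *m v)^T) *m M.
Proof.
move=> h; rewrite mulmxBr mulmx1 mulmxBl mul1mx; congr (_ - _).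
by rewrite trmx_mul -!mulmxA h mulmx1.
Qed.

Lemma gd_tr g : gd g -> g.1.1^T *m g.1.2 = 1%:M.
Proof. by move=> h; rewrite -[LHS]trmxK trmx_mul trmxK h trmx1. Qed.

(** For s_0: if theta = u alpha_i, then s_theta = u s_i u^{-1}. *)
Lemma inW_gen i : inW (genW A i).
Proof.
case: i => [i|]; first by exists [:: i]; rewrite /= !mulmx1.
have [ct [h e _]] := theta_spec.
have [s [i [e1 e2]]] := word_of_rt h.
rewrite e in e1; exists (s ++ i :: rev s).
have g1 := gd_word (map Some s); have g2 := gd_tr g1.
have := wordW_rev (map Some s); rewrite -map_rev !wordW_Some /mulW /= => -[r1 r2 _].
rewrite /gd wordW_Some /= in g1; rewrite wordW_Some /= in g2.
rewrite wP_cat wQ_cat /= !mulmxA /sP /sQ (rank1_conj _ _ g1) (rank1_conj _ _ g2).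
by rewrite e1 e2 -!mulmxA r1 r2 !mulmx1.
Qed.

Lemma inW_word s : inW (W s).
Proof.
elim: s => [|i s IH]; first by exists [::].
exact: inW_mul (inW_gen i) IH.
Qed.

Lemma rt_inW g c v : inW g -> rt c v ->
  exists2 c', rt c' (g.1.2 *m v) & A *m c' = g.1.1 *m (A *m c).
Proof. by move=> [s [-> ->]]; apply: rt_word. Qed.

(** * Affine roots, positivity and the exchange property *)

Local Notation aff := (vec * int)%type.
Implicit Types x y : aff.

(* [t_b w] acts on the affine root [l + k delta]. *)
Definition aact g x : aff := (g.1.1 *m x.1, x.2 - pairing g.2 (g.1.1 *m x.1)).
Definition simp i : aff := (sl i, sk i).
Definition acomb (a b : int) x y : aff := (a *: x.1 + b *: y.1, a * x.2 + b * y.2).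
Definition aopp x : aff := (- x.1, - x.2).
Definition aroot x := exists c v, rt c v /\ A *m c = x.1.
Definition apos x := 0 < x.2 \/ x.2 = 0 /\ exists c, nneg c /\ A *m c = x.1.

Lemma aact_mul g h x : gd g -> aact (mulW g h) x = aact g (aact h x).
Proof.
move=> hg; rewrite /aact /= -mulmxA; congr (_, _).
by rewrite pairingDl (pairing_mulmx _ _ hg) opprD addrA addrAC.
Qed.

Lemma aact1 x : aact (oneW n) x = x.
Proof.
case: x => l k; rewrite /aact /= !mul1mx pairingC pairingE mulmx0 mxE.
by rewrite subr0.
Qed.

Lemma aact_comb g a b x y : aact g (acomb a b x y) = acomb a b (aact g x) (aact g y).
Proof.
rewrite /aact /acomb /= !mulmxDr -!scalemxAr; congr (_, _).
rewrite pairingDr !pairingZr; ring.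
Qed.

Lemma aact_opp g x : aact g (aopp x) = aopp (aact g x).
Proof. by rewrite /aact /aopp /= !mulmxN pairingNr opprK opprD opprK. Qed.

Lemma aact_gen i x :
  aact (genW A i) x = acomb 1 (- pairing (sw i) x.1) x (simp i).
Proof.
rewrite genWE /aact /acomb /= mul_rank1 scale1r scaleNr; congr (_, _).
rewrite pairingNl pairingZl pairingBr pairingZr sw_sl; ring.
Qed.

Lemma aact_simp i : aact (genW A i) (simp i) = aopp (simp i).
Proof.
rewrite aact_gen /= sw_sl /acomb /aopp /= !scale1r; congr (_, _); last by ring.
by rewrite scaleNr scaler_nat mulr2n opprD addrA subrr sub0r.
Qed.

Lemma aroot_act g x : inW g -> aroot x -> aroot (aact g x).
Proof.
move=> hg [c [v [h e]]]; have [c' h' e'] := rt_inW hg h.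
by exists c', (g.1.2 *m v); rewrite /= -e.
Qed.

Lemma aroot_simp i : aroot (simp i).
Proof. by have [c h e] := sl_rt i; exists c, (sw i). Qed.

Lemma apos_dich x : aroot x -> apos x \/ apos (aopp x).
Proof.
move=> [c [v [h e]]]; case: (ltgtP x.2 0) => k.
- by right; left; rewrite /= oppr_gt0.
- by left; left.
- case: (rt_sign h) => s; [left|right]; right; split=> //=; rewrite ?k ?oppr0 //.
    by exists c.
  by exists (- c); rewrite mulmxN e.
Qed.

Lemma apos_excl x : aroot x -> apos x -> apos (aopp x) -> False.
Proof.
move=> [c [v [h e]]]; rewrite /apos /= oppr_gt0.
case=> [p|[k [c1 [n1 e1]]]]; case=> [p'|[k' [c2 [n2 e2]]]].
- by have := lt_trans p p'; rewrite ltxx.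
- by move: k' p => /eqP; rewrite oppr_eq0 => /eqP ->; rewrite ltxx.
- by move: p'; rewrite k ltxx.
case/eqP: (rt_neq0 h); rewrite -e in e1 e2.
have E1 := A_inj2 e1; rewrite -mulmxN in e2; have E2 := A_inj2 e2.
apply/matrixP => i j; rewrite ord1 [RHS]mxE; apply/eqP; rewrite eq_le.
by have := n1 i; have := n2 i; rewrite E1 E2 mxE oppr_ge0 => -> ->.
Qed.

Lemma apos_comb a b x y : 0 <= a -> 0 <= b -> apos x -> apos y -> apos (acomb a b x y).
Proof.
have ge0 z : apos z -> 0 <= z.2 by case=> [/ltW//|[-> _]].
move=> a0 b0 px py; have := ge0 _ px; have := ge0 _ py; move=> y0 x0.
have : 0 <= (acomb a b x y).2 by rewrite /= addr_ge0 // mulr_ge0.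
rewrite le0r => /orP[/eqP z0|gt0]; last by left.
right; split=> //=.
have part (e : int) z : 0 <= e -> apos z -> e * z.2 = 0 -> exists c, nneg c /\ A *m c = e *: z.1.
  move=> e0 pz /eqP; rewrite mulf_eq0 => /orP[/eqP->|/eqP z20].
    by exists 0; split; [move=> j; rewrite mxE | rewrite mulmx0 scale0r].
  case: pz => [|[_ [c [nc <-]]]]; first by rewrite z20 ltxx.
  exists (e *: c); split; last by rewrite -scalemxAr.
  by move=> j; rewrite mxE mulr_ge0.
have ax : 0 <= a * x.2 by apply: mulr_ge0.
have bx : 0 <= b * y.2 by apply: mulr_ge0.
move/eqP: z0; rewrite /= paddr_eq0 // => /andP[/eqP e1 /eqP e2].
have [c1 [n1 <-]] := part a x a0 px e1; have [c2 [n2 <-]] := part b y b0 py e2.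
exists (c1 + c2); split; last by rewrite mulmxDr.
by move=> j; rewrite mxE addr_ge0.
Qed.

Lemma apos_simp i : apos (simp i).
Proof.
case: i => [i|]; last by left.
right; split=> //; exists (scoroot i); split; last exact: mulA_scoroot.
by move=> j; rewrite scorootE; case: eqP.
Qed.

(** Coordinatewise consequences of maximality of theta, with t a coordinate of theta, c one of a
    root, and m the pairing of that root with theta^vee. *)
Lemma le0_of_neg (m t c : int) : m < 0 -> 0 <= t -> 0 <= c -> 0 <= (1 + m) * t - c -> c = 0.
Proof. by move=> m0 t0 c0 h; have h1 : (1 + m) * t <= 0; [nia | lia]. Qed.
Lemma eqN_of_neg (m t c : int) :
  m <= -2 -> 0 <= t -> 0 <= (1 + m) * t - c -> 0 <= t - - c -> c = - t.
Proof. by move=> m0 t0 h h'; have h1 : (1 + m) * t <= - t; [nia | lia]. Qed.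

Lemma subE (b c : vec) j : (b - c) j ord0 = b j ord0 - c j ord0.
Proof. by rewrite !mxE. Qed.
Lemma oppE (b : vec) j : (- b) j ord0 = - b j ord0.
Proof. by rewrite mxE. Qed.

(** The only coordinate of c and that of its coroot are integers with product 1. *)
Lemma rt_simple_multiple c v i : rt c v -> nneg c -> (forall j, j != i -> c j ord0 = 0) ->
  c = scoroot i.
Proof.
move=> h nc c0; have [N [hN h2]] := rt_nrm h.
have cE : c = c i ord0 *: scoroot i.
  apply/matrixP => j k; rewrite ord1 [RHS]mxE scorootE.
  by case: (eqVneq j i) => [->|/c0 ->]; rewrite ?mulr1 ?mulr0.
have ci : c i ord0 * v i ord0 = 1.
  move: h2; rewrite {1}cE -scalemxAr mulA_scoroot pairingZr => e.
  have := nrm_sroot i hN; rewrite {1}cE -scalemxAr mulA_scoroot mxE scoroot_sroot.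
  rewrite (_ : d i * (c i ord0 * 2) = 2 * (d i * c i ord0)); last by ring.
  rewrite -hN.2 (_ : 2 * (N * v i ord0) = N * (2 * v i ord0)); last by ring.
  move/(mulfI (lt0r_neq0 hN.1)) => e'; move: e; rewrite e'.
  by rewrite (_ : c i ord0 * (2 * v i ord0) = 2 * (c i ord0 * v i ord0)); [lia | ring].
have c1 : c i ord0 = 1.
  have := nc i; have : `|c i ord0|%N = 1%N.
    apply/eqP; rewrite -dvdn1; apply/dvdnP; exists `|v i ord0|%N.
    by rewrite mulnC -abszM ci.
  by lia.
by rewrite cE c1 scale1r.
Qed.

(** A finite s_i changes only the i-th coordinate, so any other nonzero coordinate keeps the root
    positive. For s_0 the level k becomes k + m; maximality of theta shows that the image can be
    negative only when the root is delta - theta. *)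
Lemma apos_gen i x : aroot x -> apos x -> x <> simp i -> apos (aact (genW A i) x).
Proof.
move=> [c [v [h e]]]; case: i => [i|] px ne.
- rewrite aact_gen /acomb /= mul1r mulr0 addr0 scale1r.
  case: px => [k|[k [c' [nc e']]]]; first by left.
  right; split=> //=; have Ec : c' = c by apply: A_inj2; rewrite e.
  rewrite {}Ec in nc e'.
  have scE : A *m sc i c = x.1 + - pairing (scoroot i) x.1 *: sroot A i.
    by rewrite -sP_sc e /sP mul_rank1 scaleNr.
  exists (sc i c); split=> //.
  case: (rt_sign (rt_step i h)) => // neg; case: ne.
  rewrite (surjective_pairing x) k -e; congr (_, _).
  rewrite /sl -mulA_scoroot; congr (_ *m _); apply: (rt_simple_multiple h nc) => j ji.
  apply/eqP; rewrite eq_le nc andbT; have := neg j.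
  by rewrite /sc mxE subZE scorootE (negbTE ji) mulr0 subr0 oppr_ge0.
- have [ct [hth et mx]] := theta_spec.
  have h' := rt_refl hth h; have ht' := mx _ _ h'.
  set m := pairing (thetav A) (A *m c) in h' ht'.
  have ctp : nneg ct.
    by move=> j; have := mx _ _ (rt_opp hth) j; rewrite opprK mxE -mulr2n pmulrn_lge0.
  have ctp' : exists j, 0 < ct j ord0.
    apply: NNPP => no; case/eqP: (rt_neq0 hth); apply/matrixP => j k; rewrite ord1 [RHS]mxE.
    by apply/eqP; rewrite eq_le ctp andbT leNgt; apply/negP => gt; apply: no; exists j.
  have [j0 j0p] := ctp'.
  have E : aact (genW A None) x = (A *m (c - m *: ct), x.2 + m).
    rewrite aact_gen /acomb /= pairingNl opprK -e -/m mul1r mulr1 scale1r; congr (_, _).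
    by rewrite mulmxBr -scalemxAr et scalerN.
  rewrite E.
  (* [ct - (c - m ct) >= 0] is the highest root property for the reflected root. *)
  have key j : 0 <= (1 + m) * ct j ord0 - c j ord0.
    by have := ht' j; rewrite subE subZE; lia.
  have pge : 0 <= x.2 by case: px => [/ltW|[->]].
  case: (ltrgt0P (x.2 + m)) => [gt0|lt0|z0].
  + by left.
  + exfalso.
    case: (ltrgt0P x.2) pge => // [k _|k _]; last first.
      case: px => [|[_ [c' [nc e']]]]; first by rewrite k ltxx.
      have Ec : c' = c by apply: A_inj2; rewrite e.
      rewrite {}Ec in nc; case/eqP: (rt_neq0 h); apply/matrixP => j l.
      rewrite ord1 (_ : (0 : vec) j ord0 = 0); last by rewrite mxE.
      by rewrite k add0r in lt0; apply: (le0_of_neg lt0 (ctp j) (nc j) (key j)).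
    have cE : c = - ct.
      apply/matrixP => j l; rewrite ord1 oppE.
      by apply: (eqN_of_neg (m := m) _ (ctp j) (key j));
        [lia | have := mx _ _ (rt_opp h) j; rewrite subE oppE].
    have m2 : m = -2.
      by rewrite /m cE mulmxN pairingNr; have [N [_ ->]] := rt_nrm hth.
    have k1 : x.2 = 1 by lia.
    by case: ne; rewrite (surjective_pairing x) k1 -e cE mulmxN et.
  + right; split=> //=; exists (c - m *: ct); split=> //.
    case: (ltrgt0P x.2) pge => // [k _|k _].
      case: (eqVneq m (-1)) => [m1|mn1].
        move=> j; rewrite subZE m1 mulN1r opprK.
        by have := mx _ _ (rt_opp h) j; rewrite subE oppE opprK addrC.
      have cE : c = - ct.
        apply/matrixP => j l; rewrite ord1 oppE.
        by apply: (eqN_of_neg (m := m) _ (ctp j) (key j));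
        [lia | have := mx _ _ (rt_opp h) j; rewrite subE oppE].
      have m2 : m = -2.
        by rewrite /m cE mulmxN pairingNr; have [N [_ ->]] := rt_nrm hth.
      by move=> j; rewrite subZE cE m2 oppE; have := ctp j; lia.
    have m0 : m = 0 by lia.
    rewrite m0 scale0r subr0.
    case: px => [|[_ [c' [nc e']]]]; first by rewrite k ltxx.
    by have <- : c' = c by apply: A_inj2; rewrite e.
Qed.

(** A conjugate of a reflection is the reflection in the image root; the coroot follows by [rt_uniq]
    and the translation part from the level. *)
Lemma gen_conj g i j : gd g -> inW g -> aact g (simp i) = simp j ->
  mulW g (genW A i) = mulW (genW A j) g.
Proof.
move=> hg iW [e1 e2].
have [c h e] := sl_rt i; have [c' h' e'] := rt_inW iW h; have [c'' h'' e''] := sl_rt j.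
have ec : c' = c'' by apply: A_inj2; rewrite e' e e1 e''.
rewrite {}ec in h'; have ew : g.1.2 *m sw i = sw j := rt_uniq h' h''.
rewrite !genWE /mulW /=; congr (_, _, _).
- by rewrite (rank1_conj _ _ hg) e1 ew.
- by rewrite (rank1_conj _ _ (gd_tr hg)) e1 ew.
- rewrite mulmxN -scalemxAr ew mul_rank1 -e2 e1 pairingC scalerBl.
  by rewrite opprB [RHS]addrC addrA subrK.
Qed.

(** Apply the letters of s one at a time: the root can turn negative only at a letter whose simple
    root it has just become. *)
Lemma exch s x : aroot x -> apos x -> ~ apos (aact (W (rev s)) x) ->
  exists s1 i s2, s = s1 ++ i :: s2 /\ aact (W (rev s1)) x = simp i.
Proof.
elim: s x => [|i s IH] x rx px npx; first by case: npx; rewrite /= aact1.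
case: (classic (x = simp i)) => [->|ne].
  by exists [::], i, s; rewrite /= aact1.
have E t : aact (W (rev (i :: t))) x = aact (W (rev t)) (aact (genW A i) x).
  by rewrite rev_cons -cats1 wordW_cat aact_mul ?[W [:: i]]mulW1 //; apply: gd_word.
rewrite E in npx.
have [s1 [j [s2 [-> e]]]] := IH _ (aroot_act (inW_gen i) rx) (apos_gen rx px ne) npx.
by exists (i :: s1), j, s2; rewrite E.
Qed.

(** * Reduced words *)

(** Left descent in geometric form; [rev s] represents the inverse, and the condition depends only
    on the group element. *)
Definition desc s i := ~ apos (aact (W (rev s)) (simp i)).

Lemma desc_eq s s' i : W s = W s' -> desc s i -> desc s' i.
Proof. by rewrite /desc => /wordW_eq_rev ->. Qed.

Lemma descP s i : desc s i -> apos (aopp (aact (W (rev s)) (simp i))).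
Proof.
by move=> h; case: (apos_dich (aroot_act (inW_word (rev s)) (aroot_simp i))).
Qed.

(** The letter found by [exch] is conjugate to s_j by the prefix before it; moved to the front, it
    cancels s_j. *)
Lemma exchange s j : desc s j -> exists s', size s = (size s').+1 /\ W (j :: s) = W s'.
Proof.
move=> h; have [s1 [i [s2 [-> e]]]] := exch (aroot_simp j) (apos_simp j) h.
exists (s1 ++ s2); split; first by rewrite !size_cat /= addnS.
have e' : aact (W s1) (simp i) = simp j.
  by rewrite -e -aact_mul ?wordW_rev ?aact1 //; apply: gd_word.
have E := gen_conj (gd_word s1) (inW_word s1) e'.
by rewrite /= !wordW_cat /= [LHS]mulWA -E -mulWA mulW_genK.
Qed.

Local Notation red := (@is_reduced n A).

Lemma red_behead i s : red (i :: s) -> red s.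
Proof. by move=> h s' e; have := h (i :: s'); rewrite /= e ltnS; apply. Qed.

Lemma red_suffix s s' : red (s ++ s') -> red s'.
Proof. by elim: s => //= i s IH /red_behead. Qed.

Lemma red_head i s : red (i :: s) -> desc (i :: s) i.
Proof.
move=> h; rewrite /desc rev_cons -cats1 wordW_cat aact_mul; last exact: gd_word.
rewrite /= mulW1 aact_simp aact_opp => neg.
have [|s' [ss' e]] := @exchange s i.
  move=> pos; apply: (apos_excl _ pos neg).
  by apply: aroot_act (aroot_simp i); apply: inW_word.
by have := h s' (esym e); rewrite /= ss' ltnNge leqnSn.
Qed.

Lemma red_desc s i : red s -> desc s i ->
  exists r, [/\ W (i :: r) = W s, red (i :: r) & size s = (size r).+1].
Proof.
move=> rs /exchange [r [sr e]]; exists r.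
have e' : W (i :: r) = W s by rewrite /= -e /= mulW_genK.
by split=> // s'; rewrite e' => /rs; rewrite sr.
Qed.

(** A shorter word for the product would have [i] as a descent, and the exchange property would then
    give a word for W(s) shorter than s. *)
Lemma red_cons s i : red s -> ~ desc s i -> red (i :: s).
Proof.
move=> rs nd s' e; rewrite leqNgt; apply/negP => lt.
have e' : W (i :: s') = W s by rewrite /= e /= mulW_genK.
have : desc s' i.
  move=> pos; apply: nd => neg.
  have := wordW_eq_rev e'; rewrite rev_cons -cats1 wordW_cat /= mulW1 => er.
  move: neg; rewrite /desc -er aact_mul; last exact: gd_word.
  rewrite aact_simp aact_opp; apply: apos_excl pos.
  by apply: aroot_act (aroot_simp i); apply: inW_word.
case/exchange => r [sr er]; have := rs r; rewrite -er e' => /(_ erefl) le.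
by move: lt le; rewrite /= sr; lia.
Qed.

Lemma red_exists s : exists r, W r = W s /\ red r.
Proof.
have [k] := ubnP (size s); elim: k s => // k IH s lt.
case: (classic (red s)) => [rs|nr]; first by exists s.
have [s' [e lt']] : exists s', W s' = W s /\ (size s' < size s)%N.
  apply: NNPP => no; apply: nr => s' e; rewrite leqNgt; apply/negP => l; apply: no.
  by exists s'.
have [|r [er rr]] := IH s'; first by apply: leq_trans lt' _; rewrite -ltnS.
by exists r; rewrite er.
Qed.

(** * Two simultaneous descents and rank-two subgroups *)

Section Rank2.
Variables i j : option 'I_n.
Let p := - pairing (sw i) (sl j).
Let q := - pairing (sw j) (sl i).

Definition letter (b : bool) := if b then i else j.
(** The two reflections in coordinates on the simple affine roots of i and j, with p and q the
    negated off-diagonal Cartan entries. Rank-two facts thus become evaluations on integers. *)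
Definition r2 (p q : int) (b : bool) (z : int * int) :=
  if b then (p * z.2 - z.1, z.2) else (z.1, q * z.1 - z.2).
Definition act2 p q (w : seq bool) z := foldr (r2 p q) z w.
Definition base2 (b : bool) : int * int := if b then (1, 0) else (0, 1).
Definition emb2 (z : int * int) := acomb z.1 z.2 (simp i) (simp j).

Lemma emb2_base b : emb2 (base2 b) = simp (letter b).
Proof.
case: b; rewrite /emb2 /acomb /simp /= scale0r scale1r ?addr0 ?add0r; congr (_, _); ring.
Qed.

Lemma aact_emb2_gen b z : aact (genW A (letter b)) (emb2 z) = emb2 (r2 p q b z).
Proof.
case: z => a c; rewrite aact_gen /emb2 /acomb /simp /=.
case: b => /=; rewrite pairingDr !pairingZr sw_sl.
- rewrite -[pairing (sw i) (sl j)]opprK -/p scale1r; congr (_, _); last by ring.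
  by rewrite addrAC -scalerDl; congr (_ *: _ + _); ring.
- rewrite -[pairing (sw j) (sl i)]opprK -/q scale1r; congr (_, _); last by ring.
  by rewrite -addrA -scalerDl; congr (_ + _ *: _); ring.
Qed.

Lemma aact_emb2 w z : aact (W (map letter w)) (emb2 z) = emb2 (act2 p q w z).
Proof.
elim: w => [|b w IH]; first by rewrite /= aact1.
by rewrite [W _]/= aact_mul ?IH ?aact_emb2_gen //; apply: gd_gen.
Qed.

(* Every proper prefix of [w] sends the next simple root to a nonnegative combination. *)
Definition okw p q w := all (fun k =>
  let z := act2 p q (take k w) (base2 (nth true w k)) in (0 <= z.1) && (0 <= z.2))
  (iota 0 (size w)).

(** Moved back through the prefix already split off, the next simple root is a nonnegative
    combination of those of i and j. The inverse of W(s) makes both negative, so the next letter is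
    a descent of the remainder. *)
Lemma desc_prefix s w : red s -> desc s i -> desc s j -> okw p q w ->
  exists r, W s = W (map letter w ++ r) /\ size s = (size w + size r)%N.
Proof.
move=> rs di dj ok.
suff H k : (k <= size w)%N ->
    exists r, W s = W (map letter (take k w) ++ r) /\ size s = (k + size r)%N.
  by have [r] := H _ (leqnn _); rewrite take_size; exists r.
elim: k => [|k IH] kw; first by exists s; rewrite take0.
have [r [er sr]] := IH (ltnW kw).
set P := map letter (take k w) in er *; set b := nth true w k.
have rr : red r.
  apply: (@red_suffix P); move=> s'; rewrite -er => /rs.
  by rewrite sr size_cat size_map size_takel // ltnW.
have db : desc r (letter b).
  have ki : k \in iota 0 (size w) by rewrite mem_iota add0n.
  have /andP[z1 z2] := allP ok k ki.
  move=> pos; apply: (@apos_excl (aact (W (rev r)) (simp (letter b)))) => //.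
    by apply: aroot_act (aroot_simp _); apply: inW_word.
  have -> : aact (W (rev r)) (simp (letter b)) =
      aact (W (rev s)) (emb2 (act2 p q (take k w) (base2 b))).
    rewrite (wordW_eq_rev er) rev_cat wordW_cat -aact_emb2 emb2_base -/P.
    rewrite aact_mul; last exact: gd_word.
    congr (aact _ _); rewrite -aact_mul; last exact: gd_word.
    by rewrite wordW_revl aact1.
  rewrite -aact_opp; set z := act2 _ _ _ _.
  have -> : aopp (emb2 z) = acomb z.1 z.2 (aopp (simp i)) (aopp (simp j)).
    by rewrite /aopp /emb2 /acomb /= !scalerN !mulrN -!opprD.
  by rewrite aact_comb !aact_opp; apply: apos_comb => //; apply: descP.
have [r' [er' rr' sr']] := red_desc rr db.
exists r'; rewrite (take_nth true) // map_rcons cat_rcons -/b -/P.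
by rewrite er !wordW_cat er' sr sr' addnS.
Qed.

(** A braid relation in the form u s_b = s_b' u, checked on a single root. *)
Lemma braid_word u b b' : act2 p q u (base2 b) = base2 b' ->
  W (map letter (rcons u b)) = W (map letter (b' :: u)).
Proof.
move=> e; rewrite map_rcons -cats1 wordW_cat /= mulW1.
apply: gen_conj; [exact: gd_word | exact: inW_word |].
by rewrite -!emb2_base aact_emb2 e.
Qed.
End Rank2.

Lemma sw_sl_le0 i j : i != j -> pairing (sw i) (sl j) <= 0.
Proof.
have [ct [h e mx]] := theta_spec; have [N [hN _]] := rt_nrm h.
have dom k : 0 <= (A *m ct) k ord0.
  have := mx _ _ (rt_step k h) k; rewrite subE subZE scorootE eqxx mulr1.
  by rewrite opprB addrC subrK.
case: i j => [i|] [j|] //= ne.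
- by rewrite pairing_scoroot mxE Aoff //; apply: contra ne => /eqP ->.
- by rewrite pairing_scoroot oppE oppr_le0 -e.
- rewrite pairingNl oppr_le0 -(pmulr_rge0 _ hN.1) (nrm_sroot _ hN).
  by apply: mulr_ge0 => //; apply: ltW.
Qed.

Definition cartan_pairs : seq (int * int) :=
  [:: (0, 0); (1, 1); (1, 2); (2, 1); (1, 3); (3, 1)].

(** Cauchy-Schwarz bounds the product of the Cartan entries by 3 unless the finite parts are
    opposite, which is affine A1. Equal finite parts cannot occur, as -theta is not a simple root.
    The remaining pairs are A1 x A1, A2, C2 and G2. *)
Lemma rank2_cases i j : i != j ->
  (sl i = - sl j /\ sk i + sk j = 1) \/
  (- pairing (sw i) (sl j), - pairing (sw j) (sl i)) \in cartan_pairs.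
Proof.
move=> ne; have p0 := sw_sl_le0 ne; have q0 : pairing (sw j) (sl i) <= 0.
  by apply: sw_sl_le0; rewrite eq_sym.
have [c h e] := sl_rt i; have [c' h' e'] := sl_rt j.
have [_ _ z0] := rt_CS h h'; rewrite e e' in z0 *.
have [ct [hth et mx]] := theta_spec.
have thN k : theta A <> - sroot A k.
  rewrite -mulA_scoroot -et -mulmxN => /A_inj2 E.
  have := mx _ _ (rt_simple k) k; rewrite E subE oppE scorootE eqxx; lia.
case=> [E|E|le3].
- exfalso; have : sl i = sl j by rewrite -e -e' E.
  case: i j ne {h h' e e' p0 q0 z0 E} => [i|] [j|] //= ne.
  + rewrite -!mulA_scoroot => /A_inj2/matrixP/(_ i ord0); rewrite !scorootE eqxx.
    by case: (i =P j) ne => [->|//]; rewrite eqxx.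
  + by move/esym/eqP; rewrite eqr_oppLR => /eqP /thN.
  + by move/eqP; rewrite eqr_oppLR => /eqP /thN.
- left; have E' : sl i = - sl j by rewrite -e -e' E mulmxN.
  split=> //; case: i j ne E' {h h' e e' p0 q0 z0 E} => [i|] [j|] //= ne.
  rewrite -!mulA_scoroot -mulmxN => /A_inj2/matrixP/(_ i ord0).
  by rewrite oppE !scorootE eqxx; case: eqP.
- right; rewrite !inE !xpair_eqE; move: p0 q0 z0 le3.
  move: (pairing _ _) (pairing _ _) => a b a0 b0 z0 le3.
  case: (eqVneq a 0) z0 => [->|an0] z0; first by have /eqP -> : b == 0 by rewrite z0.
  have bn0 : b != 0 by apply/negP => b0'; move: z0; rewrite b0'.
  have a1 : a <= -1 by lia.
  have b1 : b <= -1 by lia.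
  have a3 : -3 <= a by nia.
  have b3 : -3 <= b by nia.
  have /or3P ea : [|| a == -1, a == -2 | a == -3] by lia.
  have /or3P eb : [|| b == -1, b == -2 | b == -3] by lia.
  by move: le3; case: ea => /eqP ->; case: eb => /eqP ->.
Qed.

(** The two simple roots add up to delta, which the group fixes: their images have levels adding up
    to 1, so they cannot both be negative. *)
Lemma desc_finite s i j : desc s i -> desc s j -> sl i = - sl j -> sk i + sk j = 1 -> False.
Proof.
have le0 x : apos (aopp x) -> x.2 <= 0.
  by case=> [/ltW|[/eqP]] /=; rewrite ?oppr_ge0 // oppr_eq0 => /eqP ->.
move=> /descP/le0 di /descP/le0 dj e k; move: di dj.
rewrite /aact /= e mulmxN pairingNr opprK.
by move: (pairing _ _) (sk i) (sk j) k => a b c; lia.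
Qed.

(** * Finiteness of W and its longest element *)

Lemma mx_col_ext (M M' : 'M[int]_n) :
  (forall j, M *m scoroot j = M' *m scoroot j) -> M = M'.
Proof.
move=> h; apply/matrixP => i j; have /matrixP/(_ i ord0) := h j.
by rewrite -!colE !mxE.
Qed.

Lemma gd_uniq g h : gd g -> gd h -> g.1.2 = h.1.2 -> g.1.1 = h.1.1.
Proof.
rewrite /gd => hg hh e; have e' := mulmx1C hg.
by rewrite -[h.1.1]mul1mx -e' -mulmxA e hh mulmx1.
Qed.

(** The suffixes of a reduced word represent distinct elements, and each is determined by its images
    of the simple roots, whose weight coordinates take 9 values. *)
Lemma red_Some_bounded : exists B, forall s : seq 'I_n, red (map Some s) -> (size s <= B)%N.
Proof.
exists #|{ffun 'I_n * 'I_n -> 'I_9}| => s rs.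
pose col k j := wP A (drop k s) *m sroot A j.
pose f (k : 'I_(size s).+1) : {ffun 'I_n * 'I_n -> 'I_9} :=
  [ffun ij => inord (absz (col k ij.2 ij.1 ord0 + 4)%R)].
have colE' k j : exists2 c, rt c (wQ A (drop k s) *m scoroot j) & A *m c = col k j.
  have [c h e] := rt_word (drop k s) (rt_simple j).
  by exists c; rewrite // e mulA_scoroot.
have fE k i j : ((f k (i, j))%:Z = col k j i ord0 + 4)%R.
  have [c h e] := colE' k j; have := rt_box i h; rewrite e ffunE /=.
  by move: (col k j i ord0) => z hz; rewrite inordK; lia.
suff finj : injective f.
  by have := leq_card f finj; rewrite card_ord => /ltnW.
suff H k l : f k = f l -> (l <= k)%N.
  by move=> k l e; apply/val_inj/eqP; rewrite eqn_leq !H.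
move=> e.
have eQ : wQ A (drop k s) = wQ A (drop l s).
  apply: mx_col_ext => j; have [c h ec] := colE' k j; have [c' h' ec'] := colE' l j.
  have cc : c = c'.
    apply: A_inj2; rewrite ec ec'; apply/matrixP => i z; rewrite ord1.
    by apply: (addIr 4); rewrite -!fE e.
  by rewrite cc in h; apply: rt_uniq h h'.
have eW : W (map Some (drop l s)) = W (map Some (drop k s)).
  have g1 := gd_word (map Some (drop k s)); have g2 := gd_word (map Some (drop l s)).
  have := gd_uniq g1 g2; rewrite !wordW_Some /= => -> //.
  by rewrite eQ.
have rk : red (map Some (drop k s)).
  by apply: (@red_suffix (map Some (take k s))); rewrite -map_cat cat_take_drop.
have := rk _ eW; rewrite !size_map !size_drop.
by have := ltn_ord k; have := ltn_ord l; lia.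
Qed.

Lemma w0_word_spec : red (map Some (w0_word A)) /\
  forall s : seq 'I_n, red (map Some s) -> (size s <= size (w0_word A))%N.
Proof.
apply: (epsilon_spec (inhabits [::]) (fun s : seq 'I_n => red (map Some s) /\
    forall s' : seq 'I_n, red (map Some s') -> (size s' <= size s)%N)).
have [B hB] := red_Some_bounded.
have [||s [rs mx]] := @max_exists _ (fun s : seq 'I_n => red (map Some s)) (fun s => (size s)%:Z) B.
- by exists [::].
- by move=> s /hB; lia.
by exists s; split=> // s' /mx; lia.
Qed.

Lemma w0_desc i : desc (map Some (w0_word A)) (Some i).
Proof.
have [rs mx] := w0_word_spec; apply: NNPP => nd.
by have := mx (i :: w0_word A) (red_cons rs nd); rewrite /= ltnn.
Qed.

(** * Translations as words in the generators *)

Definition inT b := exists s, W s = transl b.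

Lemma transl_add (b b' : vec) : mulW (transl b) (transl b') = transl (b + b').
Proof. by rewrite /mulW /transl /= !mul1mx. Qed.

Lemma inT0 : inT 0. Proof. by exists [::]. Qed.

Lemma inT_add b b' : inT b -> inT b' -> inT (b + b').
Proof. by move=> [s e] [s' e']; exists (s ++ s'); rewrite wordW_cat e e' transl_add. Qed.

Lemma wordW_rev_transl s b : W s = transl b -> W (rev s) = transl (- b).
Proof.
move=> e; apply: (@mulW_wordI s); rewrite wordW_rev e transl_add subrr.
by [].
Qed.

Lemma inT_opp b : inT b -> inT (- b).
Proof. by move=> [s e]; exists (rev s); apply: wordW_rev_transl. Qed.

Lemma inT_scale (a : int) b : inT b -> inT (a *: b).
Proof.
move=> h; have N k : inT (k%:Z *: b).
  elim: k => [|k IH]; first by rewrite scale0r; apply: inT0.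
  by rewrite intS scalerDl scale1r; apply: inT_add.
case: a => k; first exact: N.
by rewrite NegzE scaleNr; apply: inT_opp.
Qed.

Lemma inT_conj u b : inT b -> inT (wQ A u *m b).
Proof.
move=> [s e]; exists (map Some u ++ s ++ rev (map Some u)).
rewrite !wordW_cat e mulWA.
apply: (@mulW_wordI (rev (map Some u))); rewrite !mulWA wordW_revl mul1W.
have := wordW_revl (map Some u); rewrite -map_rev !wordW_Some /mulW /transl /= => -[e1 e2 _].
by rewrite !mulmx1 !mul1mx !addr0 add0r mulmxA e2 mul1mx.
Qed.

Lemma inT_thetav : inT (thetav A).
Proof.
have [s [e1 e2]] := inW_gen None; exists (None :: map Some s).
have := mulW_gen None; rewrite [W _]/= wordW_Some /mulW /oneW /transl.
move=> -[m1 m2 _]; rewrite -e1 -e2 mulmx0 addr0.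
by congr (_, _, _).
Qed.

(** For a pairing at most -2, maximality of theta, applied to the reflected root and to the opposite
    root, leaves only -theta; the case at least 2 follows by passing to -c. *)
Lemma theta_pairing c v : rt c v ->
  [\/ `|pairing (thetav A) (A *m c)| <= 1, A *m c = theta A | A *m c = - theta A].
Proof.
move=> h; have [ct [hth et mx]] := theta_spec.
have ctp : nneg ct.
  by move=> j; have := mx _ _ (rt_opp hth) j; rewrite opprK mxE -mulr2n pmulrn_lge0.
have H (x u : vec) : rt x u -> pairing (thetav A) (A *m x) <= -2 -> x = - ct.
  move=> hx m2; apply/matrixP => j l; rewrite ord1 oppE.
  apply: (eqN_of_neg m2 (ctp j)).
    have := mx _ _ (rt_refl hth hx) j; rewrite subE subZE.
    by move: (pairing _ _) => m; congr (0 <= _); ring.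
  by have := mx _ _ (rt_opp hx) j; rewrite subE oppE.
case: (lerP `|pairing (thetav A) (A *m c)| 1) => [|gt]; first by constructor 1.
case: (lerP (pairing (thetav A) (A *m c)) (-2)) => [le|gt2].
  by constructor 3; rewrite (H _ _ h le) mulmxN et.
constructor 2; rewrite -[c]opprK (H _ _ (rt_opp h)) ?opprK //.
by rewrite mulmxN pairingNr; move: (pairing _ _) gt gt2 => m; lia.
Qed.

(** Some conjugate x = u theta^vee pairs nontrivially with alpha_i. If the pairing is 1 or -1, then
    x - s_i x is alpha_i^vee up to sign; otherwise [theta_pairing] makes alpha_i^vee equal to x or
    -x. *)
Lemma inT_scoroot i : inT (scoroot i).
Proof.
have [ct [hth et mx]] := theta_spec.
pose P k := forall u, pairing (wQ A u *m thetav A) (sroot A k) = 0.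
(* [S] collects the simple roots orthogonal to the whole orbit of theta^vee. Applying s_l with l
   outside [S] forces A_lk = 0 for k in [S], so [S] is empty or everything, and the latter would
   give theta = 0. *)
pose S := [set k | if excluded_middle_informative (P k) then true else false].
have inS k : k \in S <-> P k.
  by rewrite inE; case: excluded_middle_informative.
have S0 : S = set0.
  case: (indec (S := S)) => // [k l kS lS|ST].
  - have nP : ~ P l by move=> /inS; apply/negP.
    have [u hu] : exists u, pairing (wQ A u *m thetav A) (sroot A l) <> 0.
      by apply: NNPP => no; apply: nP => u; apply: NNPP => ne; apply: no; exists u.
    have Pk := (inS k).1 kS; have := Pk (l :: u); rewrite /= -mulmxA sQ_sv.
    rewrite /sv pairingBl Pk pairingZl pairing_scoroot mxE sub0r => /eqP.
    rewrite oppr_eq0 mulf_eq0 => /orP[/eqP //|/eqP Alk].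
    apply: (mulfI (lt0r_neq0 (d_gt0 k))); rewrite dA Alk !mulr0 //.
  - have [N [hN _]] := rt_nrm hth.
    case/eqP: (rt_neq0 hth); apply: A_inj; apply/matrixP => k l.
    rewrite ord1 [RHS]mxE; apply: (mulfI (lt0r_neq0 (d_gt0 k))).
    rewrite -(nrm_sroot k hN); have kS : k \in S by rewrite ST inE.
    by have := (inS k).1 kS [::]; rewrite /= mul1mx => ->; rewrite !mulr0.
have [u hu] : exists u, pairing (wQ A u *m thetav A) (sroot A i) <> 0.
  apply: NNPP => no; have : i \in S; last by rewrite S0 inE.
  by apply/inS => u; apply: NNPP => ne; apply: no; exists u.
have Tu : inT (wQ A u *m thetav A) := inT_conj u inT_thetav.
have gu := gd_word (map Some u); rewrite /gd wordW_Some /= in gu.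
have [c hc ec] := rt_word (rev u) (rt_simple i).
have [e1 e2] : wP A u *m wP A (rev u) = 1%:M /\ wQ A u *m wQ A (rev u) = 1%:M.
  by have := wordW_rev (map Some u); rewrite -map_rev !wordW_Some /mulW => -[].
have xE : pairing (wQ A u *m thetav A) (sroot A i) = pairing (thetav A) (A *m c).
  by rewrite ec mulA_scoroot -[RHS](pairing_mulmx _ _ gu) [wP A u *m _]mulmxA e1 mul1mx.
have back : wQ A u *m (wQ A (rev u) *m scoroot i) = scoroot i by rewrite mulmxA e2 mul1mx.
case: (theta_pairing hc) => [le1|E|E].
- have Ts : inT (sv i (wQ A u *m thetav A)).
    by have := inT_conj (i :: u) inT_thetav; rewrite /= -mulmxA sQ_sv.
  rewrite -xE in le1; rewrite /sv in Ts.
  have := inT_add Tu (inT_opp Ts); rewrite opprB addrC subrK => Tx.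
  move: hu le1 Tx; move: (pairing _ _) => x hu le1 Tx.
  have xx : x * x = 1 by nia.
  by have := inT_scale x Tx; rewrite scalerA xx scale1r.
- have cE : c = ct by apply: A_inj2; rewrite E.
  by rewrite cE in hc; rewrite -back (rt_uniq hc hth).
- have cE : c = - ct by apply: A_inj2; rewrite E mulmxN et.
  by rewrite cE in hc; rewrite -back (rt_uniq hc (rt_opp hth)) mulmxN; apply: inT_opp.
Qed.

(** This guarantees that [Dw (transl b)] is built from an actual word. *)
Lemma transl_word b : inT b.
Proof.
have -> : b = \sum_i b i ord0 *: scoroot i.
  apply/matrixP => i j; rewrite (ord1 j) summxE (bigD1 i) //= big1 => [|k /negbTE nk].
    by rewrite mxE scorootE eqxx mulr1 addr0.
  by rewrite mxE scorootE eq_sym nk mulr0.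
elim/big_rec: _ => [|i x _ hx]; first exact: inT0.
by apply: inT_add => //; apply: inT_scale; apply: inT_scoroot.
Qed.

(** The inverse translation sends alpha_i to alpha_i + <b, alpha_i> delta, of negative level: strict
    antidominance enters here. *)
Lemma transl_desc b s i : W s = transl b -> pairing b (sroot A i) < 0 -> desc s (Some i).
Proof.
move=> e lt0; rewrite /desc (wordW_rev_transl e) /aact /simp /= mul1mx pairingNl opprK add0r.
by case=> /= [gt0|[e0 _]]; [have := lt_trans lt0 gt0 | move: lt0; rewrite e0]; rewrite ltxx.
Qed.

(** * Matsumoto's theorem for the Demazure operators *)

Lemma gd_unimod g : gd g -> unimod g.1.1.
Proof. by move=> h; exists g.1.2^T. Qed.

Definition xl i : CP n := eexp (sl i).
Definition al i : CP n -> CP n := actF (genW A i).1.1.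
Definition Sop i := twist (al i) (mulW (genW A i)).
Definition Dop i := dop (xl i) (al i) (mulW (genW A i)).
Definition Dops s f := foldr Dop f s.

Lemma al_eexp i l : al i (eexp l) = eexp (l - pairing (sw i) l *: sl i).
Proof.
rewrite /al; have [_ _ _ _ ->] := actFP (gd_unimod (gd_gen i)).
by rewrite genWE /= mul_rank1.
Qed.

Lemma al_invol i : involutive (al i).
Proof.
move=> f; rewrite /al -actFM; try exact: gd_unimod (gd_gen i).
have := mulW_gen i; rewrite /mulW /oneW => -[-> _ _]; exact: actF1.
Qed.

Lemma mulW_invol i : involutive (mulW (genW A i)).
Proof. exact: mulW_genK. Qed.

Lemma al_rmorph i : exists f : {rmorphism CP n -> CP n}, (f : CP n -> CP n) = al i.
Proof. exact: Waction_rmorph (actFP (gd_unimod (gd_gen i))). Qed.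

Lemma al_xl i : al i (xl i) = (xl i)^-1.
Proof.
rewrite al_eexp sw_sl -eexpN; congr (eexp _).
by rewrite scaler_nat mulr2n opprD addrA subrr sub0r.
Qed.

Lemma sl_neq0 i : sl i != 0.
Proof.
apply/eqP => e; have := sw_sl i; rewrite e pairingE mulmx0 mxE.
by [].
Qed.

Lemma one_sub_xl i : 1 - xl i != 0.
Proof. by rewrite subr_eq0 eq_sym eexp_eq1 sl_neq0. Qed.

(** The operators S form a group action, so their braid relations are just equalities in the affine
    Weyl group. These are the input for the braid relations of the D_i. *)
Lemma Sops_word s f :
  foldr Sop f s = fun k => actF (W s).1.1 (f (mulW (W (rev s)) k)).
Proof.
apply: functional_extensionality; elim: s => [|i s IH] k.
  by rewrite /= mul1W actF1.
rewrite /= /Sop /twist IH /al -actFM; try exact: gd_unimod; last first.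
- exact: gd_unimod (gd_word s).
- exact: gd_unimod (gd_gen i).
by rewrite rev_cons -cats1 wordW_cat /= mulW1 mulWA.
Qed.

Lemma Sops_eq s s' : W s = W s' -> forall f, foldr Sop f s = foldr Sop f s'.
Proof. by move=> e f; rewrite !Sops_word e (wordW_eq_rev e). Qed.

Section Rank2Braid.
Variables i j : option 'I_n.
Local Notation L := (letter i j).

Lemma al_xl2 (P : nat) : - pairing (sw i) (sl j) = P -> al i (xl j) = xl i ^+ P * xl j.
Proof.
by move=> e; rewrite al_eexp -scaleNr e eexpD eexpZ -exprnP mulrC.
Qed.

(** It suffices that a sl_i + b sl_j pairs nontrivially with one of the two coroots; the pairings
    are 2a - pb and 2b - qa. *)
Lemma one_sub_xl2 (a b : nat) (p q : int) :
  - pairing (sw i) (sl j) = p -> - pairing (sw j) (sl i) = q ->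
  (2 * a%:Z != p * b%:Z) || (2 * b%:Z != q * a%:Z) ->
  1 - xl i ^+ a * xl j ^+ b != 0.
Proof.
move=> ep eq ne; rewrite subr_eq0 eq_sym -!eexpMn -eexpD eexp_eq1.
apply/eqP => z; case/orP: ne; case/eqP.
- have := f_equal (pairing (sw i)) z.
  rewrite pairingDr -!scaler_nat !natz !pairingZr sw_sl -[pairing (sw i) (sl j)]opprK ep.
  rewrite [RHS]pairingE mulmx0 mxE mulrN => /eqP.
  by rewrite subr_eq0 mulrC [b%:Z * _]mulrC => /eqP.
- have := f_equal (pairing (sw j)) z.
  rewrite pairingDr -!scaler_nat !natz !pairingZr sw_sl -[pairing (sw j) (sl i)]opprK eq.
  rewrite [RHS]pairingE mulmx0 mxE mulrN addrC => /eqP.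
  by rewrite subr_eq0 mulrC [a%:Z * _]mulrC => /eqP.
Qed.
End Rank2Braid.

(** The two sides of a braid relation, one starting with i and one with j, together with what
    [desc_prefix] needs to split each of them off a reduced word. *)
Definition braidable i j (p q : int) := exists u1 u2 : seq bool,
  [/\ okw p q (true :: u1), okw p q (false :: u2), size u1 = size u2,
      W (map (letter i j) (true :: u1)) = W (map (letter i j) (false :: u2)) &
      forall f, Dops (map (letter i j) (true :: u1)) f = Dops (map (letter i j) (false :: u2)) f].

Lemma Dops_braid i j p q : - pairing (sw i) (sl j) = p -> - pairing (sw j) (sl i) = q ->
  (p, q) \in cartan_pairs -> braidable i j p q.
Proof.
move=> ep eq.
have [sg esg] := al_rmorph i; have [ta eta] := al_rmorph j.
have sgsg : involutive sg by rewrite esg; apply: al_invol.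
have tata : involutive ta by rewrite eta; apply: al_invol.
have sgx : sg (xl i) = (xl i)^-1 by rewrite esg al_xl.
have tay : ta (xl j) = (xl j)^-1 by rewrite eta al_xl.
have x0 : xl i != 0 := eexp_neq0 _; have y0 : xl j != 0 := eexp_neq0 _.
have hx := one_sub_xl i; have hy := one_sub_xl j.
have ss := mulW_invol i; have tt := mulW_invol j.
have sgP P : p = Posz P -> sg (xl j) = xl i ^+ P * xl j.
  by move=> eP; rewrite esg; apply: al_xl2; rewrite ep.
have taQ Q : q = Posz Q -> ta (xl i) = xl j ^+ Q * xl i.
  by move=> eQ; rewrite eta; apply: al_xl2; rewrite eq.
have nz a b : (2 * a%:Z != p * b%:Z) || (2 * b%:Z != q * a%:Z) -> 1 - xl i ^+ a * xl j ^+ b != 0.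
  exact: one_sub_xl2.
have brW u b b' := @braid_word i j u b b'; rewrite ep eq in brW.
have nz11 := nz 1%N 1%N; have nz21 := nz 2%N 1%N; have nz12 := nz 1%N 2%N.
have nz31 := nz 3%N 1%N; have nz13 := nz 1%N 3%N; have nz32 := nz 3%N 2%N; have nz23 := nz 2%N 3%N.
rewrite !expr1 in nz11 nz21 nz12 nz31 nz13.
pose tw b := twist (if b then sg : CP n -> CP n else ta) (mulW (genW A (letter i j b))).
have eSop w f : foldr Sop f (map (letter i j) w) = foldr tw f w.
  by elim: w => //= b w ->; case: b; rewrite /tw /Sop /= ?esg ?eta.
have eS w w' : W (map (letter i j) w) = W (map (letter i j) w') ->
    forall f, foldr tw f w = foldr tw f w'.
  by move=> e f; rewrite -!eSop; apply: Sops_eq.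
have eD w f : Dops (map (letter i j) w) f = foldr (fun b => dop (xl (letter i j b))
    (if b then sg : CP n -> CP n else ta) (mulW (genW A (letter i j b)))) f w.
  by elim: w => //= b w ->; case: b; rewrite /Dop /= ?esg ?eta.
rewrite /braidable; clear nz ep eq.
rewrite !inE !xpair_eqE.
case/or4P=> [| | |/or3P[]] /andP[/eqP p1 /eqP q1]; subst p q.
- exists [:: false], [:: true].
  have e := brW [:: true] false false erefl.
  split; [by [] | by [] | by [] | exact: e | move=> f; rewrite !eD].
  have := sgP 0%N erefl; have := taQ 0%N erefl; rewrite !expr0 !mul1r => tax sgy.
  apply: (dop_braid2 hx hy sgy tax); exact: (eS _ _ e).
- exists [:: false; true], [:: true; false].
  have e := brW [:: true; false] true false erefl.
  split; [by [] | by [] | by [] | exact: e | move=> f; rewrite !eD].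
  have := sgP 1%N erefl; have := taQ 1%N erefl; rewrite !expr1 [xl j * _]mulrC => tax sgy.
  by apply: (dop_braid3 sgsg tata ss tt sgx tay x0 y0 hx hy sgy tax (eS _ _ e)); apply: nz11.
- exists [:: false; true; false], [:: true; false; true].
  have e := brW [:: true; false; true] false false erefl.
  split; [by [] | by [] | by [] | exact: e | move=> f; rewrite !eD].
  have := sgP 1%N erefl; have := taQ 2%N erefl; rewrite expr1 [xl i * _]mulrC => tax sgy.
  (* For (p, q) = (1, 2) the short root belongs to j, so the type C2 relation is used with the
     reflections exchanged. *)
  apply/esym.
  apply: (dop_braid4 tata sgsg tt ss tay sgx y0 x0 hy hx tax sgy (eS _ _ (esym e)));
    rewrite [X in 1 - X]mulrC; [exact: nz11 | exact: nz12].
- exists [:: false; true; false], [:: true; false; true].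
  have e := brW [:: true; false; true] false false erefl.
  split; [by [] | by [] | by [] | exact: e | move=> f; rewrite !eD].
  have := sgP 2%N erefl; have := taQ 1%N erefl; rewrite expr1 [xl j * _]mulrC => tax sgy.
  apply: (dop_braid4 sgsg tata ss tt sgx tay x0 y0 hx hy sgy tax (eS _ _ e));
    [exact: nz11 | exact: nz21].
- exists [:: false; true; false; true; false], [:: true; false; true; false; true].
  have e := brW [:: true; false; true; false; true] false false erefl.
  split; [by [] | by [] | by [] | exact: e | move=> f; rewrite !eD].
  have := sgP 1%N erefl; have := taQ 3%N erefl; rewrite expr1 [xl i * _]mulrC => tax sgy.
  apply/esym.
  apply: (dop_braid6 tata sgsg tt ss tay sgx y0 x0 hy hx tax sgy (eS _ _ (esym e)));
    rewrite [X in 1 - X]mulrC; [exact: nz11 | exact: nz12 | exact: nz13 | exact: nz23].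
- exists [:: false; true; false; true; false], [:: true; false; true; false; true].
  have e := brW [:: true; false; true; false; true] false false erefl.
  split; [by [] | by [] | by [] | exact: e | move=> f; rewrite !eD].
  have := sgP 3%N erefl; have := taQ 1%N erefl; rewrite expr1 [xl j * _]mulrC => tax sgy.
  apply: (dop_braid6 sgsg tata ss tt sgx tay x0 y0 hx hy sgy tax (eS _ _ e));
    [exact: nz11 | exact: nz21 | exact: nz31 | exact: nz32].
Qed.

(* Matsumoto: along two reduced words starting with distinct letters, the common
   element also has a reduced word starting with each side of the braid relation. *)
Theorem Dops_reduced s s' : red s -> red s' -> W s = W s' ->
  forall f, Dops s f = Dops s' f.
Proof.
have [k] := ubnP (size s); elim: k s s' => // k IH s s' lt rs rs' e f.
have sz : size s = size s'.
  by apply/eqP; rewrite eqn_leq (rs _ (esym e)) (rs' _ e).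
case: s s' rs rs' e sz lt => [|i t] [|j t'] // rs rs' e [sz] lt.
rewrite /= ltnS in lt.
have rt' := red_behead rs; have rt'' := red_behead rs'.
case: (eqVneq i j) => [ij|ij].
  subst j; rewrite /=; congr (Dop _ _); apply: IH => //.
  by have := f_equal (mulW (genW A i)) e; rewrite /= !mulW_genK.
have di := red_head rs; have dj := desc_eq (esym e) (red_head rs').
case: (rank2_cases ij) => [[e1 e2]|cp]; first by case: (desc_finite di dj e1 e2).
have [u1 [u2 [ok1 ok2 su eW eD]]] := Dops_braid erefl erefl cp.
have [r1 [er1 sr1]] := desc_prefix rs di dj ok1.
have [r2 [er2 sr2]] := desc_prefix rs di dj ok2.
have red_of w r : W (i :: t) = W (map (letter i j) w ++ r) ->
    size (i :: t) = (size w + size r)%N -> red (map (letter i j) w ++ r).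
  by move=> ew sw x; rewrite -ew => /rs; rewrite sw size_cat size_map.
have rr1 := red_of _ _ er1 sr1; have rr2 := red_of _ _ er2 sr2.
have sz1 : size t = (size u1 + size r1)%N by case: sr1.
have sz2 : size t = (size u2 + size r2)%N by case: sr2.
have E1 : Dops t =1 Dops (map (letter i j) u1 ++ r1).
  move=> g; apply: IH => //; first exact: (red_behead rr1).
  by have := f_equal (mulW (genW A i)) er1; rewrite /= !mulW_genK.
have E2 : Dops t' =1 Dops (map (letter i j) u2 ++ r2).
  move=> g; apply: IH => //; first by rewrite -sz.
    exact: (red_behead rr2).
  by rewrite e in er2; have := f_equal (mulW (genW A j)) er2; rewrite /= !mulW_genK.
(* Both braid words represent the same element, so the remainders do as well; being shorter, they
   fall under the induction hypothesis. *)
have E3 : Dops r1 =1 Dops r2.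
  move=> g; apply: IH; [by apply: leq_trans lt; rewrite sz1; lia | exact: red_suffix rr1
    | exact: red_suffix rr2 |].
  have := er1; rewrite er2 !wordW_cat -eW => /mulW_wordI; exact: esym.
have cat w r phi : Dops (w ++ r) phi = Dops w (Dops r phi) by rewrite /Dops foldr_cat.
rewrite -[LHS]/(Dop i (Dops t f)) -[RHS]/(Dop j (Dops t' f)) E1 E2 !cat E3.
exact: eD.
Qed.

(** * The Pontryagin product *)

Local Notation Ae := (Aelt n).
Local Notation mulA := (@Defs.mulA n).
Local Notation addA := (@Defs.addA n).
Local Notation iotaD := (@Defs.iotaD n).
Implicit Types a b e : Ae.

Lemma eqA_sym a b : eqA a b -> eqA b a. Proof. by move=> h g. Qed.
Lemma eqA_trans b a e : eqA a b -> eqA b e -> eqA a e.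
Proof. by move=> h h' g; rewrite h h'. Qed.

Lemma coefAE a k : coefA a k = \sum_(p <- a) (if p.2 == k then p.1 else 0).
Proof. by rewrite /coefA big_mkcond. Qed.

Definition lin a (F : Wn -> CP n) := \sum_(p <- a) p.1 * F p.2.

Lemma lin_coefA a F (U : seq Wn) : uniq U -> {subset map snd a <= U} ->
  lin a F = \sum_(g <- U) coefA a g * F g.
Proof.
move=> uU sU; under [RHS]eq_bigr do rewrite coefAE mulr_suml.
rewrite exchange_big /= /lin big_seq [RHS]big_seq; apply: eq_bigr => p pa.
have pU : p.2 \in U by apply: sU; apply: map_f.
rewrite (bigD1_seq p.2) //= eqxx big1 ?addr0 // => g /negbTE ng.
by rewrite eq_sym ng mul0r.
Qed.

(** Any functional linear in the coefficients factors through [coefA]. Compatibility of the product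
    on the left and of [prA] with [eqA] follows by choosing [F]. *)
Lemma eqA_lin a b F : eqA a b -> lin a F = lin b F.
Proof.
move=> h; set U := undup (map snd (a ++ b)).
have uU : uniq U := undup_uniq _.
rewrite (@lin_coefA a F U) // ?(@lin_coefA b F U) //.
- by apply: eq_bigr => g _; rewrite h.
- by move=> g hg; rewrite mem_undup map_cat mem_cat hg orbT.
- by move=> g hg; rewrite mem_undup map_cat mem_cat hg.
Qed.

Lemma sum_mulA a b (G : CP n * Wn -> CP n) :
  \sum_(x <- mulA a b) G x =
  \sum_(p <- a) \sum_(q <- b) G (p.1 * actF p.2.1.1 q.1, mulW p.2 q.2).
Proof. by rewrite /mulA big_allpairs_dep. Qed.

Lemma eqA_mull a a' b : eqA a a' -> eqA (mulA a b) (mulA a' b).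
Proof.
move=> h k; rewrite !coefAE !sum_mulA /=.
pose F g := \sum_(q <- b) (if mulW g q.2 == k then actF g.1.1 q.1 else 0).
have E (x : Ae) : \sum_(p <- x) \sum_(q <- b)
    (if mulW p.2 q.2 == k then p.1 * actF p.2.1.1 q.1 else 0) = lin x F.
  apply: eq_bigr => p _; rewrite /F mulr_sumr; apply: eq_bigr => q _.
  by case: ifP; rewrite ?mulr0.
by rewrite !E; apply: eqA_lin.
Qed.

Lemma eqA_add a a' b b' : eqA a a' -> eqA b b' -> eqA (addA a b) (addA a' b').
Proof. by move=> h h' k; move: (h k) (h' k); rewrite /coefA !big_cat /= => -> ->. Qed.

Lemma eqA_pr a b : eqA a b -> eqA (prA a) (prA b).
Proof.
move=> h k; rewrite !coefAE /prA !big_map /=.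
have E (x : Ae) : \sum_(p <- x) (if transl p.2.2 == k then p.1 else 0 : CP n) =
    lin x (fun g => if transl g.2 == k then 1 else 0).
  by apply: eq_bigr => p _; case: ifP; rewrite ?mulr1 ?mulr0.
by rewrite !E; apply: eqA_lin.
Qed.

(** A list may carry labels outside the affine Weyl group, where [actF] and inverses are
    uncontrolled. Associativity and compatibility on the right require this condition. *)
Definition allW a := forall p, p \in a -> inW p.2.

Lemma inW_gd g : inW g -> gd g.
Proof.
by move=> [s [e1 e2]]; have := gd_word (map Some s); rewrite /gd wordW_Some e1 e2.
Qed.

Lemma inW_transl (b : vec) : inW (transl b). Proof. by exists [::]. Qed.

Lemma allW_add a b : allW a -> allW b -> allW (addA a b).
Proof. by move=> h h' p; rewrite mem_cat => /orP[/h|/h']. Qed.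

Lemma allW_mul a b : allW a -> allW b -> allW (mulA a b).
Proof.
by move=> h h' p /allpairsP[[x y] /= [/h hx /h' hy ->]] /=; apply: inW_mul.
Qed.

Lemma allW_pr a : allW (prA a).
Proof. by move=> p /mapP[q _ ->]; apply: inW_transl. Qed.

Lemma allW_one (f : CP n) : allW [:: (f, oneW n)].
Proof. by move=> p; rewrite inE => /eqP ->; apply: inW_transl. Qed.

Lemma allW_iotaD i : allW (iotaD A i).
Proof.
by move=> p; rewrite !inE => /orP[] /eqP -> /=; [apply: inW_transl | apply: inW_gen].
Qed.

Lemma allW_Dword s : allW (Dword A s).
Proof.
by elim: s => [|i s IH]; [apply: allW_one | apply: allW_mul => //; apply: allW_iotaD].
Qed.

Definition invW g : Wn := (g.1.2^T, g.1.1^T, - (g.1.1^T *m g.2)).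

Lemma mulWV g : gd g -> mulW g (invW g) = oneW n.
Proof.
move=> h; rewrite /mulW /invW /=.
rewrite (mulmx1C h) (mulmx1C (gd_tr h)) mulmxN mulmxA (mulmx1C (gd_tr h)) mul1mx subrr.
by [].
Qed.

Lemma mulVW g : gd g -> mulW (invW g) g = oneW n.
Proof. by move=> h; rewrite /mulW /invW /= h gd_tr // addNr. Qed.

Lemma mulW_eq g h k : gd g -> (mulW g h == k) = (h == mulW (invW g) k).
Proof.
move=> hg; apply/eqP/eqP => [<-|->]; first by rewrite mulWA mulVW ?mul1W.
by rewrite mulWA mulWV ?mul1W.
Qed.

Lemma coefA_mul a b k : allW a -> coefA (mulA a b) k =
  \sum_(p <- a) p.1 * actF p.2.1.1 (coefA b (mulW (invW p.2) k)).
Proof.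
move=> ha; rewrite coefAE sum_mulA big_seq [RHS]big_seq; apply: eq_bigr => p /ha /inW_gd hp.
have H := actFP (gd_unimod hp); have [aD _ _ _ _] := H.
rewrite coefAE (big_morph _ aD (Waction0 H)) mulr_sumr; apply: eq_bigr => q _ /=.
by rewrite mulW_eq //; case: ifP; rewrite ?(Waction0 H) ?mulr0.
Qed.

Lemma eqA_mulr a b b' : allW a -> eqA b b' -> eqA (mulA a b) (mulA a b').
Proof.
by move=> ha h k; rewrite !coefA_mul //; apply: eq_bigr => p _; rewrite h.
Qed.

Lemma mulAA a b e : allW a -> allW b -> eqA (mulA (mulA a b) e) (mulA a (mulA b e)).
Proof.
move=> ha hb k; rewrite !coefAE !sum_mulA big_seq [RHS]big_seq.
apply: eq_bigr => p /ha /inW_gd hp.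
rewrite sum_mulA big_seq [RHS]big_seq; apply: eq_bigr => q /hb /inW_gd hq.
apply: eq_bigr => r _ /=; rewrite mulWA.
have [_ aM _ _ _] := actFP (gd_unimod hp).
by rewrite aM actFM ?mulrA //; apply: gd_unimod.
Qed.

Lemma invW_gen i : invW (genW A i) = genW A i.
Proof.
rewrite -[LHS]mulW1 -(mulW_gen i) mulWA mulVW ?mul1W //; exact: gd_gen.
Qed.

Lemma iotaDE i : iotaD A i = [:: ((1 - xl i)^-1, oneW n); (- (xl i / (1 - xl i)), genW A i)].
Proof. by case: i. Qed.

(** The bridge from the algebra to the operators on coefficient functions. *)
Lemma coefA_iotaD i b : coefA (mulA (iotaD A i) b) = Dop i (coefA b).
Proof.
apply: functional_extensionality => k; rewrite coefA_mul; last exact: allW_iotaD.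
rewrite iotaDE big_cons big_seq1 /= actF1 invW_gen /Dop /dop.
by rewrite (_ : invW (oneW n) = oneW n) ?mul1W // -[LHS]mulW1 mulVW //; apply: gd_one.
Qed.

Lemma coefA_Dword s b : coefA (mulA (Dword A s) b) = Dops s (coefA b).
Proof.
elim: s => [|i s IH].
  apply: functional_extensionality => k; rewrite coefA_mul; last exact: allW_one.
  rewrite /oneA big_seq1 /= mul1r actF1.
  by rewrite (_ : invW (oneW n) = oneW n) ?mul1W // -[LHS]mulW1 mulVW //; apply: gd_one.
rewrite -[Dops _ _]/(Dop i (Dops s (coefA b))) -IH -coefA_iotaD.
apply: functional_extensionality => k; apply: mulAA; [exact: allW_iotaD | exact: allW_Dword].
Qed.

Lemma coefA_Dword1 s : coefA (Dword A s) = Dops s (coefA (oneA n)).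
Proof. by elim: s => //= i u IH; rewrite coefA_iotaD IH. Qed.

Lemma Dword_reduced s s' : red s -> red s' -> W s = W s' -> eqA (Dword A s) (Dword A s').
Proof. by move=> rs rs' e k; rewrite !coefA_Dword1 (Dops_reduced rs rs' e). Qed.

(** * Left invariance and the projection [prA] *)

Definition Winv a := forall i, Sop (Some i) (coefA a) = coefA a.

(** By Matsumoto the reduced word may be taken to start with the descent [i], and the image of
    [Dop i] is fixed by [Sop i]. *)
Lemma Dops_desc s i f : red s -> desc s i -> Sop i (Dops s f) = Dops s f.
Proof.
move=> rs ds; have [r [e rr _]] := red_desc rs ds.
rewrite (Dops_reduced rs rr (esym e)) -[Dops _ _]/(Dop i (Dops r f)) /Sop /Dop.
have [sg esg] := al_rmorph i; rewrite -esg.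
apply: twist_dop; [| exact: mulW_invol | | exact: eexp_neq0 | exact: one_sub_xl].
- by rewrite esg; apply: al_invol.
- by rewrite esg; apply: al_xl.
Qed.

(** In each term f t_b w of h, the finite factor w is absorbed by the invariant a. *)
Lemma Winv_pr (h : Ae) a : allW h -> Winv a -> eqA (mulA h a) (mulA (prA h) a).
Proof.
move=> hh ia k; rewrite !coefA_mul //; last exact: allW_pr.
rewrite /prA big_map big_seq [RHS]big_seq; apply: eq_bigr => p /hh [u [e1 e2]] /=.
congr (_ * _); rewrite actF1 e1.
have fix_u : foldr Sop (coefA a) (map Some u) = coefA a.
  by elim: u {e1 e2} => //= i u ->; apply: ia.
rewrite -[RHS](f_equal (fun f => f _) fix_u) Sops_word wordW_Some /=.
congr (actF _ (coefA a _)); rewrite mulWA; congr (mulW _ k).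
have gp : gd p.2 by apply: inW_gd; exists u.
apply: (@mulW_wordI (map Some u)).
rewrite mulWA wordW_rev mul1W wordW_Some.
have -> : invW (transl p.2.2) = transl (- p.2.2).
  by rewrite /invW /transl /= !trmx1 mul1mx.
have -> : ((wP A u, wQ A u, 0) : Wn) = mulW (transl (- p.2.2)) p.2.
  by rewrite /mulW /transl /= !mul1mx e1 e2 addNr.
by rewrite -mulWA mulWV // mulW1.
Qed.

(** [prA] is linear over the translation subalgebra: translations act trivially on P and only add to
    the translation part. *)
Lemma pr_mul (h : Ae) a : eqA (prA (mulA (prA h) a)) (mulA (prA h) (prA a)).
Proof.
move=> k; rewrite !coefAE /prA big_map /= !sum_mulA !big_map; apply: eq_bigr => p _ /=.
rewrite big_map; apply: eq_bigr => q _ /=.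
by rewrite transl_add !mul1mx.
Qed.

Lemma pr_comm a b : eqA (mulA (prA a) (prA b)) (mulA (prA b) (prA a)).
Proof.
move=> k; rewrite !coefAE !sum_mulA /prA !big_map /=.
under eq_bigr do rewrite big_map /=.
under [RHS]eq_bigr do rewrite big_map /=.
rewrite exchange_big; apply: eq_bigr => p _; apply: eq_bigr => q _ /=.
by rewrite !transl_add !actF1 mulrC addrC.
Qed.

(** The rule [inH_eq] can introduce cancelling terms with labels outside the group, so only some
    representative has good labels. *)
Lemma inH_allW (h : Ae) : inH A h -> exists2 h', eqA h h' & allW h'.
Proof.
elim=> [c|l|i|a b _ [a' ea ha] _ [b' eb hb]|a b _ [a' ea ha] _ [b' eb hb]|a b e _ [a' ea ha]].
- by exists [:: (cst n c, oneW n)] => //; apply: allW_one.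
- by exists (iotaE l) => //; apply: allW_one.
- by exists (iotaD A i) => //; apply: allW_iotaD.
- by exists (addA a' b'); [apply: eqA_add | apply: allW_add].
- exists (mulA a' b'); last exact: allW_mul.
  by apply: eqA_trans (eqA_mull _ ea) _; apply: eqA_mulr.
- by exists a' => //; apply: eqA_trans ea; apply: eqA_sym.
Qed.

Lemma inH_Dword s : inH A (Dword A s).
Proof.
elim: s => [|i s IH]; last by apply: inH_mul => //; apply: inH_D.
by have := inH_e A (0 : vec); rewrite /iotaE eexp0.
Qed.

Local Notation D0 := (Dw A (w0 A)).

Lemma Dw_spec g : (exists s, W s = g) -> exists s, [/\ W s = g, red s & Dw A g = Dword A s].
Proof.
move=> [s e]; have [r [er rr]] := red_exists s.
have [e1 e2] := epsilon_spec (inhabits [::]) (fun s => wordW A s = g /\ is_reduced A s)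
  (ex_intro _ r (conj (etrans er e) rr)).
by exists (epsilon (inhabits [::]) (fun s => wordW A s = g /\ is_reduced A s)).
Qed.

(** The word picked by [Dw] could a priori contain the letter 0; Matsumoto replaces it by [w0_word],
    whose letters are finite, as the computation of its projection requires. *)
Lemma D0_spec : [/\ allW D0, Winv D0 & eqA D0 (Dword A (map Some (w0_word A)))].
Proof.
have [|s [e rs ->]] := @Dw_spec (w0 A); first by exists (map Some (w0_word A)).
have [rw mx] := w0_word_spec.
split; first exact: allW_Dword.
- move=> i; rewrite coefA_Dword1; apply: Dops_desc => //.
  by apply: (@desc_eq (map Some (w0_word A))); [rewrite e | exact: w0_desc].
- exact: Dword_reduced.
Qed.

(** All labels have trivial translation part, so only the sum of the coefficients remains. It is the
    word of D_i applied to the constant 1, and D_i 1 = 1/(1 - x) - x/(1 - x) = 1. *)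
Lemma pr_Dword_Some (u : seq 'I_n) : eqA (prA (Dword A (map Some u))) (oneA n).
Proof.
have [h1 h2] : (forall p, p \in Dword A (map Some u) -> p.2.2 = 0) /\
    \sum_(p <- Dword A (map Some u)) p.1 = 1.
  elim: u => [|i u [IH1 IH2]]; first by split=> [p|]; rewrite ?big_seq1 // inE => /eqP ->.
  split.
    move=> p /allpairsP[[x y] /= [hx /IH1 hy ->]] /=; rewrite hy mulmx0 addr0.
    by move: hx; rewrite !inE => /orP[] /eqP ->.
  rewrite [Dword _ _]/= sum_mulA iotaDE big_cons big_seq1 /=.
  have H := actFP (gd_unimod (gd_gen (Some i))); have [aD _ a1 _ _] := H.
  rewrite -!mulr_sumr -(big_morph _ aD (Waction0 H)) IH2 a1.
  under eq_bigr do rewrite actF1.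
  rewrite IH2 !mulr1 -{1}[_^-1]mul1r -mulrBl divff //; exact: one_sub_xl.
move=> k; rewrite !coefAE /prA big_map big_seq1 /= -h2.
rewrite (_ : \sum_(j <- Dword A (map Some u)) _ =
  \sum_(j <- Dword A (map Some u)) (if oneW n == k then j.1 else 0)).
  by case: ifP => // _; rewrite big1.
by rewrite big_seq [RHS]big_seq; apply: eq_bigr => p /h1 /= ->.
Qed.

Lemma pr_D0 : eqA (prA D0) (oneA n).
Proof.
by have [_ _ /eqA_pr h] := D0_spec; apply: eqA_trans h (pr_Dword_Some _).
Qed.

Lemma pr_mul1 (h : Ae) : eqA (mulA (prA h) (oneA n)) (prA h).
Proof.
move=> k; rewrite !coefAE sum_mulA /prA !big_map /=; apply: eq_bigr => p _.
by rewrite big_seq1 /= actF1 mulr1 mulW1.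
Qed.

Lemma pr_D0_mul (h : Ae) : allW h -> eqA (prA (mulA h D0)) (prA h).
Proof.
have [_ i0 _] := D0_spec => hh.
apply: eqA_trans (eqA_pr (Winv_pr hh i0)) _.
apply: eqA_trans (pr_mul _ _) _.
by apply: eqA_trans (eqA_mulr (@allW_pr _) pr_D0) (pr_mul1 _).
Qed.

Lemma inK_pr (x : Ae) : inK A x -> eqA x (mulA (prA x) D0).
Proof.
move=> [h [/inH_allW [h' e hh] ex]]; have [_ i0 _] := D0_spec.
have ex' : eqA x (mulA h' D0) by apply: eqA_trans ex (eqA_mull _ e).
apply: (eqA_trans ex'); apply: eqA_trans (Winv_pr hh i0) _; apply: eqA_mull.
by apply: eqA_sym; apply: eqA_trans (eqA_pr ex') (pr_D0_mul hh).
Qed.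

Section Pontryagin.
Variable b0 : vec.
Hypothesis b0_neg : forall j, pairing b0 (sroot A j) < 0.
Local Notation O := (OGr A b0).

Lemma OGr_spec : Winv O /\ exists2 t, inH A t /\ allW t & O = mulA t D0.
Proof.
have [|s [e rs Dt]] := @Dw_spec (transl b0); first exact: transl_word.
rewrite /OGr Dt; split.
  by move=> i; rewrite coefA_Dword; apply: Dops_desc => //; apply: transl_desc e _.
by exists (Dword A s) => //; split; [exact: inH_Dword | exact: allW_Dword].
Qed.

(** The candidate h O lies in K and has the projection required of the product, by commutativity of
    the translation subalgebra. So the choice in [pont] is legitimate, and injectivity of [prA] on K
    identifies it with h O. *)
Lemma pont_OGr (h x : Ae) : inH A h -> allW h -> eqA x (mulA h D0) ->
  eqA (pont A O x) (mulA h O).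
Proof.
move=> Hh hh ex; have [iO [t [Ht tW] eO]] := OGr_spec.
have prO : eqA (prA (mulA h O)) (mulA (prA O) (prA x)).
  apply: eqA_trans (eqA_pr (Winv_pr hh iO)) _; apply: eqA_trans (pr_mul _ _) _.
  apply: eqA_trans (pr_comm _ _) _; apply: eqA_mulr; first exact: allW_pr.
  by apply: eqA_sym; apply: eqA_trans (eqA_pr ex) (pr_D0_mul hh).
have KO : inK A (mulA h O).
  exists (mulA h t); split; first exact: inH_mul.
  by rewrite eO; apply: eqA_sym; apply: mulAA.
have [KP eP] := epsilon_spec (inhabits [::])
  (fun c : Ae => inK A c /\ eqA (prA c) (mulA (prA O) (prA x))) (ex_intro _ _ (conj KO prO)).
apply: eqA_trans (inK_pr KP) _; apply: eqA_trans _ (eqA_sym (inK_pr KO)).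
by apply: eqA_mull; apply: eqA_trans eP (eqA_sym prO).
Qed.

(** If x = h D_{w0}, then D_i x = (D_i h) D_{w0}; both sides are D_i h O. *)
Lemma Dact_pont i (x : Ae) : inK A x -> eqA (Dact A i (pont A O x)) (pont A O (Dact A i x)).
Proof.
move=> [h [Hh ex]]; have [h' e hh] := inH_allW Hh.
have Hh' : inH A h' by apply: inH_eq e Hh.
have ex' : eqA x (mulA h' D0) by apply: eqA_trans ex (eqA_mull _ e).
have iW : allW (iotaD A i) := @allW_iotaD i.
apply: eqA_trans (eqA_mulr iW (pont_OGr Hh' hh ex')) _; apply: eqA_sym.
apply: eqA_trans _ (mulAA _ iW hh); apply: pont_OGr.
- by apply: inH_mul => //; apply: inH_D.
- exact: allW_mul.
- by apply: eqA_trans (eqA_mulr iW ex') _; apply: eqA_sym; apply: mulAA.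
Qed.
End Pontryagin.

End Roots.

Theorem theorem2p7 (n : nat) (A : 'M[int]_n) :
  (0 < n)%N -> finite_type_cartan A -> indecomposable_cartan A ->
  forall b : 'cV[int]_n, (forall j, pairing b (sroot A j) < 0) ->
  forall (i : option 'I_n) (xi : Aelt n), inK A xi ->
  eqA (Dact A i (pont A (OGr A b) xi)) (pont A (OGr A b) (Dact A i xi)).
Proof.
move=> n_gt0 [A2 Aoff _ [d [d_gt0 dA posdef]]] indec b b_neg i xi.
exact: (Dact_pont A2 Aoff d_gt0 dA posdef n_gt0 indec b_neg).
Qed.
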